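(* Let $X$ be an SMD random variable such that $K_{2n}(X)K_{2n+2}(X)<0$ for every integer $n\ge1$. If $Y$ is a centred real random variable admitting moments of all orders such that $K_4(Y)K_4(X)>0$ and $\mathit{mmse}(X,s)=\mathit{mmse}(Y,s)$ for all $s>0$, then $X$ and $Y$ have the same distribution.
   Context: For a real random variable $X$ with moments of all orders, its cumulants are $K_n(X)=(-i)^n(\ln\varphi_X)^{(n)}(0)$, $\varphi_X$ the characteristic function. $X$ is called SMD if $X$ and $-X$ have the same law, $X$ has moments of all orders, and any random variable $Y$ with $\mathbb{E}[Y^p]=\mathbb{E}[X^p]$ for all $p\ge1$ has the same law as $X$. For $s>0$, $\mathit{mmse}(X,s)=\mathbb{E}[(X-\mathbb{E}[X\mid Y_s])^2]$ where $Y_s=\sqrt{s}X+N$ and $N$ is a standard Gaussian independent of $X$. *)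

(* Defs.v *)
From HB Require Import structures.
From mathcomp Require Import all_boot all_order all_algebra.
From mathcomp Require Import all_classical all_reals all_analysis.
Set Implicit Arguments. Unset Strict Implicit. Unset Printing Implicit Defensive.
Import Order.TTheory GRing.Theory Num.Theory.
Import numFieldNormedType.Exports.
Local Open Scope classical_set_scope.
Local Open Scope ring_scope.

Section defs.
Context {R : realType}.

Definition has_all_moments d (T : measurableType d) (P : probability T R)
  (X : {RV P >-> R}) : Prop :=
  forall p : nat, P.-integrable setT (fun x => (X x ^+ p)%:E).

Definition same_law d d' (T : measurableType d) (T' : measurableType d')
  (P : probability T R) (Q : probability T' R)
  (X : {RV P >-> R}) (Y : {RV Q >-> R}) : Prop :=
  forall A : set R, measurable A -> P (X @^-1` A) = Q (Y @^-1` A).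

Definition SMD d (T : measurableType d) (P : probability T R)
  (X : {RV P >-> R}) : Prop :=
  [/\ (forall A : set R, measurable A ->
         P (X @^-1` A) = P ((fun x => - X x) @^-1` A)),
      has_all_moments X &
      forall d' (T' : measurableType d') (Q : probability T' R)
             (Y : {RV Q >-> R}),
        (forall p : nat, (1 <= p)%N ->
           Q.-integrable setT (fun y => (Y y ^+ p)%:E) /\
           ('E_Q[fun y => (Y y ^+ p)%R] = 'E_P[fun x => (X x ^+ p)%R])%E) ->
        same_law Y X].

Definition char_re d (T : measurableType d) (P : probability T R)
  (X : {RV P >-> R}) (t : R) : R := fine ('E_P[fun x => cos (t * X x)%R])%E.
Definition char_im d (T : measurableType d) (P : probability T R)
  (X : {RV P >-> R}) (t : R) : R := fine ('E_P[fun x => sin (t * X x)%R])%E.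

Definition re_log_char d (T : measurableType d) (P : probability T R)
  (X : {RV P >-> R}) (t : R) : R :=
  ln (Num.sqrt (char_re X t ^+ 2 + char_im X t ^+ 2)).

(** even cumulants: K_{2m}(X) = (-i)^{2m} (ln phi_X)^{(2m)}(0)
    = (-1)^m (Re ln phi_X)^{(2m)}(0)  (cumulants are real). *)
Definition cumulant_even d (T : measurableType d) (P : probability T R)
  (X : {RV P >-> R}) (m : nat) : R :=
  (-1) ^+ m * derive1n (m.*2) (re_log_char X) 0.

Definition gauss := (@normal_prob R 0 1 : probability _ R).

(** observation Y_s = sqrt s * X + N on the canonical space (X, N) ~ mu (x) gauss *)
Definition obs (s : R) (z : R * R) : R := Num.sqrt s * z.1 + z.2.

(** g is a version of E[X | Y_s], i.e. E[X | Y_s] = g(Y_s) a.s., where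
    (X, N) has law mu (x) gauss (X with law mu, N standard Gaussian independent
    of X): g Borel, g(Y_s) integrable and E[X 1_{Y_s in B}] = E[g(Y_s) 1_{Y_s in B}]
    for all Borel sets B. *)
Definition is_cond_exp (mu : probability R R) (s : R) (g : R -> R) : Prop :=
  [/\ measurable_fun setT g,
      (mu \x gauss)%E.-integrable setT (fun z => (g (obs s z))%:E) &
      forall B : set R, measurable B ->
        (\int[(mu \x gauss)%E]_(z in obs s @^-1` B) (z.1)%:E =
         \int[(mu \x gauss)%E]_(z in obs s @^-1` B) (g (obs s z))%:E)%E].

Definition cond_exp (mu : probability R R) (s : R) : R -> R :=
  xget (fun _ => 0) (is_cond_exp mu s).

Definition mmse_law (mu : probability R R) (s : R) : \bar R :=
  (\int[(mu \x gauss)%E]_z ((z.1 - cond_exp mu s (obs s z)) ^+ 2)%:E)%E.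

Definition mmse d (T : measurableType d) (P : probability T R)
  (X : {RV P >-> R}) (s : R) : \bar R := mmse_law (distribution P X) s.

End defs.

(* Main.v *)
(* Write Y_s = tX + N with t = sqrt s. For every polynomial estimator q the quadratic
   risk E((X - q(Y_s))^2) is a polynomial in t computed from the moments of X, and it
   exceeds mmse(X, s) by a square. Truncating the expansion in t of E(X | Y_s) at
   order M gives an estimator whose excess risk is O(t^(2M)); it only involves the
   first M moments. Suppose that X and Y have the same moments up to order p and let
   d be the difference of their moments of order p+1. Using for Y the truncated
   estimator of X, corrected by d t^p He_p / p! and by the analogous term of degree
   p+1, one gets an upper bound for mmse(Y, s) = mmse(X, s), whose comparison with the
   lower bound for mmse(X, s) at order t^(2p) reads d^2 + 2 d K_(p+1)(X) <= 0.
   Exchanging X and Y yields the converse inequality, so that d = 0 or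
   K_(p+1)(Y) = - K_(p+1)(X). Odd cumulants of X vanish, the case p+1 = 4 is excluded
   by the sign hypothesis, and for p+1 >= 6 the second alternative makes the
   coefficient of t^(2p+2) strictly negative, because all the products
   K_(p+1) K_i K_(p+3-i) with i even have the same sign, whereas the terms
   K_2 K_(p+1)^2 cancel the only positive contribution; a contradiction. Hence all
   moments agree, and X is determined by its moments. *)
Require Import Defs.
From HB Require Import structures.
From mathcomp Require Import all_boot all_order all_algebra.
From mathcomp Require Import all_classical all_reals all_analysis.
From mathcomp Require Import measurable_realfun.
From mathcomp Require Import ring lra zify.
Set Implicit Arguments. Unset Strict Implicit. Unset Printing Implicit Defensive.
Import Order.TTheory GRing.Theory Num.Theory.
Local Open Scope ring_scope.

(** * Hermite coefficients and cumulants *)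

(** Moments may grow too fast for power series in t to converge, so generating functions are never
    summed: every identity is one between truncated polynomials, with an explicit remainder. The
    formal half replaces the Gaussian expectation by the linear functional [gauss_fun] on
    polynomials. The analytic half shows that the risk of a polynomial estimator is given exactly by
    the formal expression, and that the truncated posterior mean is nearly optimal. The exponent 2M
    appears because the excess risk is a squared distance to E(X | Y_s), which is approximated up to
    t^M. Likewise, moving a nearly optimal estimator by t^p changes its risk only at order t^(2p);
    this is where the moment of order p+1 first shows, and only through the square of a cumulant:
    the two inequalities together say K_(p+1)(Y)^2 = K_(p+1)(X)^2. The remaining sign has to be
    settled separately, by hypothesis at order 4 and by the coefficient of t^(2p+2) beyond. *)

Section GaussFunctional.
Context {R : realFieldType}.
Implicit Types (p q : {poly R}) (n k i j : nat).

(** The recursion for Gaussian moments goes two steps back, hence a pair holding the moments of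
    orders n and n+1. *)
Fixpoint gauss_moment_pair n : R * R :=
  if n is n'.+1 then
    let: (a, b) := gauss_moment_pair n' in (b, n'.+1%:R * a)
  else (1, 0).
Definition gauss_moment n : R := (gauss_moment_pair n).1.

Lemma gauss_moment0 : gauss_moment 0 = 1. Proof. by []. Qed.
Lemma gauss_momentSS n : gauss_moment n.+2 = n.+1%:R * gauss_moment n.
Proof. by rewrite /gauss_moment /=; case: (gauss_moment_pair n). Qed.

(** E(p(N)) for a standard Gaussian N, defined algebraically; [Rintegral_gauss_horner] identifies it
    with the integral. *)
Definition gauss_fun p : R := \sum_(i < size p) p`_i * gauss_moment i.

Lemma gauss_funE n p : (size p <= n)%N ->
  gauss_fun p = \sum_(i < n) p`_i * gauss_moment i.
Proof.
move=> pn; rewrite /gauss_fun (big_ord_widen _ (fun i => p`_i * gauss_moment i) pn).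
rewrite big_mkcond; apply: eq_bigr => i _; case: ltnP => // pi.
by rewrite nth_default// mul0r.
Qed.

Lemma gauss_fun_is_linear : linear_for *%R gauss_fun.
Proof.
move=> a p q; pose n := maxn (size p) (size q).
have sp : (size p <= n)%N by rewrite leq_maxl.
have sq : (size q <= n)%N by rewrite leq_maxr.
have spq : (size (a *: p + q)%R <= n)%N.
  by rewrite (leq_trans (size_polyD _ _))// geq_max sq (leq_trans (size_scale_leq _ _)).
rewrite (gauss_funE spq) (gauss_funE sp) (gauss_funE sq) mulr_sumr -big_split/=.
by apply: eq_bigr => i _; rewrite coefD coefZ mulrDl mulrA.
Qed.
HB.instance Definition _ :=
  GRing.isLinear.Build R {poly R} R *%R gauss_fun gauss_fun_is_linear.

Lemma gauss_funXn n : gauss_fun 'X^n = gauss_moment n.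
Proof.
rewrite /gauss_fun size_polyXn big_ord_recr/= coefXn eqxx mul1r big1 ?add0r// => i _.
by rewrite coefXn ltn_eqF// mul0r.
Qed.

Lemma gauss_fun_polyC a : gauss_fun a%:P = a.
Proof. by rewrite -alg_polyC linearZ/= -(expr0 'X) gauss_funXn mulr1. Qed.

Lemma polyXn_ind (P : {poly R} -> Prop) :
  (forall n, P 'X^n) -> (forall a p q, P p -> P q -> P (a *: p + q)) -> forall p, P p.
Proof.
move=> PX PL p; have P0 : P 0.
  by have := PL (-1) _ _ (PX 0) (PX 0); rewrite scaleN1r addNr.
rewrite -[p]coefK poly_def; elim/big_ind: _ => // [q r Pq Pr|i _].
  by rewrite -[q]scale1r; apply: PL.
by rewrite -[_ *: _]addr0; apply: PL.
Qed.

(** Stein's identity; on monomials it is the recursion of the moments. *)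
Lemma gauss_fun_mulX p : gauss_fun ('X * p) = gauss_fun p^`().
Proof.
elim/polyXn_ind: p => [n|a p q IHp IHq]; last first.
  by rewrite mulrDr -scalerAr !linearP/= IHp IHq.
rewrite -exprS gauss_funXn derivXn linearMn/=; case: n => [|n]; first by rewrite mulr0n.
by rewrite gauss_funXn gauss_momentSS mulr_natl.
Qed.

Fixpoint hermite n : {poly R} :=
  if n is n'.+1 then 'X * hermite n' - (hermite n')^`() else 1.

Arguments hermite : simpl never.

Lemma hermiteS n : hermite n.+1 = 'X * hermite n - (hermite n)^`().
Proof. by []. Qed.

Lemma deriv_hermite n : (hermite n)^`() = n%:R *: hermite n.-1.
Proof.
elim: n => [|n IHn]; first by rewrite /= scale0r derivC.
rewrite hermiteS derivB derivM derivX mul1r IHn derivZ -scalerAr.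
case: n IHn => [|n] IHn.
  by rewrite !scale0r subr0 addr0 scale1r.
rewrite -addrA -scalerBr [n.+1.-1]/= -hermiteS.
by rewrite -[in RHS]natr1 [in RHS]addrC scalerDl scale1r.
Qed.

Lemma hermite_mulX n : 'X * hermite n = hermite n.+1 + n%:R *: hermite n.-1.
Proof. by rewrite hermiteS deriv_hermite subrK. Qed.

(** By Stein's identity p -> X p - p' is adjoint to differentiation, and [hermite n] is its n-th
    iterate on 1. *)
Lemma gauss_fun_hermite p n : gauss_fun (p * hermite n) = gauss_fun p^`(n).
Proof.
elim: n p => [|n IHn] p; first by rewrite mulr1.
rewrite hermiteS mulrBr mulrCA linearB/= gauss_fun_mulX derivM linearD/= addrK.
by rewrite IHn -derivSn.
Qed.

Lemma size_hermite n : (size (hermite n) <= n.+1)%N.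
Proof.
elim/ltn_ind: n => -[|n] IHn; first by rewrite size_poly1.
rewrite hermiteS (leq_trans (size_polyD _ _))// geq_max size_polyN.
rewrite mulrC (leq_trans (size_polyMleq _ _)) ?size_polyX ?addn2 ?ltnS ?IHn//=.
by rewrite deriv_hermite (leq_trans (size_scale_leq _ _))// (leq_trans (IHn n.-1 _))//; lia.
Qed.

Lemma size_hermiteM p i j : (size p <= i.+1)%N -> (size (p * hermite j)%R <= (i + j).+1)%N.
Proof.
move=> pi; rewrite (leq_trans (size_polyMleq _ _))//.
by have := size_hermite j; lia.
Qed.

(** Coefficient of p on [hermite k] in the Hermite basis, since E(He_k^2) = k!. *)
Definition hcoef k p : R := k`!%:R^-1 * gauss_fun (p * hermite k).

Lemma hcoef_is_linear k : linear_for *%R (hcoef k).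
Proof. by move=> a p q; rewrite /hcoef mulrDl -scalerAl linearP/= mulrDr mulrCA. Qed.
HB.instance Definition _ k :=
  GRing.isLinear.Build R {poly R} R *%R (hcoef k) (hcoef_is_linear k).

Lemma factR_neq0 n : n`!%:R != 0 :> R.
Proof. by rewrite pnatr_eq0 -lt0n fact_gt0. Qed.

Lemma factR_gt0 n : 0 < n`!%:R :> R.
Proof. by rewrite ltr0n fact_gt0. Qed.

Lemma factRS n : n.+1`!%:R = n.+1%:R * n`!%:R :> R.
Proof. by rewrite factS natrM. Qed.

Lemma hcoefE k p : hcoef k p = gauss_fun p^`N(k).
Proof.
rewrite /hcoef gauss_fun_hermite nderivn_def raddfMn/= -[X in _ * X]mulr_natl.
by rewrite mulKf ?factR_neq0.
Qed.

Lemma hcoef0 p : hcoef 0 p = gauss_fun p.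
Proof. by rewrite /hcoef mulr1 invr1 mul1r. Qed.

Lemma hcoef_small k p : (size p <= k)%N -> hcoef k p = 0.
Proof. by move=> pk; rewrite hcoefE nderivn_poly0// linear0. Qed.

Lemma hcoef_top k p : (size p <= k.+1)%N -> hcoef k p = p`_k.
Proof.
move=> pk; rewrite hcoefE (_ : p^`N(k) = (p`_k)%:P) ?gauss_fun_polyC//.
apply/polyP => i; rewrite coef_nderivn coefC; case: i => [|i] /=.
  by rewrite addn0 binn mulr1n.
have pki : (size p <= k + i.+1)%N by rewrite (leq_trans pk)// addnS ltnS leq_addr.
by rewrite nth_default// mul0rn.
Qed.

Lemma hcoef_mulX k p :
  hcoef k ('X * p) = k.+1%:R * hcoef k.+1 p + (if k is k'.+1 then hcoef k' p else 0).
Proof.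
rewrite /hcoef -mulrA mulrCA hermite_mulX mulrDr -scalerAr linearD/= linearZ/= mulrDr.
congr (_ + _).
  by rewrite factRS invfM mulrA mulVKf// pnatr_eq0.
case: k => [|k]; first by rewrite !mul0r mulr0.
by rewrite factRS invfM /= mulrACA mulVf ?mul1r// pnatr_eq0.
Qed.

(** Orthogonality: for i < k by degree, for i = k because [hermite k] is monic. *)
Lemma hcoef_hermite i k : hcoef k (hermite i) = (i == k)%:R.
Proof.
(* E(He_i He_k) is symmetric, so the two cases differ by a ratio of factorials. *)
wlog ik : i k / (i <= k)%N => [wlg|].
  case: (leqP i k) => [|/ltnW] ik; first exact: wlg.
  have := wlg _ _ ik; rewrite /hcoef mulrC eq_sym => /(canRL (mulrK _)).
  rewrite unitfE invr_eq0 factR_neq0 invrK => /(_ isT); rewrite mulrC [_ * hermite k]mulrC => ->.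
  by case: eqVneq => [->|]; rewrite ?mulr0 ?mul1r ?mulVf ?factR_neq0// mul0r mulr0.
case: (ltngtP i k) ik => // [ik _|-> _].
  by rewrite hcoef_small// (leq_trans (size_hermite _)).
rewrite hcoef_top ?size_hermite//.
elim: k => [|k IHk]; first by rewrite coef1.
rewrite hermiteS coefB coefXM/= IHk nth_default ?subr0// deriv_hermite.
by rewrite (leq_trans (size_scale_leq _ _))// (leq_trans (size_hermite _)); lia.
Qed.

(* The ladder relation turns multiplication by a Hermite polynomial into a
   recursion on its degree; only the three top coefficients are needed. *)
Lemma hcoef_mul_hermite k p j :
  hcoef k (p * hermite j.+1) = k.+1%:R * hcoef k.+1 (p * hermite j)
   + (if k is k'.+1 then hcoef k' (p * hermite j) else 0)
   - j%:R * hcoef k (p * hermite j.-1).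
Proof.
rewrite hermiteS deriv_hermite mulrBr mulrCA linearB/= hcoef_mulX.
by rewrite -scalerAr linearZ.
Qed.

(** The degree of p may be i+1, so this covers the top coefficient and the one below it. He_(i+1)
    He_j has no component on He_(i+j), by parity; hence the coefficient just below the top is
    carried along unchanged. *)
Lemma hcoef_mul_hermite_top i j p : (size p <= i.+2)%N ->
  hcoef (i + j) (p * hermite j) = hcoef i p.
Proof.
move=> pi; elim: j => [|j IHj]; first by rewrite mulr1 addn0.
rewrite addnS hcoef_mul_hermite IHj (@hcoef_small (i + j).+2) ?mulr0 ?add0r; last first.
  by rewrite (leq_trans (size_hermiteM _ pi)).
case: j {IHj} => [|j]; first by rewrite mul0r subr0.
rewrite (@hcoef_small _ (_ * hermite j)) ?mulr0 ?subr0//.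
by rewrite (leq_trans (size_hermiteM j pi))//; lia.
Qed.

(** Hermite coefficient two places below degree i; the value 0 for i < 2 stands for a negative
    index. *)
Definition hcoef_sub2 i p : R := if i is i'.+2 then hcoef i' p else 0.

(** The correction comes from He_i He_j = He_(i+j) + i j He_(i+j-2) + lower terms. *)
Lemma hcoef_mul_hermite_sub2 i j p : (0 < i)%N -> (size p <= i.+1)%N ->
  hcoef_sub2 (i + j) (p * hermite j) = hcoef_sub2 i p + i%:R * j%:R * hcoef i p.
Proof.
case: i => // i _ pi; elim: j => [|j IHj]; first by rewrite mulr1 addn0 mulr0 mul0r addr0.
rewrite addSn addnS {1}/hcoef_sub2 hcoef_mul_hermite.
rewrite -addSn (hcoef_mul_hermite_top _ (leqW pi)).
have -> : (if (i + j)%N is k'.+1 then hcoef k' (p * hermite j) else 0) =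
    hcoef_sub2 (i.+1 + j) (p * hermite j) by rewrite addSn /hcoef_sub2; case: (i + j)%N.
have -> : j%:R * hcoef (i + j) (p * hermite j.-1) = j%:R * hcoef i.+1 p.
  case: j {IHj} => [|j]; first by rewrite !mul0r.
  by rewrite /= addnS -addSn (hcoef_mul_hermite_top _ (leqW pi)).
by rewrite IHj -[in RHS](natr1 j) addSn -natr1 natrD -(natr1 i); ring.
Qed.

Lemma hcoef_mul_hermiteB i l p : (i <= l)%N -> (size p <= i.+2)%N ->
  hcoef l (p * hermite (l - i)) = hcoef i p.
Proof. by move=> il pi; have := hcoef_mul_hermite_top (l - i) pi; rewrite subnKC. Qed.

Lemma hcoef_mul_hermiteB_sub2 i l p : (0 < i <= l)%N -> (size p <= i.+1)%N ->
  hcoef_sub2 l (p * hermite (l - i)) =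
  hcoef_sub2 i p + i%:R * (l - i)%:R * hcoef i p.
Proof.
by move=> /andP[i0 il] pi; have := hcoef_mul_hermite_sub2 (l - i) i0 pi; rewrite subnKC.
Qed.

Lemma hcoefM_top i j p q : (size p <= i.+1)%N -> (size q <= j.+1)%N ->
  hcoef (i + j) (p * q) = hcoef i p * hcoef j q.
Proof.
move=> pi qj; rewrite !hcoef_top//; last by rewrite (leq_trans (size_polyMleq _ _))//; lia.
rewrite coefM (bigD1 (inord i))//= inordK; last by lia.
rewrite addKn big1 ?addr0// => k; rewrite -val_eqE/= inordK; last by lia.
case: (ssrnat.ltngtP k i) => // ki _.
  have qk : (size q <= i + j - k)%N by lia.
  by rewrite (nth_default _ qk) mulr0.
have pk : (size p <= k)%N by lia.
by rewrite (nth_default _ pk) mul0r.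
Qed.

(** Coefficient of a^k in exp(a y - a^2/2), as a polynomial in y. *)
Definition nhermite k : {poly R} := k`!%:R^-1 *: hermite k.

Lemma nhermite0 : nhermite 0 = 1.
Proof. by rewrite /nhermite invr1 scale1r. Qed.

Lemma size_nhermite k : (size (nhermite k) <= k.+1)%N.
Proof. by rewrite (leq_trans (size_scale_leq _ _)) ?size_hermite. Qed.

Lemma gauss_fun_mul_nhermite p k : gauss_fun (p * nhermite k) = hcoef k p.
Proof. by rewrite /hcoef /nhermite -scalerAr linearZ. Qed.

End GaussFunctional.
Arguments hermite : simpl never.
Arguments hcoef_sub2 : simpl never.

Section CourseOfValues.
Context {A : Type} (a0 : A) (F : (nat -> A) -> nat -> A).

(** Course-of-values recursion by iterating the functional: if [F f n] depends on f below n only,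
    the value at n is stable after n+1 iterations. *)
Definition course_rec n : A := iter n.+1 F (fun=> a0) n.

Hypothesis F_ext : forall f f' n, (forall i, (i < n)%N -> f i = f' i) -> F f n = F f' n.

Lemma course_recE n : course_rec n = F course_rec n.
Proof.
have stab i : forall k, (i < k)%N -> iter k F (fun=> a0) i = course_rec i.
  elim/ltn_ind: i => i IHi [//|k] ik.
  rewrite /course_rec !iterS; apply: F_ext => j ji.
  by rewrite !IHi//; apply: leq_trans ji _.
by rewrite {1}/course_rec iterS; apply: F_ext => i; exact: stab.
Qed.
End CourseOfValues.

(** * Moments, cumulants and the formal posterior mean *)

Section MomentSequence.
Context {R : realFieldType}.
Implicit Types (mu nu : nat -> R) (n k i j l : nat).

(* [cumul mu n] is the cumulant of order [n.+1] of a law with moments [mu]. *)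
Definition cumul mu : nat -> R := course_rec 0 (fun f n =>
  mu n.+1 - \sum_(i < n) 'C(n, i)%:R * f i * mu (n - i)%N).

Lemma cumulE mu n : cumul mu n =
  mu n.+1 - \sum_(i < n) 'C(n, i)%:R * cumul mu i * mu (n - i)%N.
Proof.
rewrite /cumul course_recE// => f f' {}n ff'.
by congr (_ - _); apply: eq_bigr => i _; rewrite ff'.
Qed.

Lemma moment_cumul mu n : mu 0%N = 1 ->
  mu n.+1 = \sum_(i < n.+1) 'C(n, i)%:R * cumul mu i * mu (n - i)%N.
Proof.
by move=> mu0; rewrite big_ord_recr/= subnn mu0 binn mulr1 mul1r cumulE addrC subrK.
Qed.

Lemma eq_cumul mu nu n : (forall i, (i <= n.+1)%N -> mu i = nu i) -> cumul mu n = cumul nu n.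
Proof.
elim/ltn_ind: n => n IHn munu; rewrite !cumulE munu//; congr (_ - _).
apply: eq_bigr => i _; rewrite IHn// ?munu//.
  by rewrite (leq_trans (leq_subr _ _)).
by move=> j ji; apply: munu; rewrite (leq_trans ji)// ltnS ltnW.
Qed.

(** [cumul mu n] has order n+1, so n even means odd order. In each term of the recursion either n -
    i is odd or i is even, and the induction applies in the second case. *)
Lemma odd_cumul mu n : (forall i, odd i -> mu i = 0) -> ~~ odd n -> cumul mu n = 0.
Proof.
move=> mu_odd; elim/ltn_ind: n => n IHn en; rewrite cumulE mu_odd ?sub0r//=.
rewrite big1 ?oppr0// => i _; case: (boolP (odd i)) => oi.
  by rewrite mu_odd ?mulr0// oddB ?(negbTE en) ?oi// ltnW.
by rewrite IHn// mulr0 mul0r.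
Qed.

(* Formal expansion in powers of [t] of [y |-> E(X | tX + N = y)]: the quotient
   of the generating functions of [mu k.+1] and [mu k] in the basis [nhermite]. *)
Definition post mu : nat -> {poly R} := course_rec 0 (fun f l =>
  mu l.+1 *: nhermite l - \sum_(i < l) f i * (mu (l - i)%N *: nhermite (l - i))).

Lemma postE mu l : post mu l =
  mu l.+1 *: nhermite l - \sum_(i < l) post mu i * (mu (l - i)%N *: nhermite (l - i)).
Proof.
rewrite /post course_recE// => f f' {}l ff'.
by congr (_ - _); apply: eq_bigr => i _; rewrite ff'.
Qed.

(** Coefficient of t^l in E(X w) = E(X | Y_s = y) E(w), where w = exp(t X y - t^2 X^2/2). *)
Lemma post_residual mu l : mu 0%N = 1 -> mu l.+1 *: nhermite l =
  \sum_(i < l.+1) post mu i * (mu (l - i)%N *: nhermite (l - i)).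
Proof.
move=> mu0; rewrite big_ord_recr/= subnn mu0 scale1r nhermite0 mulr1.
by rewrite [in RHS]postE addrC subrK.
Qed.

Lemma size_post mu l : (size (post mu l) <= l.+1)%N.
Proof.
elim/ltn_ind: l => l IHl; rewrite postE (leq_trans (size_polyD _ _))// geq_max size_polyN.
rewrite (leq_trans (size_scale_leq _ _)) ?size_nhermite//=.
apply: (leq_trans (size_sum _ _ _)); apply/bigmax_leqP => i _.
rewrite -scalerAr (leq_trans (size_scale_leq _ _))//.
rewrite -scalerAr (leq_trans (size_scale_leq _ _))//.
by rewrite (leq_trans (size_hermiteM (l - i) (IHl _ _)))//= subnKC// ltnW.
Qed.

Lemma post0 mu : post mu 0 = (mu 1%N)%:P.
Proof. by rewrite postE big_ord0 subr0 nhermite0 alg_polyC. Qed.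

(** Coefficient of z^n in the derivative of the cumulant generating function. *)
Definition ncumul mu n : R := cumul mu n / n`!%:R.

Lemma moment_ncumul mu n : mu 0%N = 1 ->
  mu n.+1 / n`!%:R = \sum_(i < n.+1) ncumul mu i * (mu (n - i)%N / (n - i)`!%:R).
Proof.
move=> mu0; rewrite moment_cumul// mulr_suml; apply: eq_bigr => -[i /= ni] _; move: ni; rewrite ltnS => ni.
rewrite /ncumul -(bin_fact ni) !natrM.
have := factR_neq0 (R := R) i; have := factR_neq0 (R := R) (n - i).
have : 'C(n, i)%:R != 0 :> R by rewrite pnatr_eq0 -lt0n bin_gt0.
by move=> ? ? ?; field; apply/and3P; split.
Qed.

(** Taking top Hermite coefficients in [post_residual] yields the recursion [moment_ncumul]. *)
Lemma hcoef_post mu l : mu 0%N = 1 -> hcoef l (post mu l) = ncumul mu l.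
Proof.
move=> mu0; elim/ltn_ind: l => l IHl.
have := congr1 (hcoef l) (post_residual l mu0).
rewrite linearZ/= /nhermite linearZ/= hcoef_hermite eqxx mulr1.
rewrite moment_ncumul// linear_sum !big_ord_recr/= subnn mu0 scale1r invr1.
rewrite scale1r !mulr1 => /eqP; rewrite -subr_eq0 opprD addrACA -sumrB big1 ?add0r; last first.
  move=> i _; rewrite -!scalerAr !linearZ/= -IHl//.
  rewrite hcoef_mul_hermiteB ?(leqW (size_post _ _))//; last exact: ltnW.
  by ring.
by rewrite subr_eq0 => /eqP.
Qed.

(** [nhermite l.+1] has no component on [hermite l], and Hermite factors carry the coefficient below
    the top along unchanged; induction on [post_residual] then gives 0. *)
Lemma hcoef_post_sub1 mu l : mu 0%N = 1 -> mu 1%N = 0 -> hcoef l (post mu l.+1) = 0.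
Proof.
move=> mu0 mu1; elim/ltn_ind: l => l IHl.
have := congr1 (hcoef l) (post_residual l.+1 mu0).
rewrite linearZ/= /nhermite linearZ/= hcoef_hermite gtn_eqF// !mulr0.
rewrite linear_sum big_ord_recr/= subnn mu0 scale1r invr1 scale1r mulr1 big_ord_recl.
rewrite post0 mu1 mul0r linear0 add0r big1 ?add0r// => i _.
rewrite lift0 -!scalerAr !linearZ/= subSS.
by rewrite hcoef_mul_hermiteB ?size_post// ?IHl ?mulr0// ltnW.
Qed.

(** The coefficient two below the top of [post_residual]: it is zero on the left, and the products
    on the right add the term i (l - i) of [hcoef_mul_hermiteB_sub2]. *)
Lemma hcoef_post_sub2_rec mu l : mu 0%N = 1 -> mu 1%N = 0 ->
  \sum_(i < l.+1) (hcoef_sub2 i (post mu i) + i%:R * (l - i)%:R * ncumul mu i)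
     * (mu (l - i)%N / (l - i)`!%:R) = 0.
Proof.
move=> mu0 mu1; have c0 : hcoef_sub2 l (mu l.+1 *: nhermite l : {poly R}) = 0.
  rewrite /hcoef_sub2; case: l => [|[|l]]//=; rewrite /nhermite !linearZ/= hcoef_hermite gtn_eqF ?mulr0//.
rewrite -[RHS]c0 (post_residual _ mu0).
have hs (F : 'I_l.+1 -> {poly R}) : hcoef_sub2 l (\sum_i F i) = \sum_i hcoef_sub2 l (F i).
  by rewrite /hcoef_sub2; case: l {c0} F => [|[|l]] F; rewrite ?linear_sum// big1.
have hz a (p : {poly R}) : hcoef_sub2 l (a *: p) = a * hcoef_sub2 l p.
  by rewrite /hcoef_sub2; case: l {c0 hs} => [|[|l]]; rewrite ?linearZ// mulr0.
rewrite hs; apply: eq_bigr => -[[|i] ili] _ /=.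
  rewrite post0 mu1 mul0r !mul0r addr0 mul0r /hcoef_sub2.
  by case: l {c0 hs hz ili} => [|[|l]]; rewrite ?linear0.
rewrite -!scalerAr !hz -(hcoef_post i.+1 mu0).
by rewrite hcoef_mul_hermiteB_sub2 ?size_post//; ring.
Qed.

Lemma coef_sqr_shift (p q : {poly R}) N l : (l < N)%N ->
  (forall i, (i < N)%N -> p`_i = q`_i) -> forall r : {poly R}, (p * r)`_l = (q * r)`_l.
Proof.
move=> lN pq r; rewrite !coefM; apply: eq_bigr => i _; rewrite pq//.
by rewrite (leq_trans _ lN)// ltn_ord.
Qed.

(* With [C = sum c_k z^k], [c_k = mu k / k!], [A = sum alpha_k z^k] and [B] the
   generating function of the second Hermite coefficients, the recursions read
   [C' = A C] and [B C = - z^2 A' C']; hence [B = - z^2 A' A = - z^2 (A^2)' / 2]. *)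
Lemma hcoef_post_sub2 mu l : mu 0%N = 1 -> mu 1%N = 0 ->
  hcoef_sub2 l.+1 (post mu l.+1) =
  - (l%:R / 2) * \sum_(i < l.+1) ncumul mu i * ncumul mu (l - i)%N.
Proof.
move=> mu0 mu1; pose n := l.+2.
(* Polynomials stand in for the power series; the identities below are claimed for low coefficients
   only. *)
have trunc (f : nat -> R) : exists p : {poly R}, forall i, (i < n)%N -> p`_i = f i.
  by exists (\poly_(i < n) f i) => i iN; rewrite coef_poly iN.
have [A AE] := trunc (ncumul mu).
have [B BE] := trunc (fun i => hcoef_sub2 i (post mu i)).
have [C CE] := trunc (fun i => mu i / i`!%:R).
have CA i : (i < l.+1)%N -> C^`()`_i = (A * C)`_i.
  move=> il; rewrite coef_deriv (CE i.+1 il) -[_ *+ _]mulr_natr factRS.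
  rewrite invfM mulrA mulrAC divfK ?pnatr_eq0// moment_ncumul// coefM.
  by apply: eq_bigr => j _; rewrite (AE j) ?(CE (i - j)%N)// /n; have := ltn_ord j; lia.
pose S := 'X * ('X * ((A * A)^`())).
have SE i : (i < n)%N -> (2%:R *: (('X * A^`()) * ('X * C^`())))`_i = (S * C)`_i.
  move=> iN; rewrite coefZ.
  have -> : 'X * A^`() * ('X * C^`()) = C^`() * A^`() * 'X * 'X by ring.
  have -> : S * C = (A * C) * (A^`() + A^`()) * 'X * 'X by rewrite /S derivM; ring.
  rewrite !coefMX; case: i iN => [|[|i]] //= iN; rewrite ?mulr0//.
  rewrite (coef_sqr_shift (N := l.+1) _ CA); last by rewrite /n in iN; lia.
  by rewrite mulrDr coefD mulrDl mul1r.
have BC i : (i < n)%N -> ((2%:R *: B + S) * C)`_i = 0.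
  move=> iN; rewrite mulrDl coefD -SE// -scalerAl !coefZ -mulrDr -coefD.
  rewrite coefD !coefM -big_split/= -[RHS](mulr0 2%:R) -[in RHS](hcoef_post_sub2_rec i mu0 mu1).
  congr (_ * _); apply: eq_bigr => j _.
  have jn : (j < n)%N by rewrite (leq_ltn_trans _ iN)// -ltnS.
  have ijn : (i - j < n)%N by rewrite (leq_ltn_trans (leq_subr _ _)).
  rewrite !coefXM !coef_deriv (BE _ jn) (CE _ ijn) mulrDl; congr (_ + _).
  case: (nat_of_ord j) jn ijn => [|k] kn ikn; first by rewrite eqxx /= !mul0r.
  rewrite /= AE//; case: (i - k.+1)%N ikn => [|k'] kn'; first by rewrite !mulr0 !mul0r.
  rewrite /= (CE _ kn') -[ncumul mu k.+1 *+ _]mulr_natl -[(_ / _) *+ _]mulr_natl.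
  by rewrite mulrACA !mulrA.
(* C has constant coefficient 1, so it can be cancelled coefficient by coefficient. *)
have B0 i : (i < n)%N -> (2%:R *: B + S)`_i = 0.
  elim/ltn_ind: i => i IHi iN; have := BC _ iN; rewrite coefM big_ord_recr/= subnn.
  rewrite big1 => [|j _]; last by rewrite IHi ?mul0r// (ltn_trans _ iN).
  by rewrite add0r CE// mu0 invr1 mulr1 mulr1.
have := B0 l.+1 (ltnSn _); rewrite coefD coefZ BE// !coefXM /= => /eqP.
rewrite addr_eq0 => /eqP h; apply: (mulfI (_ : 2%:R != 0)); first by rewrite pnatr_eq0.
rewrite h; clear -AE; case: l @n AE => [|l] n AE /=.
  by rewrite mulr0n mul0r oppr0 mul0r mulr0.
rewrite coef_deriv coefM mulNr mulrN mulrA [2%:R * _]mulrC divfK ?pnatr_eq0// -[X in - X = _]mulr_natl.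
congr (- (_ * _)); apply: eq_bigr => i _.
by rewrite (AE i) ?(AE (l.+1 - i)%N)// /n; have := ltn_ord i; lia.
Qed.

End MomentSequence.

(** * Formal expansion of the quadratic risk *)

Section HermiteNorms.
Context {R : realFieldType}.

Lemma gauss_fun_hermiteM i j :
  gauss_fun (hermite i * hermite j : {poly R}) = j`!%:R * (i == j)%:R.
Proof. by rewrite -(@hcoef_hermite R i j) /hcoef mulVKf ?factR_neq0. Qed.

(** E(He_p^2 (X^2 - 1)) / 2, where X He_p = He_(p+1) + p He_(p-1) gives ((p+1)! + p p! - p!) / 2. *)
Lemma hcoef2_hermite_sqr p :
  hcoef 2 (hermite p * hermite p : {poly R}) = p%:R * p`!%:R.
Proof.
have h2 : hermite 2 = 'X * 'X - 1 :> {poly R}.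
  by rewrite !hermiteS (_ : hermite 0 = 1)// derivC subr0 mulr1 derivX.
rewrite /hcoef h2 mulrBr mulr1 linearB/= gauss_fun_hermiteM eqxx mulr1.
rewrite (_ : _ * ('X * 'X) = ('X * hermite p) * ('X * hermite p)); last by ring.
rewrite hermite_mulX.
have := gauss_fun_hermiteM p.+1 p.+1; have := gauss_fun_hermiteM p.+1 p.-1.
have := gauss_fun_hermiteM p.-1 p.+1; have := gauss_fun_hermiteM p.-1 p.-1.
have /gtn_eqF pp : (p.-1 < p.+1)%N by lia.
rewrite !eqxx pp [p.-1 == _]eq_sym pp !mulr0 !mulr1.
move: (hermite p.+1) (hermite p.-1) => h1 h0 e00 e01 e10 e11.
rewrite mulrDl !mulrDr -!scalerAl -!scalerAr !linearD/= !linearZ/= e00 e01 e10 e11.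
rewrite !mulr0 addr0 add0r; case: p {e00 e01 e10 e11 pp h1 h0 h2} => [|p] /=.
  by rewrite !mul0r addr0 (_ : 1`! = 1%N)// (_ : 0`! = 1%N)// mulrN subrr.
by rewrite !factRS -!natr1; move: (p`!%:R : R) (p%:R : R) => f q; field.
Qed.

End HermiteNorms.

Section Comparison.
Context {R : realFieldType}.
Implicit Types (mu nu : nat -> R) (Q : {poly {poly R}}) (t : R).

(* Generating function of [y |-> E(X^a exp(tXy - t^2X^2/2))]. *)
Definition wpoly B a mu : {poly {poly R}} := \poly_(k < B) (mu (k + a)%N *: nhermite k).

(* Expansion in powers of [t] of [E(X^a Q(t)(tX + N))]. *)
Definition mpol B a mu Q : {poly R} := map_poly (@gauss_fun R) (Q * wpoly B a mu).

(* Expansion in powers of [t] of [E((X - Q(t)(tX + N))^2)]. *)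
Definition risk B mu Q : {poly R} :=
  (mu 2%N)%:P - 2%:R *: mpol B 1 mu Q + mpol B 0 mu (Q ^+ 2).

Lemma coef_mpol B a mu Q n : (n < B)%N ->
  (mpol B a mu Q)`_n = \sum_(k < n.+1) mu (k + a)%N * hcoef k Q`_(n - k).
Proof.
move=> nB; rewrite coef_map/= coefMr linear_sum; apply: eq_bigr => k _.
have kB : (k < B)%N by rewrite (leq_ltn_trans _ nB)// -ltnS.
by rewrite coef_poly kB -scalerAr linearZ/= gauss_fun_mul_nhermite.
Qed.

Lemma mpolD B a mu P Q : mpol B a mu (P + Q) = mpol B a mu P + mpol B a mu Q.
Proof. by rewrite /mpol mulrDl raddfD. Qed.

(** [mpol] is linear in the moments; it is defined for arbitrary sequences so that it applies to
    their difference. *)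
Lemma mpol_diff B a mu nu Q :
  mpol B a nu Q = mpol B a mu Q + mpol B a (fun k => nu k - mu k) Q.
Proof.
rewrite /mpol -raddfD -mulrDr; congr (map_poly _ (_ * _)).
apply/polyP => k; rewrite coefD !coef_poly; case: ifP => _; last by rewrite addr0.
by rewrite -scalerDl addrC subrK.
Qed.

(** The degree bound on Q leaves only indices k with 2k <= n, the vanishing of the first moments
    only k >= l; since n <= 2l + 2, just l and l+1 remain. *)
Lemma coef_mpol_two B a mu Q n l : (n < B)%N ->
  (forall j, (size (Q`_j)%R <= j.+1)%N) -> (forall k, (k < l)%N -> mu (k + a)%N = 0) ->
  (l < n <= (l + l).+2)%N -> (mpol B a mu Q)`_n =
  mu (l + a)%N * hcoef l Q`_(n - l) + mu (l.+1 + a)%N * hcoef l.+1 Q`_(n - l.+1).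
Proof.
move=> nB sQ mu0 /andP[ln nl]; rewrite coef_mpol//.
have l1 : (l < n.+1)%N by lia.
have l2 : (l.+1 < n.+1)%N by lia.
rewrite (bigD1 (Ordinal l1))//= (bigD1 (Ordinal l2))/=; last by rewrite -val_eqE/= gtn_eqF.
rewrite addrA big1 ?addr0// => k /andP[]; rewrite -!val_eqE/= => kl kl2.
have [kl'|lk] := ltnP k l; first by rewrite mu0// mul0r.
by rewrite hcoef_small ?mulr0// (leq_trans (sQ _))//; lia.
Qed.

Definition postpoly mu M : {poly {poly R}} := \poly_(j < M) post mu j.

(** Formal version of E(E(X | Y_s) Q(Y_s)) = E(X Q(Y_s)). The truncation at M is felt from order t^M
    on, and Q contributes a further factor t^J. *)
Lemma mpol_post B mu M J Q n : mu 0%N = 1 -> (n < B)%N -> (n < J + M)%N ->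
  (forall j, (j < J)%N -> Q`_j = 0) ->
  (mpol B 0 mu (postpoly mu M * Q))`_n = (mpol B 1 mu Q)`_n.
Proof.
move=> mu0 nB nJM Q0; rewrite !coef_map/= mulrAC mulrC !coefM; congr gauss_fun.
apply: eq_bigr => j _; have [jJ|Jj] := ltnP j J; first by rewrite Q0// !mul0r.
congr (_ * _); rewrite coefM coef_poly ifT; last by lia.
rewrite addn1 post_residual//; apply: eq_bigr => i _.
have iM : (i < M)%N by have := ltn_ord i; have := ltn_ord j; lia.
have iB : (n - j - i < B)%N by lia.
by rewrite !coef_poly iM iB addn0.
Qed.

Lemma coef_mpol_small B a mu Q n l : (n < B)%N ->
  (forall j, (size (Q`_j)%R <= j.+1)%N) -> (forall k, (k < l)%N -> mu (k + a)%N = 0) ->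
  (n < l + l)%N -> (mpol B a mu Q)`_n = 0.
Proof.
move=> nB sQ mu0 nl; rewrite coef_mpol// big1 // => k _.
have [kl|lk] := ltnP k l; first by rewrite mu0// mul0r.
by rewrite hcoef_small ?mulr0// (leq_trans (sQ _))//; have := ltn_ord k; lia.
Qed.

Lemma size_postpoly mu M j : (size ((postpoly mu M)`_j)%R <= j.+1)%N.
Proof. by rewrite coef_poly; case: ifP; rewrite ?size_post// size_poly0. Qed.

Lemma size_coefM (P Q : {poly {poly R}}) :
  (forall j, (size (P`_j)%R <= j.+1)%N) -> (forall j, (size (Q`_j)%R <= j.+1)%N) ->
  forall j, (size ((P * Q)`_j)%R <= j.+1)%N.
Proof.
move=> sP sQ j; rewrite coefM (leq_trans (size_sum _ _ _))//.
apply/bigmax_leqP => i _; rewrite (leq_trans (size_polyMleq _ _))//.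
by have := sP i; have := sQ (j - i)%N; have := ltn_ord i; lia.
Qed.

(* First two terms of the change of [postpoly] caused by changing the moments
   from order [p.+1] on. *)
Definition perturb (d : nat -> R) p : {poly {poly R}} :=
  'X^p * ((d p.+1 *: nhermite p)%:P + (d p.+2 *: nhermite p.+1)%:P * 'X).

Lemma coef_perturb d p j : (perturb d p)`_j =
  if j == p then d p.+1 *: nhermite p
  else if j == p.+1 then d p.+2 *: nhermite p.+1 else 0.
Proof.
rewrite /perturb coefXnM coefD coefC coefMX coefC.
case: (ssrnat.ltngtP j p) => [jp|jp|->]; last by rewrite subnn eqxx addr0.
  by rewrite ltn_eqF// ltnW.
rewrite (gtn_eqF (_ : (0 < j - p)%N)) ?subn_gt0// add0r.
case: (eqVneq j p.+1) => [->|]; first by rewrite subSn// subnn eqxx.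
by move=> jp'; rewrite gtn_eqF//; lia.
Qed.

Lemma size_perturb d p j : (size ((perturb d p)`_j)%R <= j.+1)%N.
Proof.
rewrite coef_perturb; case: eqP => [->|_].
  by rewrite (leq_trans (size_scale_leq _ _)) ?size_nhermite.
case: eqP => [->|_]; last by rewrite size_poly0.
by rewrite (leq_trans (size_scale_leq _ _)) ?size_nhermite.
Qed.

Section Coefficients.
Variables (mu nu : nat -> R) (p B : nat).
Hypotheses (mu0 : mu 0%N = 1) (nu0 : nu 0%N = 1).
Hypotheses (mu1 : mu 1%N = 0).
Hypothesis munu : forall i, (i <= p)%N -> nu i = mu i.
Hypotheses (p2 : (2 <= p)%N) (Bp : (p.+1.*2 < B)%N).
Let d i := nu i - mu i.
(** The length p+3 makes [mpol_post] valid against E, which starts at t^p, up to order 2p+2, the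
    last one examined. *)
Let G := postpoly mu p.+3.
Let E := perturb d p.

Let d_small i : (i <= p)%N -> d i = 0. Proof. by move=> ip; rewrite /d munu ?subrr. Qed.

(** The cross term of G and E for the moments [mu] cancels by [mpol_post]: G is optimal to first
    order. What is left involves d or is quadratic in E. *)
Lemma risk_diff n : (n <= p.+1.*2)%N ->
  (risk B nu (G + E))`_n - (risk B mu G)`_n =
  - 2%:R * (mpol B 1 d G)`_n + (mpol B 0 d (G ^+ 2))`_n
  - 2%:R * (mpol B 1 d E)`_n + 2%:R * (mpol B 0 d (G * E))`_n
  + (mpol B 0 nu (E ^+ 2))`_n.
Proof.
move=> np; have nB : (n < B)%N by rewrite (leq_ltn_trans np).
have res : (mpol B 0 mu (G * E))`_n = (mpol B 1 mu E)`_n.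
  apply: (@mpol_post _ _ _ p) => //; first by rewrite (leq_ltn_trans np)//; lia.
  by move=> j jp; rewrite coef_perturb !ltn_eqF// ltnW.
rewrite /risk sqrrD !coefD !coefN !coefZ !mpolD !coefD.
rewrite munu// (mpol_diff B 1 mu nu) (mpol_diff B 0 mu nu (G ^+ 2)).
rewrite (mpol_diff B 1 mu nu E) (mpol_diff B 0 mu nu (G * E)) !coefD res -/d.
by ring.
Qed.

Let sG := @size_postpoly mu p.+3.
Let sE := @size_perturb d p.
Let sG2 : forall j, (size ((G ^+ 2)`_j)%R <= j.+1)%N.
Proof. by rewrite expr2; exact: size_coefM. Qed.
Let sGE : forall j, (size ((G * E)`_j)%R <= j.+1)%N.
Proof. exact: size_coefM. Qed.

Let coefE2 : [/\ forall j, (j < p.*2)%N -> (E ^+ 2)`_j = 0,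
  (E ^+ 2)`_p.*2 = (d p.+1 *: nhermite p) ^+ 2,
  (E ^+ 2)`_p.*2.+1 = (d p.+1 *: nhermite p) * (d p.+2 *: nhermite p.+1) *+ 2 &
  (E ^+ 2)`_p.*2.+2 = (d p.+2 *: nhermite p.+1) ^+ 2].
Proof.
have -> : E ^+ 2 = 'X^(p.*2) * (((d p.+1 *: nhermite p) ^+ 2)%:P
  + (((d p.+1 *: nhermite p) * (d p.+2 *: nhermite p.+1)) *+ 2)%:P * 'X
  + ((d p.+2 *: nhermite p.+1) ^+ 2)%:P * 'X * 'X).
  rewrite /E /perturb -addnn exprD !rmorphXn rmorphMn rmorphM/=; ring.
split=> [j jp|||]; rewrite coefXnM; [by rewrite jp|rewrite ifF; last by lia..].
- by rewrite subnn !(coefD, coefMX, coefC) eqxx /= !addr0.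
- by rewrite subSnn !(coefD, coefMX, coefC) /= add0r addr0.
- rewrite (_ : (p.*2.+2 - p.*2)%N = 2%N); last by lia.
  by rewrite !(coefD, coefMX, coefC) /= !add0r.
Qed.

(** The index k = 1 drops because the first moment is 0, and k >= 3 because E^2 starts at order
    2p. *)
Let coef_mpolE2 n : (n <= p.*2.+2)%N -> (2 <= n)%N ->
  (mpol B 0 nu (E ^+ 2))`_n = gauss_fun (E ^+ 2)`_n
    + nu 2%N * hcoef 2 (E ^+ 2)`_(n - 2).
Proof.
have [E20 _ _ _] := coefE2.
move=> np n2; rewrite coef_mpol; last by lia.
case: n n2 np => [|[|n]]// _ np; rewrite !big_ord_recl big1 => [|i _] /=.
  rewrite nu0 mul1r hcoef0 /bump /= !addn0 (munu (_ : (1 <= p)%N)) ?mu1; last by lia.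
  by rewrite mul0r add0r addr0.
rewrite E20 ?linear0 ?mulr0//.
by rewrite /bump /=; lia.
Qed.

Let Gp j : (j < p.+3)%N -> G`_j = post mu j.
Proof. by move=> jp; rewrite coef_poly jp. Qed.

Lemma risk_diff_low n : (n < p.*2)%N -> (risk B nu (G + E))`_n = (risk B mu G)`_n.
Proof.
move=> np; have nB : (n < B)%N by lia.
apply/eqP; rewrite -subr_eq0 risk_diff; last by lia.
rewrite !(@coef_mpol_small B 1 d _ _ p)//; last first.
- by rewrite addnn.
- by move=> k kp; rewrite d_small// addn1.
- by rewrite addnn.
- by move=> k kp; rewrite d_small// addn1.
rewrite !(@coef_mpol_small B 0 d _ _ p.+1)//; last first.
- by lia.
- by move=> k kp; rewrite d_small// addn0.
- by lia.
- by move=> k kp; rewrite d_small// addn0.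
rewrite coef_mpol// big1; last first.
  have [E20 _ _ _] := coefE2.
  by move=> k _; rewrite E20 ?linear0 ?mulr0// (leq_ltn_trans (leq_subr _ _)).
by rewrite !mulr0 !addr0 subr0 eqxx.
Qed.

Let hcoef_nhermite k i : hcoef k (nhermite i : {poly R}) = (i == k)%:R / i`!%:R.
Proof. by rewrite /nhermite linearZ/= hcoef_hermite mulrC. Qed.

Let gauss_nhermiteM i j :
  gauss_fun (nhermite i * nhermite j : {poly R}) = (i == j)%:R / i`!%:R.
Proof. by rewrite gauss_fun_mul_nhermite hcoef_nhermite. Qed.

(** The term linear in d comes from G through [hcoef_post]. The correction E gives - 2 d^2 / p! by
    its covariance with X and d^2 / p! by its square. *)
Lemma risk_diff_lead : (risk B nu (G + E))`_p.*2 - (risk B mu G)`_p.*2 =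
  - (2%:R * d p.+1 * ncumul mu p + d p.+1 ^+ 2 / p`!%:R).
Proof.
have [_ E2p _ _] := coefE2.
rewrite risk_diff; last by lia.
rewrite !(@coef_mpol_two B 1 d _ _ p)//; try lia; last 2 first.
- by move=> k kp; rewrite d_small// addn1.
- by move=> k kp; rewrite d_small// addn1.
rewrite !(@coef_mpol_small B 0 d _ _ p.+1)//; try lia; last 2 first.
- by move=> k kp; rewrite d_small// addn0.
- by move=> k kp; rewrite d_small// addn0.
rewrite coef_mpolE2; [|by lia..].
have -> : (p.*2 - p)%N = p by lia.
rewrite E2p addn1 Gp; last by lia.
rewrite hcoef_post// !(@hcoef_small _ p.+1); last 2 first.
- by rewrite (leq_trans (sE _))//; lia.
- by rewrite (leq_trans (sG _))//; lia.
rewrite (coef_perturb d p p) eqxx linearZ/= hcoef_nhermite eqxx.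
have [E20 _ _ _] := coefE2.
rewrite E20 ?linear0; last by lia.
rewrite expr2 -scalerAl -scalerAr !linearZ/= gauss_nhermiteM eqxx.
by rewrite !mulr0 !addr0; ring.
Qed.

(** Every surviving term contains a Hermite coefficient just below the top of [post], or pairs
    Hermite polynomials of different degrees. *)
Lemma risk_diff_odd : (risk B nu (G + E))`_p.*2.+1 = (risk B mu G)`_p.*2.+1.
Proof.
have [E20 _ E2p _] := coefE2.
apply/eqP; rewrite -subr_eq0 risk_diff; last by lia.
rewrite !(@coef_mpol_two B 1 d _ _ p)//; try lia; last 2 first.
- by move=> k kp; rewrite d_small// addn1.
- by move=> k kp; rewrite d_small// addn1.
rewrite !(@coef_mpol_small B 0 d _ _ p.+1)//; try lia; last 2 first.
- by move=> k kp; rewrite d_small// addn0.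
- by move=> k kp; rewrite d_small// addn0.
rewrite coef_mpolE2; [|by lia..].
have -> : (p.*2.+1 - p)%N = p.+1 by lia.
have -> : (p.*2.+1 - p.+1)%N = p by lia.
rewrite E2p Gp; last by lia.
rewrite hcoef_post_sub1// !(@hcoef_small _ p.+1); last 2 first.
- by rewrite (leq_trans (sE _))//; lia.
- by rewrite (leq_trans (sG _))//; lia.
rewrite (coef_perturb d p p.+1) gtn_eqF// eqxx linearZ/= hcoef_nhermite gtn_eqF//.
rewrite E20 ?linear0; last by lia.
rewrite linearMn/= -scalerAl -scalerAr !linearZ/= gauss_nhermiteM ltn_eqF//.
by rewrite !mul0r !mulr0 mul0rn !addr0 !mulr0 subr0 eqxx.
Qed.

(** The factor p+2 arises twice. In front of the sum, p+1 comes from [hcoef_post_sub2] and 1 from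
    the square of G; in front of the second moment, 2 comes from the product of G and E and p from
    [hcoef2_hermite_sqr]. *)
Lemma risk_diff_next : (risk B nu (G + E))`_p.*2.+2 - (risk B mu G)`_p.*2.+2 =
  p.+2%:R * d p.+1 * (\sum_(i < p.+2) ncumul mu i * ncumul mu (p.+1 - i)%N)
  - 2%:R * d p.+2 * ncumul mu p.+1 - d p.+2 ^+ 2 / p.+1`!%:R
  + p.+2%:R * mu 2%N * d p.+1 ^+ 2 / p`!%:R.
Proof.
have [E20 E2p E2p1 E2p2] := coefE2.
have nc1 : ncumul mu 1 = mu 2%N.
  by rewrite /ncumul cumulE big_ord1 subn0 mu1 mulr0 subr0 divr1.
rewrite risk_diff; last by lia.
rewrite !(@coef_mpol_two B 1 d _ _ p)//; try lia; last 2 first.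
- by move=> k kp; rewrite d_small// addn1.
- by move=> k kp; rewrite d_small// addn1.
rewrite !(@coef_mpol_two B 0 d _ _ p.+1)//; try lia; last 2 first.
- by move=> k kp; rewrite d_small// addn0.
- by move=> k kp; rewrite d_small// addn0.
rewrite coef_mpolE2; [|by lia..].
have -> : (p.*2.+2 - p)%N = p.+2 by lia.
have -> : (p.*2.+2 - p.+1)%N = p.+1 by lia.
have -> : (p.*2.+2 - p.+2)%N = p by lia.
have -> : (p.*2.+2 - 2)%N = p.*2 by lia.
rewrite !(@hcoef_small _ p.+2); last 2 first.
- by rewrite (leq_trans (sGE _))//; lia.
- by rewrite (leq_trans (sG2 _))//; lia.
rewrite E2p E2p2 !addn1 Gp; last by lia.
rewrite Gp; last by lia.
rewrite hcoef_post// -[hcoef p (post mu p.+2)]/(hcoef_sub2 p.+2 _) hcoef_post_sub2//.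
have -> : hcoef p.+1 (G ^+ 2)`_p.+1 =
    \sum_(i < p.+2) ncumul mu i * ncumul mu (p.+1 - i)%N.
  rewrite expr2 coefM linear_sum; apply: eq_bigr => i _.
  have ip := ltn_ord i; rewrite Gp ?Gp; try lia.
  have := hcoefM_top (size_post mu i) (size_post mu (p.+1 - i)).
  by rewrite subnKC ?hcoef_post// -ltnS.
have -> : hcoef p.+1 (G * E)`_p.+1 = mu 2%N * (d p.+1 / p`!%:R).
  rewrite coefMr !big_ord_recr big1 /= ?add0r => [|i _].
    rewrite subnn (_ : (p.+1 - p)%N = 1%N); last by lia.
    rewrite !Gp// post0 mu1 mul0r addr0.
    rewrite -add1n hcoefM_top ?size_post ?sE// hcoef_post// nc1.
    by rewrite coef_perturb eqxx linearZ/= hcoef_nhermite eqxx mul1r.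
  have ip := ltn_ord i.
  by rewrite coef_perturb (ltn_eqF ip) (ltn_eqF (leqW ip)) mulr0.
have e1 : (p.+2 == p) = false by lia.
have e2 : (p.+2 == p.+1) = false by lia.
have e3 : (p.+1 == p) = false by lia.
rewrite !coef_perturb e1 e2 e3 eqxx.
rewrite linear0 linearZ/= hcoef_nhermite eqxx !expr2 /nhermite -!scalerAl -!scalerAr.
rewrite !linearZ/= hcoef2_hermite_sqr gauss_fun_hermiteM eqxx munu// !addn0 -!natr1.
have := factR_neq0 (R := R) p; have := factR_neq0 (R := R) p.+1.
move: (\sum_(i < _) _) (ncumul _ _) (d _) (d _) (p`!%:R : R) (p.+1`!%:R : R).
move=> S a d1 d2 f1 f2 f1n f2n.
by field; apply/andP.
Qed.

End Coefficients.
End Comparison.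

(** Turns a comparison of risks for small t into an inequality between coefficients; one-sided
    bounds suffice, so the mmse itself is never expanded. *)
Lemma poly_lead_ge0 (R : realFieldType) (D : {poly R}) (C e : R) n :
  0 < e -> (forall i, (i < n)%N -> D`_i = 0) ->
  (forall t, 0 < t -> t < e -> - (C * t ^+ n.+1) <= D.[t]) -> 0 <= D`_n.
Proof.
move=> e0 D0 CD; rewrite leNgt; apply/negP => Dn0.
pose K := `|C| + \sum_(i < size D) `|D`_i|.
have K0 : 0 <= K by rewrite addr_ge0// sumr_ge0.
have K10 : 0 < K + 1 by rewrite ltr_wpDl.
(* K bounds C and all coefficients of D, so t (K + 1) < - D_n lets the negative term of order n
   win. *)
pose t := Num.min (Num.min 1 (e / 2)) (- D`_n / (2 * (K + 1))).
have t0 : 0 < t.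
  by rewrite !lt_min ltr01 divr_gt0//= divr_gt0 ?oppr_gt0// mulr_gt0.
have t1 : t <= 1 by rewrite !ge_min lexx.
have te : t < e.
  by rewrite (le_lt_trans (_ : t <= e / 2)) ?ge_min ?lexx ?orbT// ltr_pdivrMr// ltr_pMr// ltr1n.
have tD : t * (K + 1) < - D`_n.
  apply: (@le_lt_trans _ _ (- D`_n / 2)); last by rewrite ltr_pdivrMr// ltr_pMr ?oppr_gt0// ltr1n.
  have /(ler_wpM2r (ltW K10)) : t <= - D`_n / (2 * (K + 1)) by rewrite ge_min lexx orbT.
  by rewrite invfM mulrA divfK// gt_eqF.
have := CD t t0 te; apply/negP; rewrite -ltNge.
have nD : (n < size D)%N by apply: contraTT Dn0; rewrite -leqNgt => /(nth_default 0) ->; rewrite ltxx.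
rewrite horner_coef (bigD1 (Ordinal nD))//=.
apply: (@le_lt_trans _ _ (D`_n * t ^+ n + (\sum_(i < size D) `|D`_i|) * t ^+ n.+1)).
  rewrite lerD2l mulr_suml big_mkcond/=; apply: ler_sum => i _; case: eqP => [->|/eqP ni] /=.
    by rewrite mulr_ge0// exprn_ge0// ltW.
  have [iN|iN|iN] := ssrnat.ltngtP i n.
  - by rewrite D0// mul0r normr0 mul0r.
  - rewrite (le_trans (ler_norm _))// normrM ler_wpM2l// normrX ger0_norm ?(ltW t0)//.
    by rewrite ler_wiXn2l// ltW.
  - by move: ni; rewrite -val_eqE/= iN eqxx.
rewrite -subr_lt0 exprS; set S := \sum_(i < _) _ in K K0 K10 t t0 t1 te tD *.
rewrite (_ : _ - _ = t ^+ n * (D`_n + t * (S + C))); last by ring.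
rewrite pmulr_rlt0 ?exprn_gt0// -ltrBrDl sub0r (le_lt_trans _ tD)//.
by rewrite ler_wpM2l ?(ltW t0)//; have := ler_norm C; rewrite /K; lra.
Qed.

(** * Sign of the convolution of alternating cumulants *)

Section AlternatingCumulants.
Context {R : realFieldType}.
Variables (mu : nat -> R) (q : nat).
Hypothesis mu_odd : forall i, odd i -> mu i = 0.
Hypothesis alt : forall j, 0 < (-1) ^+ j * cumul mu j.*2.+1.
Let p := q.*2.+1.

Let ncumul_odd j : 0 < (-1) ^+ j * ncumul mu j.*2.+1.
Proof. by rewrite /ncumul mulrA divr_gt0 ?alt// factR_gt0. Qed.

Let ncumul_even i : ~~ odd i -> ncumul mu i = 0.
Proof. by move=> ei; rewrite /ncumul odd_cumul ?mul0r. Qed.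

(** The three factors carry the signs (-1)^q, (-1)^a and (-1)^(q-a), whose product is 1. *)
Let triple_gt0 a : (a <= q)%N ->
  0 < ncumul mu p * (ncumul mu a.*2.+1 * ncumul mu (p.+1 - a.*2.+1)).
Proof.
move=> aq; rewrite (_ : (p.+1 - a.*2.+1)%N = (q - a).*2.+1); last by rewrite /p; lia.
have := mulr_gt0 (ncumul_odd q) (mulr_gt0 (ncumul_odd a) (ncumul_odd (q - a))).
have sgn : (-1) ^+ q * ((-1) ^+ a * (-1) ^+ (q - a)) = 1 :> R.
  by rewrite -!exprD subnKC// addnn -signr_odd odd_double.
have mulrA6 (x y z u v w : R) : u * x * (v * y * (w * z)) = u * (v * w) * (x * (y * z)) by ring.
by rewrite mulrA6 sgn mul1r.
Qed.

Let triple_ge0 i : (i <= p.+1)%N -> 0 <= ncumul mu p * (ncumul mu i * ncumul mu (p.+1 - i)).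
Proof.
move=> ip; have [oi|ei] := boolP (odd i); last by rewrite (ncumul_even ei) mul0r mulr0.
have -> : i = i./2.*2.+1 by rewrite -[LHS]odd_double_half oi.
by rewrite ltW // triple_gt0 //; rewrite /p in ip; lia.
Qed.

Lemma alternating_convolution : (2 <= q)%N -> mu 0%N = 1 ->
  2%:R * mu 2%N * ncumul mu p ^+ 2 <
  ncumul mu p * \sum_(i < p.+2) ncumul mu i * ncumul mu (p.+1 - i).
Proof.
move=> q2 mu0; have nc1 : ncumul mu 1 = mu 2%N.
  by rewrite /ncumul cumulE big_ord1 subn0 (mu_odd (i := 1)) ?mulr0 ?subr0 ?divr1.
have i1 : (1 < p.+2)%N by [].
have i3 : (3 < p.+2)%N by rewrite /p; lia.
have ip : (p < p.+2)%N by [].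
rewrite mulr_sumr (bigD1 (Ordinal i1))//= (bigD1 (Ordinal ip))/=; last first.
  by rewrite -val_eqE/= /p; lia.
(* The indices 1 and p give the left-hand side; index 3, distinct from p because q >= 2, makes the
   inequality strict. *)
rewrite (bigD1 (Ordinal i3))/=; last by rewrite -!val_eqE/= /p; lia.
rewrite nc1 subn1 /= subSnn nc1 !addrA.
have -> : ncumul mu p * (mu 2%N * ncumul mu p) + ncumul mu p * (ncumul mu p * mu 2%N) =
  2%:R * mu 2%N * ncumul mu p ^+ 2 by ring.
rewrite -addrA ltrDl ltr_wpDr//; last by rewrite (@triple_gt0 1)// ltnW.
by apply: sumr_ge0 => i _; apply: triple_ge0; rewrite -ltnS.
Qed.

End AlternatingCumulants.

(** [ncumul mu p.+1] has odd order and vanishes, so d2 enters only through minus a square. With d1 =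
    - 2 p! a, where a is [ncumul mu p], the rest is - 2 (p+2) p! (a S - 2 mu_2 a^2). *)
Lemma next_coef_lt0 (R : realFieldType) (mu : nat -> R) q (d1 d2 : R) :
  (2 <= q)%N -> mu 0%N = 1 -> (forall i, odd i -> mu i = 0) ->
  (forall j, 0 < (-1) ^+ j * cumul mu j.*2.+1) ->
  let p := q.*2.+1 in d1 = - 2%:R * cumul mu p ->
  p.+2%:R * d1 * (\sum_(i < p.+2) ncumul mu i * ncumul mu (p.+1 - i)%N)
  - 2%:R * d2 * ncumul mu p.+1 - d2 ^+ 2 / p.+1`!%:R
  + p.+2%:R * mu 2%N * d1 ^+ 2 / p`!%:R < 0.
Proof.
move=> q2 mu0 mu_odd alt p d1E; have := alternating_convolution mu_odd alt q2 mu0.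
rewrite -/p; set S := \sum_(i < _) _; set a := ncumul mu p => lt.
rewrite {1}/ncumul odd_cumul//; last by rewrite /= odd_double.
have d1a : d1 = - 2%:R * p`!%:R * a by rewrite d1E -mulrA /a /ncumul [_ * (_ / _)]mulrC divfK ?factR_neq0.
have pf := factR_gt0 (R := R) p; have pn := factR_neq0 (R := R) p.
have d2ge : 0 <= d2 ^+ 2 / p.+1`!%:R by rewrite divr_ge0 ?sqr_ge0 ?ler0n.
have p2 : 0 < p.+2%:R :> R by rewrite ltr0n.
have key : p.+2%:R * d1 * S + p.+2%:R * mu 2%N * d1 ^+ 2 / p`!%:R =
  - 2%:R * (p.+2%:R * p`!%:R * (a * S - 2%:R * mu 2%N * a ^+ 2)).
  rewrite d1a; move: (p`!%:R : R) (p.+2%:R : R) pn => f u fn; by field.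
have : 0 < p.+2%:R * p`!%:R * (a * S - 2%:R * mu 2%N * a ^+ 2).
  by rewrite !mulr_gt0// subr_gt0.
rewrite mul0r mulr0 subr0; lra.
Qed.

Import numFieldNormedType.Exports.
Local Open Scope classical_set_scope.
Local Open Scope ring_scope.

(** * Gaussian change of variable and Hermite expansion *)

Section Gaussian.
Context {R : realType}.
Local Notation lambda := (@lebesgue_measure R).
Local Notation gauss := (@gauss R).

Lemma measurable_fun_addl (a : R) : measurable_fun setT (fun x : R => x + a).
Proof. exact: measurable_funD. Qed.

Let measurable_shift (a : R) :
  measurable_fun [set: measurableTypeR R] (fun x : measurableTypeR R => (x + a : measurableTypeR R)).
Proof. exact: measurable_fun_addl. Qed.

Definition shift_mfun (a : R) : {mfun measurableTypeR R >-> measurableTypeR R} :=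
  HB.pack (fun x : measurableTypeR R => (x + a : measurableTypeR R))
    (isMeasurableFun.Build _ _ _ _ _ (measurable_shift a)).

Lemma lebesgue_measure_shift (a : R) (A : set R) : measurable A ->
  pushforward lambda (shift_mfun a) A = lambda A.
Proof.
move=> mA; apply/esym.
apply: (@lebesgue_measure_unique R (pushforward lambda (shift_mfun a))) => //= _ [[u v]] _ <-.
rewrite /pushforward/=.
have -> : (fun x : R => x + a) @^-1` `]u, v] = `](u - a), (v - a)]%classic.
  by apply/seteqP; split => x /=; rewrite !in_itv/= ltrBlDr lerBrDr.
rewrite !lebesgue_measure_itv/= !lte_fin ltrD2r; case: ifP => // _.
by rewrite -!EFinB; congr EFin; ring.
Qed.

Lemma ge0_integral_shift (a : R) (F : R -> \bar R) :
  measurable_fun setT F -> (forall x, 0 <= F x)%E ->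
  (\int[lambda]_x F (x + a)%R = \int[lambda]_x F x)%E.
Proof.
move=> mF F0; transitivity (\int[pushforward lambda (shift_mfun a)]_x F x)%E.
  by rewrite ge0_integral_pushforward.
by apply: eq_measure_integral => A mA _; exact: lebesgue_measure_shift.
Qed.

(** The Radon-Nikodym derivative of [gauss] and [normal_pdf] have the same integral over every
    measurable set, hence agree almost everywhere. *)
Lemma ge0_integral_gauss (F : R -> \bar R) :
  measurable_fun setT F -> (forall x, 0 <= F x)%E ->
  (\int[gauss]_x F x = \int[lambda]_x (F x * (normal_pdf 0 1 x)%:E))%E.
Proof.
move=> mF F0; have dom := normal_prob_dominates (0 : R) 1.
rewrite -(Radon_Nikodym_SigmaFinite.change_of_variables dom F0 measurableT mF).
apply: ge0_ae_eq_integral => //.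
- apply: emeasurable_funM => //.
  exact: measurable_int (Radon_Nikodym_SigmaFinite.f_integrable dom).
- apply: emeasurable_funM => //; apply/measurable_EFinP; exact: measurable_normal_pdf.
- by move=> x _; rewrite mule_ge0// Radon_Nikodym_SigmaFinite.f_ge0.
- by move=> x _; rewrite mule_ge0// lee_fin normal_pdf_ge0.
apply: ae_eqe_mul2l; apply: integral_ae_eq => //.
- exact: Radon_Nikodym_SigmaFinite.f_integrable.
- by apply/measurable_EFinP; exact: measurable_normal_pdf.
- by move=> E _ mE; rewrite -Radon_Nikodym_SigmaFinite.f_integral.
Qed.

(** Cameron-Martin weight: the density of N + a with respect to N. *)
Definition cmw (a y : R) : R := expR (a * y - a ^+ 2 / 2).

Lemma normal_pdf_shift (a y : R) : normal_pdf 0 1 (y - a) = cmw a y * normal_pdf 0 1 y.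
Proof.
rewrite !normal_pdfE ?oner_neq0//= mulrCA; congr (_ * _).
by rewrite /normal_fun /cmw -expRD; congr expR; field.
Qed.

Lemma measurable_cmw (a : R) : measurable_fun setT (cmw a).
Proof.
apply: measurableT_comp => //; apply: measurable_funB => //; exact: measurable_funM.
Qed.

Lemma cmw_ge0 (a y : R) : 0 <= cmw a y. Proof. exact: expR_ge0. Qed.

Lemma cameron_martin (a : R) (F : R -> \bar R) :
  measurable_fun setT F -> (forall x, 0 <= F x)%E ->
  (\int[gauss]_n F (n + a)%R = \int[gauss]_y (F y * (cmw a y)%:E))%E.
Proof.
move=> mF F0; rewrite !ge0_integral_gauss//; first last.
- exact: measurableT_comp mF (measurable_fun_addl a).
- by move=> x; rewrite mule_ge0// lee_fin cmw_ge0.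
- by apply: emeasurable_funM => //; apply/measurable_EFinP; exact: measurable_cmw.
rewrite -(@ge0_integral_shift (- a)).
- by apply: eq_integral => x _; rewrite subrK normal_pdf_shift EFinM muleA.
- apply: emeasurable_funM; first exact: measurableT_comp mF (measurable_fun_addl a).
  by apply/measurable_EFinP; exact: measurable_normal_pdf.
- by move=> x; rewrite mule_ge0// lee_fin normal_pdf_ge0.
Qed.

End Gaussian.

Section ExpTaylor.
Context {R : realType}.
Implicit Types (u a x y t : R) (K k j n : nat).

Definition exp_poly K : {poly R} := \poly_(j < K) j`!%:R^-1.

Lemma deriv_exp_poly K : (exp_poly K.+1)^`() = exp_poly K.
Proof.
apply/polyP => j; rewrite coef_deriv !coef_poly ltnS; case: ifP => _; last by rewrite mul0rn.
by rewrite -[_ *+ _]mulr_natr factRS invfM mulrAC mulVf ?mul1r// pnatr_eq0.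
Qed.

Lemma exp_poly_at0 K : (exp_poly K.+1).[0] = 1.
Proof. by rewrite horner_coef0 coef_poly invr1. Qed.

(** The remainder of order K+1 has the remainder of order K as derivative, so the mean value theorem
    gives one factor |u| per step; the factorial is given up. *)
Lemma exp_poly_remainder K u :
  `|expR u - (exp_poly K).[u]| <= `|u| ^+ K * Num.max 1 (expR u).
Proof.
elim: K u => [|K IHK] u.
  rewrite /exp_poly poly_def big_ord0 horner0 subr0 mul1r ger0_norm ?expR_ge0//.
  by rewrite le_max lexx orbT.
pose f (v : R) : R := expR v - (exp_poly K.+1).[v].
pose df (v : R) : R := expR v - (exp_poly K).[v].
have fdf (v : R) : is_derive v (1 : R) f (df v).
  rewrite /f /df -(deriv_exp_poly K); apply: is_deriveB.
have cf A : {within A, continuous f}.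
  apply: continuous_subspaceT => v; apply: differentiable_continuous.
  by apply/derivable1_diffP; have [] := fdf v.
have f0 : f 0 = 0 by rewrite /f expR0 exp_poly_at0 subrr.
rewrite -/(f u).
have [c cu ->] : exists2 c, `|c| <= `|u| /\ Num.max 1 (expR c) <= Num.max 1 (expR u)
    & f u = df c * u.
  have [u0|u0] := leP 0 u.
    have [c] := MVT_segment u0 (fun v _ => fdf v) (cf _).
    rewrite in_itv/= => /andP[c0 cu]; rewrite f0 !subr0 => fu; exists c => //; split.
      by rewrite !ger0_norm.
    by rewrite ge_max !le_max lexx /= ler_expR cu orbT.
  have [c] := MVT_segment (ltW u0) (fun v _ => fdf v) (cf _).
  rewrite in_itv/= => /andP[cu c0]; rewrite f0 !sub0r mulrN => /oppr_inj fu.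
  exists c => //; split; first by rewrite !ler0_norm ?lerN2// ltW.
  by rewrite ge_max !le_max lexx /= -expR0 ler_expR c0.
case: cu => cu mcu; rewrite normrM exprS mulrC -mulrA ler_wpM2l//.
apply: (le_trans (IHK c)); apply: ler_pM => //.
by rewrite lerXn2r// nnegrE.
Qed.

Lemma exp_poly_bound K u : `|expR u - (exp_poly K).[u]| <= `|u| ^+ K * (1 + expR u).
Proof.
rewrite (le_trans (exp_poly_remainder K u))// ler_wpM2l ?exprn_ge0//.
by rewrite ge_max lerDl expR_ge0 lerDr ler01.
Qed.

(* [exp (a y - a^2 / 2)] truncated, as a polynomial in [a] (outer variable) and [y]. *)
Definition cm_arg : {poly {poly R}} := 'X * 'X%:P - (2%:R^-1)%:P%:P * 'X^2.
Definition cm_poly K : {poly {poly R}} := \sum_(j < K) (j`!%:R^-1)%:P *: cm_arg ^+ j.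

Lemma deriv_cm_poly K : (cm_poly K.+1)^`() = ('X%:P - 'X) * cm_poly K.
Proof.
rewrite /cm_poly big_ord_recl expr0 derivD derivZ derivC scaler0 add0r.
rewrite raddf_sum mulr_sumr; apply: eq_bigr => j _.
rewrite /= /bump /= add1n derivZ deriv_exp /=.
have -> : cm_arg^`() = 'X%:P - 'X.
  rewrite /cm_arg derivB derivM derivX derivC mul1r mulr0 addr0 derivM derivC mul0r add0r.
  by rewrite derivXn expr1 mulrnAr -mulrnAl -!polyCMn -[_^-1 *+ _]mulr_natr mulVf ?pnatr_eq0// mul1r.
rewrite -scalerMnr scalerMnl -polyCMn -[_^-1 *+ _]mulr_natr factRS invfM mulrAC.
by rewrite mulVf ?mul1r ?pnatr_eq0// scalerAr.
Qed.

Lemma cm_poly_coef0 K : (cm_poly K.+1)`_0 = 1.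
Proof.
rewrite /cm_poly coef_sum big_ord_recl big1 ?addr0 => [|j _].
  by rewrite expr0 coefZ coef1 eqxx mulr1 invr1.
rewrite coefZ /= /bump /= add1n exprS coef0M /cm_arg coefB coefXM coefCM coefXn /=.
by rewrite mulr0 subr0 mul0r mulr0.
Qed.

Lemma nhermiteS k : k.+1%:R *: nhermite k.+1 =
  'X * nhermite k - (if k is k'.+1 then nhermite k' else 0) :> {poly R}.
Proof.
rewrite /nhermite scalerA factRS invfM mulrA divff ?mul1r ?pnatr_eq0//.
rewrite hermiteS deriv_hermite scalerBr scalerAr; congr (_ - _).
case: k => [|k]; first by rewrite scale0r scaler0.
by rewrite scalerA factRS invfM mulrAC mulVf ?mul1r ?pnatr_eq0.
Qed.

(** Both sides satisfy (k+1) c_(k+1) = y c_k - c_(k-1), the left one by differentiating in a. *)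
Lemma coef_cm_poly K k : (k < K)%N -> (cm_poly K)`_k = nhermite k.
Proof.
elim: K k => // K IHK [_|k]; first by rewrite cm_poly_coef0 nhermite0.
rewrite ltnS => kK; apply: (scalerI (_ : k.+1%:R != 0 :> R)); first by rewrite pnatr_eq0.
rewrite nhermiteS scaler_nat -coef_deriv deriv_cm_poly mulrBl coefB.
rewrite coefCM IHK// coefXM; congr (_ - _).
by case: k kK => // k kK; rewrite /= IHK// ltnW.
Qed.

Lemma horner_cm_poly K a y :
  (cm_poly K).[a%:P].[y] = (exp_poly K).[a * y - a ^+ 2 / 2].
Proof.
rewrite /cm_poly /exp_poly horner_poly !horner_sum; apply: eq_bigr => j _.
rewrite /cm_arg !(hornerE, horner_exp); congr (_ * _ ^+ _).
by congr (_ - _); rewrite [RHS]mulrC expr2 mulrA.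
Qed.

End ExpTaylor.

(** * Remainders with polynomial growth *)

Section Growth.
Context {R : realType}.
Implicit Types (t x y C : R) (F G : R -> R -> R -> R).

(** At least 1, so that powers increase with the exponent, and a product, so that integrals over x
    and y separate. *)
Definition weight x y : R := (1 + x ^+ 2) * (1 + y ^+ 2).

Lemma weight_ge1 x y : 1 <= weight x y.
Proof. by rewrite /weight -[leLHS]mulr1 ler_pM// lerDl sqr_ge0. Qed.

Lemma weight_ge0 x y : 0 <= weight x y.
Proof. exact: le_trans ler01 (weight_ge1 _ _). Qed.

(** O(t^K) for t in (0, 1], up to a polynomial factor in x and y, which is integrable since all
    moments exist. *)
Definition growth K F := exists C p, 0 <= C /\
  forall t x y, 0 < t -> t <= 1 -> `|F t x y| <= C * t ^+ K * weight x y ^+ p.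

Lemma growth_le K F G : (forall t x y, 0 < t -> t <= 1 -> `|F t x y| <= `|G t x y|) ->
  growth K G -> growth K F.
Proof.
move=> FG [C [p [C0 GC]]]; exists C, p; split => // t x y t0 t1.
exact: le_trans (FG _ _ _ t0 t1) (GC _ _ _ t0 t1).
Qed.

Lemma growthD K F G : growth K F -> growth K G -> growth K (fun t x y => F t x y + G t x y).
Proof.
move=> [C [p [C0 FC]]] [D [q [D0 GD]]]; exists (C + D), (maxn p q); split; first exact: addr_ge0.
move=> t x y t0 t1; rewrite (le_trans (ler_normD _ _))// !mulrDl lerD//.
- rewrite (le_trans (FC _ _ _ t0 t1))// ler_wpM2l ?mulr_ge0 ?exprn_ge0 ?(ltW t0)//.
  by rewrite ler_weXn2l ?weight_ge1 ?leq_maxl.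
- rewrite (le_trans (GD _ _ _ t0 t1))// ler_wpM2l ?mulr_ge0 ?exprn_ge0 ?(ltW t0)//.
  by rewrite ler_weXn2l ?weight_ge1 ?leq_maxr.
Qed.

Lemma growthM K L F G : growth K F -> growth L G ->
  growth (K + L) (fun t x y => F t x y * G t x y).
Proof.
move=> [C [p [C0 FC]]] [D [q [D0 GD]]]; exists (C * D), (p + q)%N; split; first exact: mulr_ge0.
move=> t x y t0 t1; rewrite normrM !exprD.
apply: (@le_trans _ _ ((C * t ^+ K * weight x y ^+ p) * (D * t ^+ L * weight x y ^+ q))).
  by rewrite ler_pM ?FC ?GD.
by rewrite le_eqVlt; apply/orP; left; apply/eqP; ring.
Qed.

Lemma growthS K L F : (L <= K)%N -> growth K F -> growth L F.
Proof.
move=> LK [C [p [C0 FC]]]; exists C, p; split => // t x y t0 t1.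
rewrite (le_trans (FC _ _ _ t0 t1))// ler_wpM2r ?exprn_ge0 ?weight_ge0// ler_wpM2l//.
by rewrite ler_wiXn2l// ltW.
Qed.

Lemma growth_cst c : growth 0 (fun _ _ _ => c).
Proof. by exists `|c|, 0; split => // t x y _ _; rewrite !mulr1. Qed.

Lemma growth_t K : growth K (fun t _ _ => t ^+ K).
Proof.
exists 1, 0; split => // t x y t0 t1.
by rewrite mul1r mulr1 ger0_norm// exprn_ge0// ltW.
Qed.

Let norm_le_sqr x : `|x| <= 1 + x ^+ 2.
Proof.
rewrite -real_normK ?num_real//; have := sqr_ge0 (`|x| - 1).
by rewrite -subr_ge0; have := normr_ge0 x; nra.
Qed.

Lemma growth_x : growth 0 (fun _ x _ => x).
Proof.
exists 1, 1; split => // t x y _ _; rewrite !mul1r expr1 -[leLHS]mulr1.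
by rewrite ler_pM ?norm_le_sqr// lerDl sqr_ge0.
Qed.

Lemma growth_y : growth 0 (fun _ _ y => y).
Proof.
exists 1, 1; split => // t x y _ _; rewrite !mul1r expr1 -[leLHS]mul1r.
by rewrite ler_pM ?norm_le_sqr// lerDl sqr_ge0.
Qed.

Lemma growth_sum K (I : Type) (r : seq I) (P : pred I) (F : I -> R -> R -> R -> R) :
  (forall i, P i -> growth K (F i)) -> growth K (fun t x y => \sum_(i <- r | P i) F i t x y).
Proof.
move=> FK; elim: r => [|i r [C [p [C0 IHr]]]].
  by exists 0, 0; split => // t x y _ _; rewrite big_nil normr0 !mul0r.
have [Pi|nPi] := boolP (P i); last first.
  exists C, p; split => // t x y t0 t1; rewrite big_cons (negbTE nPi); exact: IHr.
have [] := growthD (FK _ Pi) (ex_intro _ C (ex_intro _ p (conj C0 IHr))).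
move=> D [q [D0 FD]]; exists D, q; split => // t x y t0 t1.
by rewrite big_cons Pi; exact: FD.
Qed.

Lemma growth_exp K F n : growth K F -> growth (K * n) (fun t x y => F t x y ^+ n).
Proof.
move=> FK; elim: n => [|n IHn]; first by rewrite muln0; exact: growth_cst.
by rewrite mulnS; apply: growth_le (growthM FK IHn) => t x y _ _; rewrite exprS.
Qed.

Lemma growth_horner (p : {poly R}) : growth 0 (fun _ _ y => p.[y]).
Proof.
apply: (@growth_le _ _ (fun _ _ y => \sum_(i < size p) p`_i * y ^+ i)).
  by move=> t x y _ _; rewrite horner_coef.
apply: growth_sum => i _; apply: (growthM (growth_cst _)).
exact: growth_exp growth_y.
Qed.

Lemma growth_horner2 K (Q : {poly {poly R}}) : (forall k, (k < K)%N -> Q`_k = 0) ->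
  growth K (fun t _ y => Q.[t%:P].[y]).
Proof.
move=> Q0; apply: (@growth_le _ _ (fun t _ y => \sum_(i < size Q) (Q`_i).[y] * t ^+ i)).
  move=> t x y _ _; rewrite [Q.[_]]horner_coef horner_sum.
  by under eq_bigr do rewrite hornerM -rmorphXn hornerC.
apply: growth_sum => i _; have [iK|Ki] := ltnP i K.
  by exists 0, 0; split => // t x y _ _; rewrite Q0// horner0 mul0r normr0 !mul0r.
by apply: (@growthS i) => //; apply: (growthM (growth_horner _) (growth_t i)).
Qed.

Definition hermite_sum K (a y : R) := \sum_(k < K) a ^+ k * (nhermite k).[y].

(** The exponent t x y - (t x)^2/2 is O(t), so cutting the exponential series after K terms costs
    O(t^K). The polynomial left agrees with [hermite_sum K] except for powers t^i with i >= K,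
    collected in [rest]. *)
Lemma cmw_expansion K : exists C p, 0 <= C /\ forall t x y, 0 < t -> t <= 1 ->
  `|cmw (t * x) y - hermite_sum K (t * x) y| <=
  C * t ^+ K * weight x y ^+ p * (1 + cmw (t * x) y).
Proof.
pose S := maxn K (size (cm_poly K : {poly {poly R}})).
pose e t x y := t * x * y - (t * x) ^+ 2 / 2.
pose rest t x y := \sum_(i < S | (K <= i)%N) ((cm_poly K)`_i).[y] * (t * x) ^+ i.
have restE t x y : (exp_poly K).[e t x y] = hermite_sum K (t * x) y + rest t x y.
  rewrite -horner_cm_poly [(cm_poly K).[_]](horner_coef_wide _ (leq_maxr K _)) -/S horner_sum.
  rewrite (bigID (fun i : 'I_S => (i < K)%N))/=; congr (_ + _).
    rewrite /hermite_sum (big_ord_widen S (fun k => (t * x) ^+ k * (nhermite k).[y])) ?leq_maxl//.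
    by apply: eq_bigr => i iK; rewrite coef_cm_poly// hornerM -rmorphXn hornerC mulrC.
  apply: eq_big => [i|i _]; first by rewrite -leqNgt.
  by rewrite hornerM -rmorphXn hornerC.
have etK : growth K (fun t x y => e t x y ^+ K).
  rewrite -{1}(mul1n K); apply: growth_exp.
  apply: (@growth_le _ _ (fun t x y => t ^+ 1 * (x * y + (- 2^-1) * (t ^+ 1 * (x * x))))).
    move=> t x y _ _; rewrite /e le_eqVlt; apply/orP; left; apply/eqP; congr (`| _ |).
    by rewrite !expr1; ring.
  apply: (growthM (growth_t 1) (growthD (growthM growth_x growth_y) _)).
  apply: (growthM (growth_cst _)); apply: (@growthS 1) => //.
  exact: (growthM (growth_t 1) (growthM growth_x growth_x)).
have rK : growth K rest.
  apply: growth_sum => i Ki; apply: (@growthS i) => //.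
  apply: (growthM (growth_horner _)).
  apply: (@growth_le _ _ (fun t x y => t ^+ i * x ^+ i)).
    by move=> t x y _ _; rewrite exprMn.
  rewrite -{1}(addn0 i); apply: (growthM (growth_t i)).
  exact: growth_exp growth_x.
have [C [p [C0 eC]]] := etK; have [D [q [D0 rD]]] := rK.
exists (C + D), (maxn p q); split; first exact: addr_ge0.
move=> t x y t0 t1; have t0' := ltW t0.
have -> : cmw (t * x) y - hermite_sum K (t * x) y =
  (expR (e t x y) - (exp_poly K).[e t x y]) + rest t x y by rewrite restE /cmw /e; ring.
have w0 : 0 <= cmw (t * x) y by exact: cmw_ge0.
rewrite (le_trans (ler_normD _ _))// !mulrDl lerD//.
- rewrite (le_trans (exp_poly_bound _ _))//.
  rewrite -[1 + expR _]/(1 + cmw (t * x) y) ler_wpM2r ?addr_ge0//.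
  rewrite -normrX (le_trans (eC _ _ _ t0 t1))// ler_wpM2l ?mulr_ge0 ?exprn_ge0//.
  by rewrite ler_weXn2l ?weight_ge1 ?leq_maxl.
- apply: (@le_trans _ _ (D * t ^+ K * weight x y ^+ maxn p q)).
    rewrite (le_trans (rD _ _ _ t0 t1))// ler_wpM2l ?mulr_ge0 ?exprn_ge0//.
    by rewrite ler_weXn2l ?weight_ge1 ?leq_maxr.
  rewrite ler_peMr ?lerDl// !mulr_ge0 ?exprn_ge0 ?weight_ge0//.
Qed.

End Growth.

(** * Conditional expectation and mmse *)

Section Integrability.
Context d (T : measurableType d) (R : realType) (P : {measure set T -> \bar R}).
Implicit Types f g : T -> R.

Lemma integrable_dom f g : measurable_fun setT f -> P.-integrable setT (EFin \o g) ->
  (forall x, `|f x| <= g x) -> P.-integrable setT (EFin \o f).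
Proof.
move=> mf ig fg; apply: le_integrable ig => //; first exact/measurable_EFinP.
by move=> x _; rewrite lee_fin (le_trans (fg x))// ler_norm.
Qed.

Lemma integrable_mull k f : P.-integrable setT (EFin \o f) ->
  P.-integrable setT (EFin \o (fun x => k * f x)).
Proof. by move=> /(integrableZl measurableT k); apply: eq_integrable. Qed.

Lemma integrable_add f g : P.-integrable setT (EFin \o f) -> P.-integrable setT (EFin \o g) ->
  P.-integrable setT (EFin \o (fun x => f x + g x)).
Proof. by move=> fi gi; apply: eq_integrable (integrableD measurableT fi gi). Qed.

Lemma integrable_sub f g : P.-integrable setT (EFin \o f) -> P.-integrable setT (EFin \o g) ->
  P.-integrable setT (EFin \o (fun x => f x - g x)).
Proof. by move=> fi gi; apply: eq_integrable (integrableB measurableT fi gi). Qed.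

Lemma integrable_bigsum n (F : 'I_n -> T -> R) :
  (forall i, P.-integrable setT (EFin \o F i)) ->
  P.-integrable setT (EFin \o (fun x => \sum_i F i x)).
Proof.
move=> Fi; have := @integrable_sum _ _ _ P setT measurableT _ (index_enum 'I_n) xpredT
  (fun i => EFin \o F i) (fun i _ => Fi i).
by apply: eq_integrable => // x _; rewrite /= sumEFin.
Qed.

Lemma Rintegral_bigsum n (F : 'I_n -> T -> R) :
  (forall i, P.-integrable setT (EFin \o F i)) ->
  \int[P]_x (\sum_i F i x) = \sum_i \int[P]_x F i x.
Proof.
elim: n F => [|n IHn] F Fi.
  under eq_Rintegral do rewrite big_ord0.
  by rewrite big_ord0 /Rintegral integral0.
under eq_Rintegral do rewrite big_ord_recr.
rewrite RintegralD//=; last by apply: integrable_bigsum => i; exact: Fi.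
by rewrite IHn// big_ord_recr.
Qed.

Section Poly.
Variable X : T -> R.
Hypothesis Xi : forall n, P.-integrable setT (EFin \o (fun x => X x ^+ n)).

Lemma integrable_horner (p : {poly R}) : P.-integrable setT (EFin \o (fun x => p.[X x])).
Proof.
apply: (@eq_integrable _ _ _ P _ measurableT (EFin \o (fun x => \sum_(i < size p) p`_i * X x ^+ i))).
  by move=> x _ /=; rewrite horner_coef.
by apply: integrable_bigsum => i; exact: integrable_mull.
Qed.

Lemma Rintegral_horner (p : {poly R}) :
  \int[P]_x p.[X x] = \sum_(i < size p) p`_i * \int[P]_x (X x ^+ i).
Proof.
under eq_Rintegral do rewrite horner_coef.
rewrite Rintegral_bigsum => [|i]; last exact: integrable_mull.
by apply: eq_bigr => i _; rewrite RintegralZl.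
Qed.

Lemma integrable_weight p : P.-integrable setT (EFin \o (fun x => (1 + X x ^+ 2) ^+ p)).
Proof.
apply: eq_integrable (integrable_horner ((1 + 'X ^+ 2) ^+ p)) => // x _ /=.
by rewrite !hornerE.
Qed.

End Poly.
End Integrability.

Lemma expr_le_fact_expR (R : realType) n (x : R) : 0 <= x -> x ^+ n / n`!%:R <= expR x.
Proof.
case: n => [|n] x0; first by rewrite expr0 invr1 mulr1 -[leLHS]expR0 ler_expR.
by rewrite (le_trans _ (expR_ge1Dxn n x0))// lerDr.
Qed.

(** * Gaussian moments from the Cameron-Martin formula *)

Section GaussianMoments.
Context {R : realType}.
Local Notation gauss := (@gauss R).

Lemma integrable_cmw a : gauss.-integrable setT (EFin \o cmw a).
Proof.
apply/integrableP; split; first by apply/measurable_EFinP; exact: measurable_cmw.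
under eq_integral do rewrite /= ger0_norm ?cmw_ge0//.
have := @cameron_martin R a (cst 1%E) (measurable_cst _) (fun=> lee01).
rewrite integral_cst// [X in (1 * X)%E](@probability_setT _ _ _ gauss) mule1 => E.
have -> : (\int[gauss]_x (cmw a x)%:E = 1)%E; last by rewrite ltry.
by rewrite E; apply: eq_integral => y _; rewrite /= mul1e.
Qed.

(** |y|^n <= n! (exp y + exp (-y)), and the exponentials are multiples of the integrable weights
    [cmw 1] and [cmw (-1)]. *)
Lemma gauss_integrable n : gauss.-integrable setT (EFin \o (fun y : R => y ^+ n)).
Proof.
have i1 := integrable_mull n`!%:R (integrable_mull (expR 2^-1) (integrable_add (integrable_cmw 1) (integrable_cmw (-1)))).
apply: integrable_dom i1 _; first exact: (@measurable_funX _ R R setT id n).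
move=> y; rewrite normrX.
have -> : expR 2^-1 * (cmw 1 y + cmw (-1) y) = expR y + expR (- y).
  by rewrite mulrDr /cmw -!expRD; congr (expR _ + expR _); field.
have : expR `|y| <= expR y + expR (- y).
  by have [y0|y0] := leP 0 y; [rewrite ger0_norm// lerDl|rewrite ltr0_norm// lerDr]; rewrite expR_ge0.
move=> /(ler_wpM2l (ler0n _ n`!)); apply: le_trans.
by rewrite mulrC -ler_pdivrMr ?factR_gt0// expr_le_fact_expR.
Qed.

Definition gmom n : R := \int[gauss]_y (y ^+ n).

Lemma cameron_martin_R (a : R) (f : R -> R) : measurable_fun setT f ->
  \int[gauss]_n f (n + a) = \int[gauss]_y (f y * cmw a y).
Proof.
move=> mf; rewrite /Rintegral; congr fine; rewrite [LHS]integralE [RHS]integralE.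
have mE : measurable_fun setT (EFin \o f) by exact/measurable_EFinP.
have pos y : ((fun y => (f y * cmw a y)%:E)^\+ y = (EFin \o f)^\+ y * (cmw a y)%:E)%E.
  by rewrite !funeposE EFinM maxe_pMl ?mul0e// lee_fin cmw_ge0.
have neg y : ((fun y => (f y * cmw a y)%:E)^\- y = (EFin \o f)^\- y * (cmw a y)%:E)%E.
  by rewrite !funenegE EFinM -mulNe maxe_pMl ?mul0e// lee_fin cmw_ge0.
under [in RHS]eq_integral do rewrite pos.
under [X in _ = (_ - X)%E]eq_integral do rewrite neg.
rewrite -!cameron_martin//.
- by congr (_ - _)%E; apply: eq_integral => y _; rewrite !(funeposE, funenegE).
- exact: measurable_funeneg.
- exact: measurable_funepos.
Qed.

Lemma integrable_cmwM (a : R) (f : R -> R) : measurable_fun setT f ->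
  gauss.-integrable setT (EFin \o (fun y => f (y + a))) ->
  gauss.-integrable setT (EFin \o (fun y => f y * cmw a y)).
Proof.
move=> mf /integrableP[_ fi]; apply/integrableP; split.
  by apply/measurable_EFinP; apply: measurable_funM => //; exact: measurable_cmw.
have mE : measurable_fun setT (fun y => `|(f y)%:E|%E).
  by apply: measurableT_comp => //; exact/measurable_EFinP.
have := @cameron_martin R a _ mE (fun=> abse_ge0 _) => E.
rewrite (_ : (\int[gauss]_x _)%E = (\int[gauss]_n `|(f (n + a))%:E|)%E)// E.
by apply: eq_integral => y _; rewrite /= normrM EFinM (ger0_norm (cmw_ge0 _ _)).
Qed.

Lemma shift_weight_le (a y : R) : `|a| <= 1 -> 1 + (y + a) ^+ 2 <= 4%:R * (1 + y ^+ 2).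
Proof.
move=> a1; have : a ^+ 2 <= 1 by rewrite -real_normK ?num_real// exprn_ile1.
by have := sqr_ge0 (y - a); have := sqr_ge0 y; nra.
Qed.

Lemma gauss_integrable_weight p : gauss.-integrable setT (EFin \o (fun y : R => (1 + y ^+ 2) ^+ p)).
Proof. exact: integrable_weight gauss_integrable p. Qed.

Lemma measurable_weight p : measurable_fun setT (fun y : R => (1 + y ^+ 2) ^+ p).
Proof.
rewrite (_ : (fun _ => _) = horner ((1 + 'X ^+ 2) ^+ p)); first exact: measurable_poly.
by apply/funext => y; rewrite !hornerE.
Qed.

(** First-order expansion in a of E((N + a)^n) after the shift has been moved into the weight.
    Compared with the binomial formula it yields Stein's identity for monomials. *)
Lemma gmom_cm n : exists C, forall a, 0 < a -> a <= 1 ->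
  `|\int[gauss]_y ((y + a) ^+ n) - (gmom n + a * gmom n.+1)| <= C * a ^+ 2.
Proof.
have [C [p [C0 Cp]]] := @cmw_expansion R 2.
pose W q (y : R) := (1 + y ^+ 2) ^+ q.
pose I := \int[gauss]_y W (n + p)%N y.
have IW : gauss.-integrable setT (EFin \o W (n + p)%N) by exact: gauss_integrable_weight.
(* 2^p comes from [weight 1 y] = 2 (1 + y^2); 4^(n+p) comes from [shift_weight_le], once the weight
   is turned back into a shift. *)
exists (C * 2%:R ^+ p * (I + 4%:R ^+ (n + p) * I)) => a a0 a1.
have na : `|a| <= 1 by rewrite ger0_norm// ltW.
have mX k : measurable_fun setT (fun y : R => y ^+ k) by exact: (@measurable_funX _ R R setT id k).
have mW : measurable_fun setT (W (n + p)%N) by exact: measurable_weight.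
have iXa : gauss.-integrable setT (EFin \o (fun y : R => (y + a) ^+ n)).
  apply: eq_integrable (integrable_horner gauss_integrable (('X + a%:P) ^+ n)) => // y _ /=.
  by rewrite !hornerE.
have iWa : gauss.-integrable setT (EFin \o (fun y : R => W (n + p)%N (y + a))).
  apply: eq_integrable (integrable_horner gauss_integrable ((1 + ('X + a%:P) ^+ 2) ^+ (n + p))) => // y _ /=.
  by rewrite !hornerE.
have iXw := integrable_cmwM (mX n) iXa.
have iWw := integrable_cmwM mW iWa.
have i1 : gauss.-integrable setT (EFin \o (fun y : R => y ^+ n + a * y ^+ n.+1)).
  by apply: integrable_add; [exact: gauss_integrable|apply: integrable_mull; exact: gauss_integrable].
have iD : gauss.-integrable setT
    (EFin \o (fun y => y ^+ n * cmw a y - (y ^+ n + a * y ^+ n.+1))) by exact: integrable_sub.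
rewrite (cameron_martin_R a (mX n)) /gmom -RintegralZl//; last exact: gauss_integrable.
rewrite -RintegralD//; [|exact: gauss_integrable|exact: integrable_mull (gauss_integrable _)].
rewrite -RintegralB// (le_trans (le_normr_Rintegral _ iD))//.
have iB : gauss.-integrable setT (EFin \o (fun y => C * a ^+ 2 * 2%:R ^+ p *
    (W (n + p)%N y + W (n + p)%N y * cmw a y))).
  by apply: integrable_mull; exact: integrable_add.
apply: (@le_trans _ _ (\int[gauss]_y (C * a ^+ 2 * 2%:R ^+ p *
    (W (n + p)%N y + W (n + p)%N y * cmw a y)))).
  apply: le_Rintegral => //; first exact: integrable_norm.
  move=> y _; have := Cp a 1 y a0 a1; rewrite mulr1.
  have -> : hermite_sum 2 a y = 1 + a * y.
    rewrite /hermite_sum big_ord_recl big_ord1 /= nhermite0 hornerC mulr1 expr0 expr1.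
    rewrite /nhermite hermiteS (_ : hermite 0 = 1)// derivC subr0 mulr1.
    by rewrite (_ : (bump 0 0)`! = 1%N)// invr1 scale1r hornerX.
  have -> : weight 1 y = 2%:R * (1 + y ^+ 2) by rewrite /weight expr1n.
  rewrite exprMn => h.
  rewrite (_ : _ - _ = y ^+ n * (cmw a y - (1 + a * y))); last by rewrite exprS; ring.
  rewrite normrM normrX.
  have yn : `|y| ^+ n <= (1 + y ^+ 2) ^+ n.
    rewrite lerXn2r ?nnegrE//; first by rewrite addr_ge0// sqr_ge0.
    rewrite -real_normK ?num_real//; have := sqr_ge0 (`|y| - 1); have := normr_ge0 y; nra.
  apply: (le_trans (ler_pM _ _ yn h)) => //.
  by rewrite le_eqVlt; apply/orP; left; apply/eqP; rewrite /W exprD; ring.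
rewrite RintegralZl//; last exact: integrable_add.
rewrite RintegralD// -/I -(cameron_martin_R a mW).
rewrite [C * a ^+ 2 * _]mulrAC [leLHS]mulrAC ler_wpM2r ?sqr_ge0//.
rewrite ler_wpM2l ?mulr_ge0 ?exprn_ge0// lerD2l -RintegralZl//; apply: le_Rintegral => //; first exact: integrable_mull.
move=> y _; rewrite /W -exprMn lerXn2r ?nnegrE ?shift_weight_le//.
- by rewrite addr_ge0// sqr_ge0.
- by rewrite mulr_ge0// addr_ge0// sqr_ge0.
Qed.

Lemma gmomS n : gmom n.+1 = n%:R * gmom n.-1.
Proof.
have [C HC] := gmom_cm n.
pose D : {poly R} := \poly_(k < n.+1) (gmom (n - k) *+ 'C(n, k)) - (gmom n)%:P - gmom n.+1 *: 'X.
have DE a : D.[a] = \int[gauss]_y ((y + a) ^+ n) - (gmom n + a * gmom n.+1).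
  rewrite /D !hornerE horner_poly opprD addrA [_ * a]mulrC; congr (_ - _ - _).
  under eq_Rintegral do rewrite exprDn.
  rewrite Rintegral_bigsum => [|i]; last first.
    apply: eq_integrable (integrable_mull (a ^+ i *+ 'C(n, i)) (gauss_integrable (n - i))) => // y _ /=.
    by rewrite mulrnAl mulrC.
  apply: eq_bigr => i _; rewrite mulrnAl mulrC -mulrnAl -RintegralZl//; last exact: gauss_integrable.
  by apply: eq_Rintegral => y _; rewrite mulrnAl mulrC.
have D0 i : (i < 1)%N -> D`_i = 0.
  case: i => // _; rewrite /D !coefB coefC coefZ coefX coef_poly /= subn0 bin0 mulr1n mulr0 subr0.
  by rewrite subrr.
have D1 : D`_1 = n%:R * gmom n.-1 - gmom n.+1.
  rewrite /D !coefB coefC coefZ coefX coef_poly /= subr0 mulr1; congr (_ - _).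
  by case: n {HC D DE D0} => [|n]; rewrite ?mul0r//= bin1 subn1 mulr_natl.
(* D is O(a^2) from both sides, so its linear coefficient has both signs. *)
have up : 0 <= D`_1.
  apply: (@poly_lead_ge0 _ D C 1) => // t t0 t1.
  by have := HC t t0 (ltW t1); rewrite -DE ler_norml => /andP[].
have dn : 0 <= (- D)`_1.
  apply: (@poly_lead_ge0 _ (- D) C 1) => // [i i1|t t0 t1]; first by rewrite coefN D0// oppr0.
  by have := HC t t0 (ltW t1); rewrite -DE ler_norml hornerN lerN2 => /andP[].
move: up dn; rewrite coefN oppr_ge0 => h1 h2.
by apply/eqP; rewrite -subr_eq0 -opprB -D1 oppr_eq0 eq_le h1 h2.
Qed.

Lemma gmomE n : gmom n = gauss_moment n.
Proof.
have g0 : gmom 0 = 1.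
  rewrite /gmom; under eq_Rintegral do rewrite expr0.
  by rewrite Rintegral_cst// mul1r [X in fine X](@probability_setT _ _ _ gauss).
have [] : gmom n = gauss_moment n /\ gmom n.+1 = gauss_moment n.+1; last by [].
elim: n => [|n [IH1 IH2]]; first by split; rewrite ?g0// gmomS mul0r.
by split => //; rewrite gmomS gauss_momentSS IH1.
Qed.

Lemma Rintegral_gauss_horner (p : {poly R}) : \int[gauss]_y p.[y] = gauss_fun p.
Proof.
rewrite (Rintegral_horner gauss_integrable); apply: eq_bigr => i _.
by rewrite -gmomE.
Qed.

End GaussianMoments.

Lemma funepos_mulr (T : Type) (R : realType) (F : T -> \bar R) (w : T -> R) : (forall z, 0 <= w z) ->
  ((fun z => F z * (w z)%:E)^\+ = fun z => F^\+ z * (w z)%:E)%E.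
Proof.
by move=> w0; apply/funext => z; rewrite !funeposE maxe_pMl ?mul0e// lee_fin.
Qed.

Lemma funeneg_mulr (T : Type) (R : realType) (F : T -> \bar R) (w : T -> R) : (forall z, 0 <= w z) ->
  ((fun z => F z * (w z)%:E)^\- = fun z => F^\- z * (w z)%:E)%E.
Proof.
by move=> w0; apply/funext => z; rewrite !funenegE -mulNe maxe_pMl ?mul0e// lee_fin.
Qed.

Section Mmse.
Context {R : realType} (mu : probability R R).
Local Notation gauss := (@gauss R).
Local Notation RG := (R * measurableTypeR R)%type.
Local Notation prod := (mu \x gauss)%E.
Variable t : R.

Definition obst (z : RG) : R := t * z.1 + z.2.
Definition cmwt (z : RG) : R := cmw (t * z.1) z.2.

Lemma measurable_snd_real : measurable_fun setT (fun z : RG => (z.2 : R)).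
Proof. exact: measurable_snd. Qed.

Lemma measurable_obst : measurable_fun setT obst.
Proof.
apply: measurable_funD; last exact: measurable_snd_real.
by apply: measurable_funM => //; exact: measurable_fst.
Qed.

Lemma measurable_cmwt : measurable_fun setT cmwt.
Proof.
apply: measurableT_comp => //; apply: measurable_funB.
  apply: measurable_funM; last exact: measurable_snd_real.
  by apply: measurable_funM => //; exact: measurable_fst.
apply: measurable_funM => //; apply: measurable_funX.
by apply: measurable_funM => //; exact: measurable_fst.
Qed.

Lemma cmwt_ge0 z : 0 <= cmwt z. Proof. exact: cmw_ge0. Qed.

Lemma measurable_fst_obst : measurable_fun setT (fun z : RG => (z.1, obst z) : RG).
Proof. by apply: measurable_fun_pair; [exact: measurable_fst|exact: measurable_obst]. Qed.

(** Given X = x the observation is N shifted by t x, so the law of (X, tX + N) has density [cmwt]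
    with respect to the product law. *)
Lemma ge0_integral_obst (F : RG -> \bar R) :
  measurable_fun setT F -> (forall z, 0 <= F z)%E ->
  (\int[prod]_z F (z.1, obst z) = \int[prod]_z (F z * (cmwt z)%:E))%E.
Proof.
move=> mF F0; rewrite fubini_tonelli1//; last exact: measurableT_comp mF measurable_fst_obst.
rewrite fubini_tonelli1//; first last.
- by move=> z; rewrite mule_ge0// lee_fin cmwt_ge0.
- by apply: emeasurable_funM => //; apply/measurable_EFinP; exact: measurable_cmwt.
apply: eq_integral => x _; rewrite /fubini_F/=.
rewrite -(@cameron_martin R (t * x) (fun y => F (x, y)))//.
  by apply: eq_integral => y _; rewrite /obst /= addrC.
exact: (measurable_fun_pair2 x mF).
Qed.

Lemma integral_obst (F : RG -> \bar R) : measurable_fun setT F ->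
  (\int[prod]_z F (z.1, obst z) = \int[prod]_z (F z * (cmwt z)%:E))%E.
Proof.
move=> mF; rewrite [LHS]integralE [RHS]integralE.
rewrite funepos_mulr ?funeneg_mulr; [|exact: cmwt_ge0..].
rewrite -!ge0_integral_obst//; [|exact: measurable_funeneg|exact: measurable_funepos].
by congr (_ - _)%E; apply: eq_integral => z _; rewrite !(funeposE, funenegE).
Qed.

End Mmse.

Lemma cmw_le (R : realType) (a y : R) : cmw a y <= expR (y ^+ 2 / 2).
Proof. by rewrite ler_expR; have := sqr_ge0 (y - a); nra. Qed.

(** * Bayes' formula for the posterior mean *)

Section PosteriorMean.
Context {R : realType} (mu : probability R R).
Local Notation gauss := (@gauss R).
Local Notation RG := (R * measurableTypeR R)%type.
Local Notation prod := (mu \x gauss)%E.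
Hypothesis mom : forall n, mu.-integrable setT (EFin \o (fun x : R => x ^+ n)).
Variable t : R.
Implicit Types (y q : R) (f : R -> R).

Definition moment n : R := \int[mu]_x (x ^+ n).

Lemma integrable_mul_cmw f y : mu.-integrable setT (EFin \o f) ->
  mu.-integrable setT (EFin \o (fun x => f x * cmw (t * x) y)).
Proof.
move=> fi; have mf : measurable_fun setT f by apply/measurable_EFinP; exact: measurable_int fi.
apply: (integrable_dom _ (integrable_mull (expR (y ^+ 2 / 2)) (integrable_norm fi))).
  apply: measurable_funM => //; exact: (measurable_fun_pair1 (f := cmwt t) y (measurable_cmwt t)).
by move=> x /=; rewrite normrM mulrC (ger0_norm (cmw_ge0 _ _)) ler_wpM2r ?cmw_le.
Qed.

Lemma integrable_poly (p : {poly R}) : mu.-integrable setT (EFin \o horner p).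
Proof. exact: integrable_horner. Qed.

Lemma integrable_poly_cmw (p : {poly R}) y :
  mu.-integrable setT (EFin \o (fun x => p.[x] * cmw (t * x) y)).
Proof. exact: integrable_mul_cmw (integrable_poly p). Qed.

(** Density of tX + N with respect to [gauss], the denominator in Bayes' formula. *)
Definition evidence y : R := \int[mu]_x cmw (t * x) y.
Definition evidence1 y : R := \int[mu]_x (x * cmw (t * x) y).
Definition post_mean y : R := evidence1 y / evidence y.

Lemma integrable_cmwt y : mu.-integrable setT (EFin \o (fun x => cmw (t * x) y)).
Proof.
apply: eq_integrable (integrable_poly_cmw 1 y) => // x _ /=.
by rewrite hornerC mul1r.
Qed.

Lemma integrable_id_cmwt y : mu.-integrable setT (EFin \o (fun x => x * cmw (t * x) y)).
Proof.
by apply: eq_integrable (integrable_poly_cmw 'X y) => // x _ /=; rewrite hornerX.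
Qed.

Lemma Rintegral_quad (a b c : R) : \int[mu]_x (a + b * x + c * x ^+ 2) =
  a + b * moment 1 + c * moment 2.
Proof.
pose p : {poly R} := a%:P + b *: 'X + c *: 'X^2.
transitivity (\int[mu]_x p.[x]); first by apply: eq_Rintegral => x _; rewrite !hornerE.
have m0 : \int[mu]_x (x ^+ 0) = 1.
  under eq_Rintegral do rewrite expr0.
  by rewrite Rintegral_cst// mul1r [X in fine X]probability_setT.
have i0 : mu.-integrable setT (EFin \o (fun x => a%:P.[x])) by exact: integrable_poly.
have i1 : mu.-integrable setT (EFin \o (fun x : R => b * x)).
  by apply: eq_integrable (integrable_mull b (mom 1)) => // x _ /=; rewrite expr1.
have i2 : mu.-integrable setT (EFin \o (fun x : R => c * x ^+ 2)) by exact: integrable_mull.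
transitivity (\int[mu]_x ((a%:P.[x] + b * x) + c * x ^+ 2)).
  by apply: eq_Rintegral => x _; rewrite !hornerE.
rewrite RintegralD//; last exact: integrable_add.
rewrite RintegralD// /moment -!RintegralZl//; congr (_ + _ + _).
- under eq_Rintegral do rewrite hornerC.
  by rewrite Rintegral_cst// [X in fine X]probability_setT mulr1.
Qed.

(** Jensen's inequality for exp, by the tangent at the mean c of t x y - (t x)^2/2. *)
Lemma evidence_ge y : expR (t * y * moment 1 - t ^+ 2 / 2 * moment 2) <= evidence y.
Proof.
set c := (X in expR X).
rewrite /evidence; apply: (@le_trans _ _ (\int[mu]_x
   (expR c * (1 - c) + expR c * (t * y) * x + (- (expR c * (t ^+ 2 / 2))) * x ^+ 2))).
  rewrite Rintegral_quad le_eqVlt; apply/orP; left; apply/eqP.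
  by move: (expR c) => E; rewrite /c; ring.
apply: le_Rintegral => //.
- apply: eq_integrable (integrable_poly ((expR c * (1 - c))%:P + (expR c * (t * y)) *: 'X +
     (- (expR c * (t ^+ 2 / 2))) *: 'X^2)) => // x _ /=.
  by rewrite !hornerE.
- exact: integrable_cmwt.
move=> x _; have := expR_ge1Dx (t * x * y - (t * x) ^+ 2 / 2 - c).
move=> /(ler_wpM2l (expR_ge0 c)); rewrite -expRD [c + _]addrC subrK => h.
by apply: le_trans h; rewrite le_eqVlt; apply/orP; left; apply/eqP; ring.
Qed.

Lemma evidence_gt0 y : 0 < evidence y.
Proof. exact: lt_le_trans (expR_gt0 _) (evidence_ge y). Qed.

Definition post_risk q y : R := \int[mu]_x ((x - q) ^+ 2 * cmw (t * x) y).

Lemma integrable_post_risk q y :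
  mu.-integrable setT (EFin \o (fun x => (x - q) ^+ 2 * cmw (t * x) y)).
Proof.
apply: eq_integrable (integrable_poly_cmw (('X - q%:P) ^+ 2) y) => // x _ /=.
by rewrite !hornerE.
Qed.

(** Pythagoras for the posterior law at a fixed observation y. *)
Lemma post_risk_split q y : post_risk q y =
  post_risk (post_mean y) y + (evidence1 y - q * evidence y) ^+ 2 / evidence y.
Proof.
have quad a : post_risk a y = \int[mu]_x (x ^+ 2 * cmw (t * x) y)
    - 2 * a * evidence1 y + a ^+ 2 * evidence y.
  rewrite /post_risk /evidence1 /evidence.
  rewrite -RintegralZl//; last exact: integrable_id_cmwt.
  rewrite -RintegralZl//; last exact: integrable_cmwt.
  have i2 : mu.-integrable setT (EFin \o (fun x => x ^+ 2 * cmw (t * x) y)).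
    by exact: integrable_mul_cmw.
  have i1 : mu.-integrable setT (EFin \o (fun x => 2 * a * (x * cmw (t * x) y))).
    by apply: integrable_mull; exact: integrable_id_cmwt.
  have i0 : mu.-integrable setT (EFin \o (fun x => a ^+ 2 * cmw (t * x) y)).
    by apply: integrable_mull; exact: integrable_cmwt.
  rewrite -RintegralB// -RintegralD//; last exact: integrable_sub.
  by apply: eq_Rintegral => x _; ring.
have := gt_eqF (evidence_gt0 y) => Z0.
rewrite !quad /post_mean; field; exact/negbT.
Qed.

Lemma post_risk_ge0 q y : 0 <= post_risk q y.
Proof. by apply: Rintegral_ge0 => x _; rewrite mulr_ge0 ?sqr_ge0 ?cmw_ge0. Qed.

(** Cauchy-Schwarz, from the nonnegative posterior variance of f at its posterior mean a. *)
Lemma sqr_Rintegral_cmw_le (f : R -> R) y :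
  mu.-integrable setT (EFin \o f) -> mu.-integrable setT (EFin \o (fun x => f x ^+ 2)) ->
  (\int[mu]_x (f x * cmw (t * x) y)) ^+ 2 / evidence y <=
  \int[mu]_x (f x ^+ 2 * cmw (t * x) y).
Proof.
move=> f1 f2; set I := \int[mu]_x (f x * _); have Z0 := evidence_gt0 y.
pose a := I / evidence y.
have : 0 <= \int[mu]_x ((f x - a) ^+ 2 * cmw (t * x) y).
  by apply: Rintegral_ge0 => x _; rewrite mulr_ge0 ?sqr_ge0 ?cmw_ge0.
have i2 := integrable_mul_cmw y f2.
have i1 : mu.-integrable setT (EFin \o (fun x => 2 * a * (f x * cmw (t * x) y))).
  by apply: integrable_mull; exact: integrable_mul_cmw.
have i0 : mu.-integrable setT (EFin \o (fun x => a ^+ 2 * cmw (t * x) y)).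
  by apply: integrable_mull; exact: integrable_cmwt.
have -> : \int[mu]_x ((f x - a) ^+ 2 * cmw (t * x) y) =
    \int[mu]_x (f x ^+ 2 * cmw (t * x) y) - 2 * a * I + a ^+ 2 * evidence y.
  rewrite /I /evidence -RintegralZl//; last exact: integrable_mul_cmw.
  rewrite -RintegralZl//; last exact: integrable_cmwt.
  rewrite -RintegralB// -RintegralD//; last exact: integrable_sub.
  by apply: eq_Rintegral => x _; ring.
rewrite -subr_ge0; congr (0 <= _); rewrite /a; field; exact: lt0r_neq0.
Qed.

End PosteriorMean.

Section ConditionalExpectation.
Context {R : realType} (mu : probability R R).
Local Notation gauss := (@gauss R).
Local Notation RG := (R * measurableTypeR R)%type.
Local Notation prod := (mu \x gauss)%E.
Hypothesis mom : forall n, mu.-integrable setT (EFin \o (fun x : R => x ^+ n)).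
Variable t : R.
Implicit Types (q : R -> R).

Lemma measurable_fst_X n : measurable_fun setT (fun z : RG => z.1 ^+ n).
Proof. by apply: measurable_funX; exact: measurable_fst. Qed.

Lemma integrable_fst_X n : prod.-integrable setT (fun z : RG => (z.1 ^+ n)%:E).
Proof.
apply/integrable12ltyP; first by apply/measurable_EFinP; exact: measurable_fst_X.
have [_] := integrableP _ _ _ (mom n); congr (_ < _)%E; apply: eq_integral => x _ /=.
by rewrite integral_cst// [X in (_ * X)%E](@probability_setT _ _ _ gauss) mule1.
Qed.

Lemma integrable_fst_X_cmwt n : prod.-integrable setT (fun z : RG => (z.1 ^+ n * cmwt t z)%:E).
Proof.
apply/integrableP; split.
  apply/measurable_EFinP; apply: measurable_funM; first exact: measurable_fst_X.
  exact: measurable_cmwt.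
have [_] := integrableP _ _ _ (integrable_fst_X n); congr (_ < _)%E.
have mF : measurable_fun setT (fun z : RG => `|(z.1 ^+ n)%:E|%E).
  by apply: measurableT_comp => //; apply/measurable_EFinP; exact: measurable_fst_X.
have /= -> := @ge0_integral_obst R mu t _ mF (fun=> abse_ge0 _).
by apply: eq_integral => z _; rewrite normrM EFinM (ger0_norm (cmwt_ge0 _ _)).
Qed.

Lemma integral_obst_fubini (f : RG -> R) : measurable_fun setT f ->
  prod.-integrable setT (fun z => (f z * cmwt t z)%:E) ->
  (\int[prod]_z (f (z.1, obst t z))%:E =
   \int[gauss]_y \int[mu]_x (f (x, y) * cmw (t * x) y)%:E)%E.
Proof.
move=> mf fi; rewrite (@integral_obst R mu t (EFin \o f)); last exact/measurable_EFinP.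
by rewrite -(integral21_prod_meas1 fi).
Qed.

Lemma EFin_Rintegral (f : R -> R) : mu.-integrable setT (EFin \o f) ->
  (\int[mu]_x (f x)%:E = (\int[mu]_x f x)%R%:E)%E.
Proof. by move=> fi; rewrite fineK//; exact: integrable_fin_num fi. Qed.

Lemma measurable_evidence : measurable_fun setT (evidence mu t).
Proof.
have i0 : prod.-integrable setT (fun z => (cmwt t z)%:E).
  apply: eq_integrable (integrable_fst_X_cmwt 0) => // z _ /=.
  by rewrite expr0 mul1r.
apply/measurable_EFinP; apply: eq_measurable_fun (measurable_fubini_G i0) => y _.
by rewrite /fubini_G EFin_Rintegral//; exact: integrable_cmwt.
Qed.

Lemma measurable_evidence1 : measurable_fun setT (evidence1 mu t).
Proof.
apply/measurable_EFinP; apply: eq_measurable_fun (measurable_fubini_G (integrable_fst_X_cmwt 1)) => y _.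
by rewrite /fubini_G /= -EFin_Rintegral//; exact: integrable_id_cmwt.
Qed.

Lemma measurable_post_mean : measurable_fun setT (post_mean mu t).
Proof.
(* The inverse is written exp (- ln), legitimate since [evidence] is positive, to get measurability
   by composition. *)
have -> : post_mean mu t = fun y => evidence1 mu t y * expR (- ln (evidence mu t y)).
  by apply/funext => y; rewrite expRN lnK// posrE evidence_gt0.
apply: measurable_funM; first exact: measurable_evidence1.
apply: measurableT_comp => //; apply: measurableT_comp => //.
exact: measurableT_comp (@measurable_ln R) measurable_evidence.
Qed.

Lemma measurable_sqr_sub q : measurable_fun setT q ->
  measurable_fun setT (fun z : RG => (z.1 - q z.2) ^+ 2).
Proof.
move=> mq; apply: measurable_funX; apply: measurable_funB; first exact: measurable_fst.
exact: measurableT_comp mq (@measurable_snd_real R).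
Qed.

Lemma integral_sqr_obst q : measurable_fun setT q ->
  (\int[prod]_z ((z.1 - q (obst t z)) ^+ 2)%:E =
   \int[gauss]_y (post_risk mu t (q y) y)%:E)%E.
Proof.
move=> mq; have mF : measurable_fun setT (fun z : RG => ((z.1 - q z.2) ^+ 2)%:E).
  by apply/measurable_EFinP; exact: measurable_sqr_sub.
have F0 (z : RG) : (0 <= ((z.1 - q z.2) ^+ 2)%:E)%E by rewrite lee_fin sqr_ge0.
rewrite (@ge0_integral_obst R mu t _ mF F0) fubini_tonelli2//; first last.
- by move=> z; rewrite mule_ge0// lee_fin cmwt_ge0.
- by apply: emeasurable_funM => //; apply/measurable_EFinP; exact: measurable_cmwt.
apply: eq_integral => y _; rewrite /fubini_G /=.
by rewrite -EFin_Rintegral//; exact: integrable_post_risk.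
Qed.

(** For each y the absolute value of [evidence1] is at most the integral of |x| against the weight,
    so X itself dominates. *)
Lemma integrable_post_mean_cmwt :
  prod.-integrable setT (fun z : RG => (post_mean mu t z.2 * cmwt t z)%:E).
Proof.
have mr : measurable_fun setT (fun z : RG => (post_mean mu t z.2 * cmwt t z)%:E).
  apply/measurable_EFinP; apply: measurable_funM; last exact: measurable_cmwt.
  exact: measurableT_comp measurable_post_mean (@measurable_snd_real R).
apply/(integrable21ltyP mu gauss mr).
have [m1 i1] := integrableP _ _ _ (integrable_fst_X_cmwt 1).
rewrite fubini_tonelli2 in i1; [|by apply: measurableT_comp|by move=> z; exact: abse_ge0].
apply: le_lt_trans i1; apply: ge0_le_integral => //.
- by move=> y _; exact: integral_ge0.
- apply: (@measurable_fun_fubini_tonelli_G _ _ _ _ _ mu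
    (fun z : RG => `|(post_mean mu t z.2 * cmwt t z)%:E|%E)).
    exact: measurableT_comp.
  by move=> z; exact: abse_ge0.
- apply: (@measurable_fun_fubini_tonelli_G _ _ _ _ _ mu
    (fun z : RG => `|(z.1 ^+ 1 * cmwt t z)%:E|%E)).
    exact: measurableT_comp.
  by move=> z; exact: abse_ge0.
move=> y _; rewrite /fubini_G/=.
have iw := integrable_cmwt mom t y; have ix := integrable_id_cmwt mom t y.
under eq_integral do rewrite normrM (ger0_norm (cmw_ge0 _ _)).
rewrite EFin_Rintegral; last exact: integrable_mull.
rewrite EFin_Rintegral; last exact: (integrable_norm ix).
rewrite lee_fin RintegralZl// -/(evidence mu t y) /post_mean normrM normfV.
rewrite [`|evidence _ _ _|]gtr0_norm ?evidence_gt0// divfK ?gt_eqF ?evidence_gt0//.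
exact: le_normr_Rintegral.
Qed.

Lemma is_cond_exp_post_mean (s : R) : t = Num.sqrt s -> is_cond_exp mu s (post_mean mu t).
Proof.
move=> ts; have mr := measurable_post_mean; have ri := integrable_post_mean_cmwt.
have obsE : obs s = obst t :> (RG -> R) by rewrite ts.
rewrite /is_cond_exp obsE; split => //.
- have mo : measurable_fun setT (fun z : RG => post_mean mu t (obst t z)).
    exact: measurableT_comp mr (measurable_obst t).
  apply/integrableP; split; first exact/measurable_EFinP.
  have [_] := integrableP _ _ _ ri; congr (_ < _)%E.
  have mF : measurable_fun setT (fun z : RG => `|(post_mean mu t z.2)%:E|%E).
    apply: measurableT_comp => //; apply/measurable_EFinP.
    exact: measurableT_comp mr (@measurable_snd_real R).
  have /= -> := @ge0_integral_obst R mu t _ mF (fun=> abse_ge0 _).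
  by apply: eq_integral => z _; rewrite normrM EFinM (ger0_norm (cmwt_ge0 _ _)).
(* In the coordinates (x, y) the indicator of B depends on y alone and leaves the inner integral
   over x. *)
move=> B mB; rewrite integral_mkcond [RHS]integral_mkcond.
pose f (z : R * R) : R := z.1 * \1_B z.2; pose g (z : R * R) : R := post_mean mu t z.2 * \1_B z.2.
have mB' : measurable_fun setT (fun z : RG => \1_B (z.2 : R) : R).
  by apply: measurableT_comp (@measurable_snd_real R); exact: measurable_indic.
have nB (y : R) : `|\1_B y : R| <= 1 by rewrite indicE; case: (_ \in _); rewrite ?normr1 ?normr0.
have -> : ((fun z : RG => (z.1)%:E) \_ (obst t @^-1` B) = fun z => (f (z.1, obst t z))%:E)%E.
  apply/funext => z; rewrite patchE /f /= indicE -[z \in _]/(obst t z \in B).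
  by case: ifPn => _; rewrite ?mulr1 ?mulr0.
have -> : ((fun z : RG => (post_mean mu t (obst t z))%:E) \_ (obst t @^-1` B)
    = fun z => (g (z.1, obst t z))%:E)%E.
  apply/funext => z; rewrite patchE /g /= indicE -[z \in _]/(obst t z \in B).
  by case: ifPn => _; rewrite ?mulr1 ?mulr0.
have mf : measurable_fun setT (f : RG -> R).
  by apply: measurable_funM => //; exact: measurable_fst.
have mg : measurable_fun setT (g : RG -> R).
  by apply: measurable_funM => //; exact: measurableT_comp mr (@measurable_snd_real R).
have fi : prod.-integrable setT (fun z => (f z * cmwt t z)%:E).
  apply: le_integrable (integrable_fst_X_cmwt 1) => //.
    by apply/measurable_EFinP; apply: measurable_funM => //; exact: measurable_cmwt.
  move=> z _; rewrite lee_fin !normrM expr1 ler_wpM2r//.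
  by rewrite -[leRHS]mulr1 ler_wpM2l.
have gi : prod.-integrable setT (fun z => (g z * cmwt t z)%:E).
  apply: le_integrable ri => //.
    by apply/measurable_EFinP; apply: measurable_funM => //; exact: measurable_cmwt.
  move=> z _; rewrite lee_fin !normrM ler_wpM2r//.
  by rewrite -[leRHS]mulr1 ler_wpM2l.
rewrite (integral_obst_fubini mf fi) (integral_obst_fubini mg gi).
apply: eq_integral => y _; rewrite /f /g /=.
have iw := integrable_cmwt mom t y; have ix := integrable_id_cmwt mom t y.
transitivity ((\1_B y * evidence1 mu t y)%:E).
  rewrite /evidence1 -RintegralZl// -EFin_Rintegral; last exact: integrable_mull.
  by apply: eq_integral => x _; congr EFin; rewrite mulrCA mulrA.
have -> : \1_B y * evidence1 mu t y = post_mean mu t y * \1_B y * evidence mu t y.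
  by rewrite /post_mean mulrAC divfK ?gt_eqF ?evidence_gt0// mulrC.
by rewrite /evidence -RintegralZl// EFin_Rintegral//; exact: integrable_mull.
Qed.

End ConditionalExpectation.

Section MmseFormula.
Context {R : realType} (mu : probability R R).
Local Notation gauss := (@gauss R).
Local Notation RG := (R * measurableTypeR R)%type.
Local Notation prod := (mu \x gauss)%E.

Lemma measurable_obs (s : R) : measurable_fun setT (obs s : RG -> R).
Proof. exact: (measurable_obst (Num.sqrt s)). Qed.

(** Pushed forward to the law of Y_s, both versions have the same integral over every Borel set. *)
Lemma cond_exp_unique s (g h : R -> R) : is_cond_exp mu s g -> is_cond_exp mu s h ->
  {ae prod, forall z, g (obs s z) = h (obs s z)}.
Proof.
move=> [mg ig Eg] [mh ih Eh].
have mo := measurable_obs s.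
have mOE E : measurable E -> measurable (obs s @^-1` E : set RG).
  by move=> mE; rewrite -[X in measurable X]setTI; exact: mo.
pose pi' : {measure set R -> \bar R} := pushforward prod (obs s); pose pi := pi' mo.
have mEg : measurable_fun setT (EFin \o g) by exact/measurable_EFinP.
have mEh : measurable_fun setT (EFin \o h) by exact/measurable_EFinP.
have gi : pi.-integrable setT (EFin \o g).
  by apply: integrable_pushforward.
have hi : pi.-integrable setT (EFin \o h).
  by apply: integrable_pushforward.
have [N [mN N0 gN]] : ae_eq pi setT (EFin \o g) (EFin \o h).
  apply: integral_ae_eq => // E _ mE.
  have giE : prod.-integrable (obs s @^-1` E) ((EFin \o g) \o obs s).
    by apply: (integrableS measurableT) => //; exact: mOE.
  have hiE : prod.-integrable (obs s @^-1` E) ((EFin \o h) \o obs s).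
    by apply: (integrableS measurableT) => //; exact: mOE.
  rewrite (integral_pushforward mo mEg giE mE) (integral_pushforward mo mEh hiE mE).
  by have := Eg E mE; rewrite Eh.
exists (obs s @^-1` N); split; [exact: mOE|exact: N0|].
move=> z /= ghz; apply: gN => /=; apply: contra_not ghz => ghz.
by have [] := ghz I.
Qed.

Hypothesis mom : forall n, mu.-integrable setT (EFin \o (fun x : R => x ^+ n)).

Lemma mmse_lawE s : mmse_law mu s =
  (\int[gauss]_y (post_risk mu (Num.sqrt s) (post_mean mu (Num.sqrt s) y) y)%:E)%E.
Proof.
set t := Num.sqrt s; have rP : is_cond_exp mu s (post_mean mu t) by exact: is_cond_exp_post_mean.
(* The posterior mean witnesses existence, so the choice in [cond_exp] is a genuine version and not
   its default 0. *)
have cP : is_cond_exp mu s (cond_exp mu s) by apply: xgetPex; exists (post_mean mu t).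
rewrite -integral_sqr_obst//; last exact: measurable_post_mean.
have mr : measurable_fun setT (post_mean mu t) by exact: measurable_post_mean.
have mc : measurable_fun setT (cond_exp mu s) by case: cP.
have mh (h : R -> R) : measurable_fun setT h ->
    measurable_fun setT (fun z : RG => ((z.1 - h (obs s z)) ^+ 2)%:E).
  move=> mh; apply/measurable_EFinP; apply: measurable_funX; apply: measurable_funB.
    exact: measurable_fst.
  exact: measurableT_comp mh (measurable_obs s).
apply: ge0_ae_eq_integral => //.
- exact: mh.
- exact: mh.
- by move=> z _; rewrite lee_fin sqr_ge0.
- by move=> z _; rewrite lee_fin sqr_ge0.
have [N [mN N0 sub]] := cond_exp_unique cP rP; exists N; split => // z /= nz.
by apply: sub => /= zE; apply: nz => _; rewrite zE.
Qed.

(** The integrand equals (post_mean - q)^2 times [evidence], so this is E((E(X | Y_s) - q(Y_s))^2).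
    The form given has a numerator that expands in t. *)
Definition excess (t : R) (q : R -> R) : \bar R :=
  (\int[gauss]_y ((evidence1 mu t y - q y * evidence mu t y) ^+ 2 / evidence mu t y)%:E)%E.

Lemma integral_sqr_obst_split s (q : R -> R) : measurable_fun setT q ->
  (\int[prod]_z ((z.1 - q (obst (Num.sqrt s) z)) ^+ 2)%:E =
   mmse_law mu s + excess (Num.sqrt s) q)%E.
Proof.
set t := Num.sqrt s => mq; rewrite integral_sqr_obst// mmse_lawE -/t /excess.
have mZ := measurable_evidence mom t; have mN := measurable_evidence1 mom t.
have mr := measurable_post_mean mom t.
rewrite -ge0_integralD//.
- by apply: eq_integral => y _; rewrite post_risk_split// EFinD.
- by move=> y _; rewrite lee_fin post_risk_ge0.
- have i0 := @integrable_fst_X _ mu mom 0.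
  have mF : measurable_fun setT (fun z : RG => ((z.1 - post_mean mu t z.2) ^+ 2 * cmwt t z)%:E).
    apply/measurable_EFinP; apply: measurable_funM; last exact: measurable_cmwt.
    exact: measurable_sqr_sub.
  have F0 (z : RG) : (0 <= ((z.1 - post_mean mu t z.2) ^+ 2 * cmwt t z)%:E)%E.
    by rewrite lee_fin mulr_ge0 ?sqr_ge0 ?cmwt_ge0.
  apply: eq_measurable_fun (@measurable_fun_fubini_tonelli_G _ _ _ _ _ mu _ mF F0) => y _.
  by rewrite /fubini_G /= EFin_Rintegral//; exact: integrable_post_risk.
- by move=> y _; rewrite lee_fin divr_ge0 ?sqr_ge0// ltW// evidence_gt0.
- apply/measurable_EFinP.
  have -> : (fun y => (evidence1 mu t y - q y * evidence mu t y) ^+ 2 / evidence mu t y) =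
      fun y => (post_mean mu t y - q y) ^+ 2 * evidence mu t y.
    apply/funext => y; have := gt_eqF (evidence_gt0 mom t y) => Z0.
    by rewrite /post_mean; field; exact/negbT.
  apply: measurable_funM => //; apply: measurable_funX; exact: measurable_funB.
Qed.

End MmseFormula.

(** * Small-signal expansion of the mmse *)

Section LowerBound.
Context {R : realType} (mu : probability R R).
Local Notation gauss := (@gauss R).
Local Notation RG := (R * measurableTypeR R)%type.
Local Notation prod := (mu \x gauss)%E.
Hypothesis mom : forall n, mu.-integrable setT (EFin \o (fun x : R => x ^+ n)).
Local Notation moment := (moment mu).

Lemma obs_weight_le (t x n : R) : 0 <= t -> t <= 1 ->
  1 + (t * x + n) ^+ 2 <= 2 * ((1 + x ^+ 2) * (1 + n ^+ 2)).
Proof.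
move=> t0 t1; have tx : (t * x) ^+ 2 <= x ^+ 2.
  by rewrite exprMn ler_piMl ?sqr_ge0// exprn_ile1.
have := sqr_ge0 (t * x - n); have := sqr_ge0 n; have := sqr_ge0 x.
by have := mulr_ge0 (sqr_ge0 x) (sqr_ge0 n); nra.
Qed.

Lemma measurable_weight_fst p : measurable_fun setT (fun z : RG => (1 + z.1 ^+ 2) ^+ p).
Proof. exact: (measurableT_comp (@measurable_weight R p) measurable_fst). Qed.

Lemma measurable_weight_snd p : measurable_fun setT (fun z : RG => (1 + z.2 ^+ 2) ^+ p).
Proof. exact: (measurableT_comp (@measurable_weight R p) (@measurable_snd_real R)). Qed.

Lemma measurable_weight2 p : measurable_fun setT (fun z : RG => weight z.1 z.2 ^+ p).
Proof.
rewrite (_ : (fun _ => _) = fun z : RG => (1 + z.1 ^+ 2) ^+ p * (1 + z.2 ^+ 2) ^+ p).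
  by apply: measurable_funM; [exact: measurable_weight_fst|exact: measurable_weight_snd].
by apply/funext => z; rewrite /weight exprMn.
Qed.

(** Uniform in t: 1 + (t x + n)^2 <= 2 (1 + x^2) (1 + n^2), whence the doubled exponent on 1 +
    x^2. *)
Lemma integral_weight_obst p : exists2 D : R, 0 <= D & forall t, 0 < t -> t <= 1 ->
  (\int[prod]_z (weight z.1 (obst t z) ^+ p)%:E <= D%:E)%E.
Proof.
have i1 (q : nat) : mu.-integrable setT (EFin \o (fun x : R => (1 + x ^+ 2) ^+ q)).
  exact: integrable_weight mom q.
have i2 := @gauss_integrable_weight R.
pose A := \int[mu]_x ((1 + x ^+ 2) ^+ (p + p)).
pose B := \int[gauss]_y ((1 + y ^+ 2) ^+ p).
have w0 (x : R) q : 0 <= (1 + x ^+ 2) ^+ q by rewrite exprn_ge0// addr_ge0// sqr_ge0.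
have A0 : 0 <= A by apply: Rintegral_ge0 => x _; exact: w0.
have B0 : 0 <= B by apply: Rintegral_ge0 => x _; exact: w0.
exists (2 ^+ p * B * A); first by rewrite !mulr_ge0// exprn_ge0.
move=> t t0 t1.
pose F (z : RG) : R := 2 ^+ p * ((1 + z.1 ^+ 2) ^+ (p + p) * (1 + z.2 ^+ 2) ^+ p).
have mF : measurable_fun setT F.
  by do 2 apply: measurable_funM => //; [exact: measurable_weight_fst|exact: measurable_weight_snd].
have F0 z : 0 <= F z by rewrite !mulr_ge0// exprn_ge0.
apply: (@le_trans _ _ (\int[prod]_z (F z)%:E)%E).
  apply: ge0_le_integral => //.
  - by move=> z _; rewrite lee_fin exprn_ge0// weight_ge0.
  - apply/measurable_EFinP; exact: (measurableT_comp (measurable_weight2 p) (@measurable_fst_obst R t)).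
  - exact/measurable_EFinP.
  - move=> z _; rewrite lee_fin /F /weight exprD -!exprMn.
    rewrite lerXn2r ?nnegrE//.
    + by rewrite mulr_ge0// addr_ge0// sqr_ge0.
    + by rewrite !mulr_ge0// addr_ge0// sqr_ge0.
    rewrite -!mulrA mulrCA ler_wpM2l ?addr_ge0 ?sqr_ge0//.
    exact: obs_weight_le (ltW t0) t1.
rewrite fubini_tonelli1//; last exact/measurable_EFinP.
have e1 (x : R) : fubini_F gauss (EFin \o F) x = (2 ^+ p * B * (1 + x ^+ 2) ^+ (p + p))%:E.
  rewrite /fubini_F /F /=.
  have ig : gauss.-integrable setT (EFin \o (fun y : R => 2 ^+ p * (1 + x ^+ 2) ^+ (p + p) * (1 + y ^+ 2) ^+ p)).
    exact: integrable_mull.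
  transitivity ((\int[gauss]_y (2 ^+ p * (1 + x ^+ 2) ^+ (p + p) * (1 + y ^+ 2) ^+ p))%:E).
    rewrite fineK; last exact: integrable_fin_num ig.
    by apply: eq_integral => y _; rewrite mulrA.
  by rewrite RintegralZl// -/B mulrAC.
under eq_integral do rewrite e1.
rewrite EFin_Rintegral; last exact: integrable_mull.
by rewrite RintegralZl.
Qed.

Hypothesis centred : moment 1 = 0.

Lemma evidence_lb t y : 0 < t -> t <= 1 -> expR (- (moment 2 / 2)) <= evidence mu t y.
Proof.
move=> t0 t1; apply: le_trans (evidence_ge mom t y).
rewrite ler_expR centred mulr0 sub0r lerN2 -mulrA [2^-1 * _]mulrC ler_piMl//.
  by rewrite divr_ge0// Rintegral_ge0// => x _; rewrite sqr_ge0.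
by rewrite exprn_ile1// ltW.
Qed.

Lemma horner_wpoly K a t y : (wpoly K a moment).[t%:P].[y] =
  \sum_(k < K) t ^+ k * moment (k + a) * (nhermite k).[y].
Proof.
rewrite horner_poly horner_sum; apply: eq_bigr => k _.
by rewrite hornerM hornerZ -rmorphXn hornerC; ring.
Qed.

Lemma Rintegral_hermite_sum K t y q : \int[mu]_x ((x - q) * hermite_sum K (t * x) y) =
  (wpoly K 1 moment).[t%:P].[y] - q * (wpoly K 0 moment).[t%:P].[y].
Proof.
rewrite !horner_wpoly mulr_sumr -sumrB.
transitivity (\int[mu]_x (\sum_(k < K) (t ^+ k * (nhermite k).[y] * x ^+ k.+1
    - q * (t ^+ k * (nhermite k).[y]) * x ^+ k))).
  apply: eq_Rintegral => x _; rewrite /hermite_sum mulr_sumr; apply: eq_bigr => k _.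
  by rewrite exprMn exprS; ring.
rewrite Rintegral_bigsum => [|k].
  apply: eq_bigr => k _; rewrite RintegralB//; [|exact: integrable_mull..].
  by rewrite !RintegralZl// /moment addn1 addn0; ring.
by apply: integrable_sub; exact: integrable_mull.
Qed.

(** Replacing [cmw] by [hermite_sum M] splits evidence1 - q evidence into a polynomial P and a
    remainder, both O(t^M); the square gives t^(2M). The division by [evidence] is absorbed by its
    lower bound where the estimate is free of [cmw], and by Cauchy-Schwarz where it contains
    [cmw]. *)
Lemma excess_post_bound M : exists2 C : R, 0 <= C & forall t, 0 < t -> t <= 1 ->
  (excess mu t (horner (postpoly moment M).[t%:P]) <= (C * t ^+ M.*2)%:E)%E.
Proof.
pose G := postpoly moment M; pose q t y := G.[t%:P].[y].
pose P t y := (wpoly M 1 moment).[t%:P].[y] - q t y * (wpoly M 0 moment).[t%:P].[y].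
have m0 : moment 0 = 1.
  rewrite /moment; under eq_Rintegral do rewrite expr0.
  by rewrite Rintegral_cst// mul1r [X in fine X]probability_setT.
(* The coefficients of P below t^M vanish: this is [post_residual]. *)
have [A [a [A0 PA]]] : growth M (fun t _ y => P t y).
  apply: growth_le (_ : growth M (fun t _ y =>
      (wpoly M 1 moment - G * wpoly M 0 moment).[t%:P].[y])).
    by move=> t x y _ _; rewrite /P /q !(hornerD, hornerN, hornerM).
  apply: growth_horner2 => k kM; apply/eqP; rewrite coefB subr_eq0 eq_sym; apply/eqP.
  rewrite coefM coef_poly kM addn1 post_residual//; apply: eq_bigr => i _.
  have iM : (i < M)%N by rewrite (leq_trans _ kM)// ltn_ord.
  have kiM : (k - i < M)%N by rewrite (leq_ltn_trans (leq_subr _ _)).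
  by rewrite !coef_poly iM kiM addn0.
have [B1 [b1 [B10 wB]]] := @cmw_expansion R M.
have [B2 [b2 [B20 qB]]] : growth 0 (fun t x y => x - q t y).
  apply: growth_le (_ : growth 0 (fun t x y => x + (-1) * q t y)).
    by move=> t x y _ _; rewrite mulN1r.
  apply: (growthD growth_x (growthM (growth_cst (-1)) _)).
  exact: growth_horner2.
pose B := B2 * B1; pose r := (b2 + b1)%N; pose N := (maxn a r).*2.
have B0 : 0 <= B by rewrite mulr_ge0.
have [D D0 wD] := integral_weight_obst N.
pose zi := expR (moment 2 / 2).
pose J := \int[mu]_x ((1 + x ^+ 2) ^+ r).
have J0 : 0 <= J by apply: Rintegral_ge0 => x _; rewrite exprn_ge0// addr_ge0// sqr_ge0.
(* The 3 is that of (a + b + c)^2 <= 3 (a^2 + b^2 + c^2), for P and the two halves of the factor 1 +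
   [cmw] in the remainder. *)
pose c := 3 * (A ^+ 2 * zi + B ^+ 2 * J ^+ 2 * zi + B ^+ 2).
have zi0 : 0 <= zi by exact: expR_ge0.
have c0 : 0 <= c by rewrite mulr_ge0// !addr_ge0// !mulr_ge0// sqr_ge0.
pose I := \int[gauss]_y ((1 + y ^+ 2) ^+ N).
have I0 : 0 <= I by apply: Rintegral_ge0 => x _; rewrite exprn_ge0// addr_ge0// sqr_ge0.
exists (c * (I + D)); first by rewrite mulr_ge0// addr_ge0.
move=> t t0 t1; have t0' := ltW t0.
have iW n y : mu.-integrable setT (EFin \o (fun x : R => weight x y ^+ n)).
  apply: eq_integrable (integrable_mull ((1 + y ^+ 2) ^+ n) (integrable_weight mom n)) => // x _ /=.
  by rewrite /weight exprMn mulrC.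
have key y : (evidence1 mu t y - q t y * evidence mu t y) ^+ 2 / evidence mu t y <=
  c * t ^+ M.*2 * ((1 + y ^+ 2) ^+ N + \int[mu]_x (weight x y ^+ N * cmw (t * x) y)).
  have Z0 := evidence_gt0 mom t y; set Z := evidence mu t y in Z0 *.
  have Zi : Z^-1 <= zi.
    rewrite /zi -[leRHS]invrK -expRN lef_pV2 ?posrE ?expR_gt0// ?invr_gt0.
    exact: evidence_lb.
  set U := \int[mu]_x (weight x y ^+ N * cmw (t * x) y).
  set V := 1 + y ^+ 2; have V1 : 1 <= V by rewrite lerDl sqr_ge0.
  have V0 : 0 <= V by rewrite (le_trans ler01).
  have U0 : 0 <= U by apply: Rintegral_ge0 => x _; rewrite mulr_ge0 ?exprn_ge0 ?weight_ge0 ?cmw_ge0.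
  pose T x := hermite_sum M (t * x) y.
  have iT : mu.-integrable setT (EFin \o (fun x => (x - q t y) * T x)).
    apply: eq_integrable (integrable_poly mom (('X - (q t y)%:P) *
      \poly_(k < M) (t ^+ k * (nhermite k).[y]))) => // x _ /=.
    rewrite !hornerE horner_poly; congr (_ * _)%:E; apply: eq_bigr => k _.
    by rewrite exprMn; ring.
  have ixw : mu.-integrable setT (EFin \o (fun x => (x - q t y) * cmw (t * x) y)).
    apply: eq_integrable (integrable_poly_cmw mom t ('X - (q t y)%:P) y) => // x _ /=.
    by rewrite !hornerE.
  have irem : mu.-integrable setT (EFin \o (fun x => (x - q t y) * (cmw (t * x) y - T x))).
    apply: eq_integrable (integrable_sub ixw iT) => // x _ /=; by rewrite mulrBr.
  have eE : evidence1 mu t y - q t y * Z = P t y +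
      \int[mu]_x ((x - q t y) * (cmw (t * x) y - T x)).
    rewrite /P -(Rintegral_hermite_sum M t y (q t y)) -RintegralD//.
    rewrite /evidence1 /Z /evidence -RintegralZl//; last exact: integrable_cmwt.
    rewrite -RintegralB//; [|exact: integrable_id_cmwt|].
      by apply: eq_Rintegral => x _; rewrite -/(T x); ring.
    by apply: integrable_mull; exact: integrable_cmwt.
  have Pb : `|P t y| <= t ^+ M * (A * V ^+ a).
    (* P is independent of x, so x = 0 gives the weight 1 + y^2. *)
    have := PA t 0 y t0 t1.
    by rewrite /weight expr0n/= addr0 mul1r -/V mulrAC mulrC.
  have iH := iW r y; have iHw := integrable_mul_cmw t y iH.
  set H := \int[mu]_x (weight x y ^+ r * cmw (t * x) y).
  have H0 : 0 <= H by apply: Rintegral_ge0 => x _; rewrite mulr_ge0 ?exprn_ge0 ?weight_ge0 ?cmw_ge0.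
  have HE : \int[mu]_x (weight x y ^+ r) = J * V ^+ r.
    rewrite /J -RintegralZr//; last exact: integrable_weight mom r.
    by apply: eq_Rintegral => x _; rewrite /weight exprMn.
  have remb : `|\int[mu]_x ((x - q t y) * (cmw (t * x) y - T x))| <=
      t ^+ M * (B * (J * V ^+ r + H)).
    apply: (le_trans (le_normr_Rintegral _ irem)) => //.
    apply: (@le_trans _ _ (\int[mu]_x (t ^+ M * B * (weight x y ^+ r + weight x y ^+ r * cmw (t * x) y)))).
      apply: le_Rintegral => //; first exact: integrable_norm.
        by apply: integrable_mull; exact: integrable_add.
      move=> x _; rewrite normrM; have h1 := qB t x y t0 t1; have h2 := wB t x y t0 t1.
      apply: (le_trans (ler_pM _ _ h1 h2)) => //.
      by rewrite le_eqVlt; apply/orP; left; apply/eqP; rewrite /B /r expr0 exprD; ring.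
    rewrite RintegralZl//; last exact: integrable_add.
    by rewrite RintegralD// HE -/H -mulrA.
  have HU : H ^+ 2 / Z <= U.
    apply: (le_trans (sqr_Rintegral_cmw_le mom t y iH _)).
      by apply: eq_integrable (iW (r * 2)%N y) => // x _; rewrite /= exprM.
    apply: le_Rintegral => //.
    - apply: integrable_mul_cmw => //.
      by apply: eq_integrable (iW (r * 2)%N y) => // x _; rewrite /= exprM.
    - exact: integrable_mul_cmw.
    move=> x _; rewrite ler_wpM2r ?cmw_ge0// -exprM ler_weXn2l ?weight_ge1//.
    by rewrite /N muln2 leq_double leq_maxr.
  have VaN : (V ^+ a) ^+ 2 <= V ^+ N.
    by rewrite -exprM ler_weXn2l// /N muln2 leq_double leq_maxl.
  have VrN : (V ^+ r) ^+ 2 <= V ^+ N.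
    by rewrite -exprM ler_weXn2l// /N muln2 leq_double leq_maxr.
  have VN0 : 0 <= V ^+ N by rewrite exprn_ge0.
  pose p1 := A * V ^+ a; pose p2 := B * J * V ^+ r; pose p3 := B * H.
  have eb : `|evidence1 mu t y - q t y * Z| <= t ^+ M * (p1 + p2 + p3).
    rewrite eE (le_trans (ler_normD _ _))// -addrA [leRHS]mulrDr lerD//.
    by rewrite (le_trans remb)// /p2 /p3 -[B * J * _]mulrA -mulrDr.
  have e2 : (evidence1 mu t y - q t y * Z) ^+ 2 <= t ^+ M.*2 * (3 * (p1 ^+ 2 + p2 ^+ 2 + p3 ^+ 2)).
    rewrite -real_normK ?num_real//.
    apply: (@le_trans _ _ ((t ^+ M * (p1 + p2 + p3)) ^+ 2)).
      by rewrite lerXn2r ?nnegrE// (le_trans _ eb).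
    rewrite exprMn -exprM muln2 ler_wpM2l ?exprn_ge0//.
    have := sqr_ge0 (p1 - p2); have := sqr_ge0 (p1 - p3); have := sqr_ge0 (p2 - p3); nra.
  apply: (@le_trans _ _ (t ^+ M.*2 * (3 * (p1 ^+ 2 + p2 ^+ 2 + p3 ^+ 2)) / Z)).
    by rewrite ler_wpM2r// invr_ge0 ltW.
  have Zi0 : 0 <= Z^-1 by rewrite invr_ge0 ltW.
  have q1 : p1 ^+ 2 / Z <= A ^+ 2 * zi * V ^+ N.
    rewrite (_ : p1 ^+ 2 / Z = A ^+ 2 * ((V ^+ a) ^+ 2 / Z)); last by rewrite /p1; ring.
    rewrite -mulrA [zi * _]mulrC ler_wpM2l ?sqr_ge0//.
    by apply: ler_pM => //; exact: sqr_ge0.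
  have q2 : p2 ^+ 2 / Z <= B ^+ 2 * J ^+ 2 * zi * V ^+ N.
    rewrite (_ : p2 ^+ 2 / Z = B ^+ 2 * J ^+ 2 * ((V ^+ r) ^+ 2 / Z)); last by rewrite /p2; ring.
    rewrite -[leRHS]mulrA [zi * _]mulrC ler_wpM2l ?mulr_ge0 ?sqr_ge0//.
    by apply: ler_pM => //; exact: sqr_ge0.
  have q3 : p3 ^+ 2 / Z <= B ^+ 2 * U by rewrite /p3 exprMn -mulrA ler_wpM2l ?sqr_ge0.
  rewrite -mulrA [c * _]mulrC -[leRHS]mulrA ler_wpM2l ?exprn_ge0//.
  rewrite /c -[leLHS]mulrA -[leRHS]mulrA ler_wpM2l//.
  rewrite 2!mulrDl; apply: (le_trans (lerD (lerD q1 q2) q3)).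
  have h1 : 0 <= A ^+ 2 * zi by rewrite mulr_ge0 ?sqr_ge0.
  have h2 : 0 <= B ^+ 2 * J ^+ 2 * zi by rewrite !mulr_ge0 ?sqr_ge0.
  have h3 : 0 <= B ^+ 2 by rewrite sqr_ge0.
  have := mulr_ge0 h1 U0; have := mulr_ge0 h2 U0; have := mulr_ge0 h3 VN0.
  by rewrite !mulrDl !mulrDr; lra.
have mq : measurable_fun setT (q t) by exact: measurable_poly.
have mZ := measurable_evidence mom t; have mN := measurable_evidence1 mom t.
rewrite /excess; pose K := c * t ^+ M.*2.
have K0 : 0 <= K by rewrite mulr_ge0// exprn_ge0.
pose U y := \int[mu]_x (weight x y ^+ N * cmw (t * x) y).
have U0 y : 0 <= U y by apply: Rintegral_ge0 => x _; rewrite mulr_ge0 ?exprn_ge0 ?weight_ge0 ?cmw_ge0.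
have V0 (y : R) : 0 <= (1 + y ^+ 2) ^+ N by rewrite exprn_ge0// addr_ge0// sqr_ge0.
pose F (z : RG) := ((weight z.1 z.2 ^+ N)%:E * (cmwt t z)%:E)%E.
have mF : measurable_fun setT F.
  apply: emeasurable_funM; first by apply/measurable_EFinP; exact: measurable_weight2.
  by apply/measurable_EFinP; exact: measurable_cmwt.
have F0 z : (0 <= F z)%E by rewrite mule_ge0// lee_fin ?cmwt_ge0// exprn_ge0// weight_ge0.
have UE y : fubini_G mu F y = (U y)%:E.
  rewrite /fubini_G /F /U -EFin_Rintegral//.
  exact: (integrable_mul_cmw t y (iW N y)).
have mU : measurable_fun setT U.
  apply/measurable_EFinP; apply: eq_measurable_fun (measurable_fun_fubini_tonelli_G F mF F0) => y _.
  exact: UE.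
have mV : measurable_fun setT (fun y : R => (1 + y ^+ 2) ^+ N) by exact: measurable_weight.
have mVE : measurable_fun setT (fun y : R => ((1 + y ^+ 2) ^+ N)%:E) by exact/measurable_EFinP.
have mUE : measurable_fun setT (fun y : R => (U y)%:E) by exact/measurable_EFinP.
have mVU : measurable_fun setT (fun y : R => ((1 + y ^+ 2) ^+ N)%:E + (U y)%:E)%E.
  exact: emeasurable_funD.
apply: (@le_trans _ _ (\int[gauss]_y (K%:E * (((1 + y ^+ 2) ^+ N)%:E + (U y)%:E)))%E).
  apply: ge0_le_integral => //.
  - by move=> y _; rewrite lee_fin divr_ge0 ?sqr_ge0// ltW// evidence_gt0.
  - apply/measurable_EFinP.
    have -> : (fun y => (evidence1 mu t y - q t y * evidence mu t y) ^+ 2 / evidence mu t y) =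
      fun y => (post_mean mu t y - q t y) ^+ 2 * evidence mu t y.
      apply/funext => y; have := gt_eqF (evidence_gt0 mom t y) => Z0.
      by rewrite /post_mean; field; exact/negbT.
    have mr := measurable_post_mean mom t.
    by apply: measurable_funM => //; apply: measurable_funX; exact: measurable_funB.
  - exact: emeasurable_funM.
  - by move=> y _; rewrite -EFinD -EFinM lee_fin; exact: key.
rewrite ge0_integralZl//; last first.
- by move=> y _; rewrite -EFinD lee_fin addr_ge0.
rewrite ge0_integralD//; [|by move=> y _; rewrite lee_fin..].
(* Undoing the change of measure turns this into an expectation at the observation, which D bounds
   uniformly in t. *)
have -> : (\int[gauss]_y (U y)%:E = \int[prod]_z (weight z.1 (obst t z) ^+ N)%:E)%E.
  under eq_integral do rewrite -UE.
  rewrite -fubini_tonelli2// -(@ge0_integral_obst R mu t (fun z => (weight z.1 z.2 ^+ N)%:E))//.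
    by apply/measurable_EFinP; exact: measurable_weight2.
  by move=> z; rewrite lee_fin exprn_ge0// weight_ge0.
have -> : (\int[gauss]_y ((1 + y ^+ 2) ^+ N)%:E = I%:E)%E.
  by rewrite fineK//; exact: integrable_fin_num (gauss_integrable_weight N).
apply: (@le_trans _ _ (K%:E * (I%:E + D%:E))%E).
  by rewrite lee_wpmul2l// leeD2l// wD.
by rewrite -EFinD -EFinM lee_fin /K mulrAC.
Qed.

End LowerBound.

(** * Exact risk of polynomial estimators *)

Section QuadraticRisk.
Context {R : realType} (mu : probability R R).
Local Notation gauss := (@gauss R).
Local Notation RG := (R * measurableTypeR R)%type.
Local Notation prod := (mu \x gauss)%E.
Hypothesis mom : forall n, mu.-integrable setT (EFin \o (fun x : R => x ^+ n)).
Local Notation moment := (moment mu).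

Lemma horner_mpol B a mu' (Q : {poly {poly R}}) t :
  (mpol B a mu' Q).[t] = \sum_(k < B) t ^+ k * mu' (k + a)%N * hcoef k Q.[t%:P].
Proof.
rewrite /mpol.
have -> : (map_poly (@gauss_fun R) (Q * wpoly B a mu')).[t] =
    gauss_fun (Q.[t%:P] * (wpoly B a mu').[t%:P]).
  rewrite -hornerM /map_poly horner_poly horner_coef linear_sum; apply: eq_bigr => i _.
  by rewrite /= -rmorphXn mulrC -[_ * (t ^+ i)%:P]mulrC mul_polyC linearZ.
rewrite horner_poly mulr_sumr linear_sum; apply: eq_bigr => k _.
by rewrite -rmorphXn /= mulrA mulrC mul_polyC -scalerAr !linearZ/= gauss_fun_mul_nhermite mulrA.
Qed.

Lemma prod_integrableM (f g : R -> R) : mu.-integrable setT (EFin \o f) ->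
  gauss.-integrable setT (EFin \o g) ->
  prod.-integrable setT (fun z : RG => (f z.1 * g z.2)%:E).
Proof.
move=> fi gi.
have mf : measurable_fun setT f by apply/measurable_EFinP; exact: measurable_int fi.
have mg : measurable_fun setT g by apply/measurable_EFinP; exact: measurable_int gi.
apply/integrable12ltyP.
  apply/measurable_EFinP; apply: measurable_funM.
    exact: measurableT_comp mf measurable_fst.
  exact: measurableT_comp mg (@measurable_snd_real R).
have e x : (\int[gauss]_y `|(f x * g y)%:E| = (`|f x| * \int[gauss]_y `|g y|)%:E)%E.
  rewrite -RintegralZl//; last exact: integrable_norm.
  rewrite fineK; last exact: integrable_fin_num (integrable_mull _ (integrable_norm gi)).
  by apply: eq_integral => y _; rewrite -normrM.
under eq_integral do rewrite e.
under eq_integral do rewrite mulrC.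
exact: (integrable_lty measurableT (integrable_mull _ (integrable_norm fi))).
Qed.

Lemma prod_RintegralM (f g : R -> R) : mu.-integrable setT (EFin \o f) ->
  gauss.-integrable setT (EFin \o g) ->
  \int[prod]_z (f z.1 * g z.2) = \int[mu]_x f x * \int[gauss]_y g y.
Proof.
move=> fi gi; rewrite {1}/Rintegral -(integral12_prod_meas1 (prod_integrableM fi gi)).
have e x : (\int[gauss]_y (f x * g y)%:E = (\int[gauss]_y g y * f x)%:E)%E.
  rewrite mulrC -RintegralZl// fineK//; exact: integrable_fin_num (integrable_mull _ gi).
rewrite /fubini_F; under eq_integral do rewrite e.
by rewrite -/(Rintegral _ _ _) RintegralZl// mulrC.
Qed.

Variable t : R.

Lemma monomial_obst_expand a (p : {poly R}) x y :
  x ^+ a * p.[t * x + y] =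
  \sum_(k < size p) t ^+ k * (x ^+ (k + a) * (p^`N(k)).[y]).
Proof.
rewrite addrC nderiv_taylor ?mulr_sumr; last exact: mulrC.
by apply: eq_bigr => k _; rewrite exprMn exprD; ring.
Qed.

Lemma integrable_monomial_obst a (p : {poly R}) :
  prod.-integrable setT (EFin \o (fun z : RG => z.1 ^+ a * p.[obst t z])).
Proof.
apply: (@eq_integrable _ _ _ _ _ measurableT (EFin \o (fun z : RG =>
    \sum_(k < size p) t ^+ k * (z.1 ^+ (k + a) * (p^`N(k)).[z.2])))).
  by move=> z _ /=; rewrite /obst monomial_obst_expand.
apply: integrable_bigsum => k; apply: (integrable_mull (t ^+ k)).
exact: (prod_integrableM (mom (k + a)) (integrable_horner (@gauss_integrable R) p^`N(k))).
Qed.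

Lemma Rintegral_monomial_obst a (p : {poly R}) B : (size p <= B)%N ->
  \int[prod]_z (z.1 ^+ a * p.[obst t z]) = \sum_(k < B) t ^+ k * moment (k + a) * hcoef k p.
Proof.
move=> pB; under eq_Rintegral do rewrite /obst monomial_obst_expand.
rewrite Rintegral_bigsum => [|k]; last first.
  apply: (integrable_mull (t ^+ k)).
  exact: (prod_integrableM (mom (k + a)) (integrable_horner (@gauss_integrable R) p^`N(k))).
rewrite (big_ord_widen B (fun k => \int[prod]_x0 (t ^+ k * (x0.1 ^+ (k + a) * p^`N(k).[x0.2])))) //.
rewrite big_mkcond; apply: eq_bigr => k _; case: ltnP => pk; last first.
  by rewrite hcoef_small ?mulr0.
have ig := integrable_horner (@gauss_integrable R) p^`N(k).
rewrite RintegralZl//; last exact: (prod_integrableM (mom (k + a)) ig).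
by rewrite (prod_RintegralM (mom _) ig) hcoefE -Rintegral_gauss_horner mulrA.
Qed.

(** An equality for this t, without remainder: [hcoef k] vanishes beyond the degree in y, so
    truncating [wpoly] at B loses nothing. *)
Lemma integral_risk B (Q : {poly {poly R}}) : (size Q.[t%:P] <= B)%N ->
  (size (Q ^+ 2).[t%:P] <= B)%N ->
  (\int[prod]_z ((z.1 - Q.[t%:P].[obst t z]) ^+ 2)%:E = ((risk B moment Q).[t])%:E)%E.
Proof.
move=> QB Q2B; set p := Q.[t%:P].
have i2 : prod.-integrable setT (EFin \o (fun z : RG => z.1 ^+ 2)) by exact: integrable_fst_X.
have i1 := integrable_monomial_obst 1 p.
have i0 : prod.-integrable setT (EFin \o (fun z : RG => (p ^+ 2).[obst t z])).
  apply: eq_integrable (integrable_monomial_obst 0 (p ^+ 2)) => // z _ /=.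
  by rewrite expr0 mul1r.
have i1' := integrable_mull 2 i1.
have i21 := integrable_sub i2 i1'.
transitivity ((\int[prod]_z (z.1 ^+ 2 - 2 * (z.1 ^+ 1 * p.[obst t z]) + (p ^+ 2).[obst t z]))%:E).
  rewrite fineK; last exact: integrable_fin_num (integrable_add i21 i0).
  by apply: eq_integral => z _; rewrite horner_exp; congr EFin; ring.
rewrite RintegralD// RintegralB// RintegralZl// (Rintegral_monomial_obst 1 QB).
have -> : \int[prod]_z (p ^+ 2).[obst t z] = \sum_(k < B) t ^+ k * moment (k + 0) * hcoef k (p ^+ 2).
  rewrite -(Rintegral_monomial_obst 0 (_ : size (p ^+ 2) <= B)%N); last by rewrite -horner_exp.
  by apply: eq_Rintegral => z _; rewrite expr0 mul1r.
have -> : \int[prod]_z (z.1 ^+ 2) = moment 2.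
  have ig : gauss.-integrable setT (EFin \o (fun y : R => y ^+ 0)) by exact: gauss_integrable.
  have := prod_RintegralM (mom 2) ig; rewrite -/(gmom 0) gmomE gauss_moment0 mulr1 => E.
  by apply: etrans E; apply: eq_Rintegral => z _; rewrite expr0 mulr1.
rewrite /risk !hornerD hornerN hornerC hornerZ !horner_mpol//.
by rewrite horner_exp.
Qed.

End QuadraticRisk.

(** * Cumulants and the characteristic function *)

Section Smooth.
Context {R : realType}.
Implicit Types (f g : R -> R) (U : set R).

Lemma eq_derive1 U f g t : open U -> U t -> {in U, f =1 g} -> (derive1 f) t = (derive1 g) t.
Proof.
move=> oU Ut fg; rewrite !derive1E; apply: near_eq_derive.
by near=> x; apply: fg; rewrite inE; near: x; exact: open_nbhs_nbhs.
Unshelve. all: by end_near. Qed.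

Lemma eq_derivable U f g t : open U -> U t -> {in U, f =1 g} -> derivable f t 1 -> derivable g t 1.
Proof.
move=> oU Ut fg; apply: near_eq_derivable.
by near=> x; apply: fg; rewrite inE; near: x; exact: open_nbhs_nbhs.
Unshelve. all: by end_near. Qed.

(** Differentiability n times on U; the set is kept because the logarithm of the characteristic
    function is controlled only where that function is nonzero. *)
Fixpoint smooth U n f : Prop :=
  if n is n'.+1 then (forall t, U t -> derivable f t 1) /\ smooth U n' (derive1 f) else True.

Variable U : set R.
Hypothesis oU : open U.

Lemma eq_smooth n f g : {in U, f =1 g} -> smooth U n f -> smooth U n g.
Proof.
elim: n f g => // n IHn f g fg [df sf]; split.
  by move=> t Ut; apply: eq_derivable fg (df t Ut).
apply: IHn sf => t; rewrite inE => Ut; exact: eq_derive1 fg.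
Qed.

Lemma eq_derive1n n f g t : U t -> {in U, f =1 g} -> derive1n (n) f t = derive1n (n) g t.
Proof.
elim: n f g t => [|n IHn] f g t Ut fg; first by rewrite !derive1n0 fg// inE.
rewrite !derive1Sn; apply: IHn => // x; rewrite inE => Ux; exact: eq_derive1 fg.
Qed.

Lemma smoothW n f : smooth U n.+1 f -> smooth U n f.
Proof.
elim: n f => // n IHn f [df sf]; split => //; exact: IHn.
Qed.

Lemma derive1D f g t : derivable f t 1 -> derivable g t 1 ->
  derive1 (fun x => f x + g x) t = (derive1 f) t + (derive1 g) t.
Proof. by move=> df dg; rewrite !derive1E; exact: (deriveD df dg). Qed.

Lemma derive1M f g t : derivable f t 1 -> derivable g t 1 ->
  derive1 (fun x => f x * g x) t = (derive1 f) t * g t + f t * (derive1 g) t.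
Proof.
move=> df dg; rewrite !derive1E; apply: (etrans (deriveM df dg)).
by rewrite addrC; congr (_ + _); exact: mulrC.
Qed.

Lemma smoothD n f g : smooth U n f -> smooth U n g -> smooth U n (fun x => f x + g x).
Proof.
elim: n f g => // n IHn f g [df sf] [dg sg]; split.
  by move=> t Ut; apply: derivableD; [exact: df|exact: dg].
apply: eq_smooth (IHn _ _ sf sg) => t; rewrite inE => Ut.
by rewrite derive1D//; [exact: df|exact: dg].
Qed.

Lemma smoothM n f g : smooth U n f -> smooth U n g -> smooth U n (fun x => f x * g x).
Proof.
elim: n f g => // n IHn f g sf sg; have [df sf'] := sf; have [dg sg'] := sg; split.
  by move=> t Ut; apply: derivableM; [exact: df|exact: dg].
apply: (@eq_smooth _ (fun x => (derive1 f) x * g x + f x * (derive1 g) x)).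
  by move=> t; rewrite inE => Ut; rewrite derive1M//; [exact: df|exact: dg].
by apply: smoothD; apply: IHn => //; exact: smoothW.
Qed.

Lemma smoothN n f : smooth U n f -> smooth U n (fun x => - f x).
Proof.
elim: n f => // n IHn f [df sf]; split.
  by move=> t Ut; apply: derivableN; exact: df.
apply: (@eq_smooth _ (fun x => - (derive1 f) x)); last exact: IHn.
by move=> t; rewrite inE => Ut; rewrite !derive1E deriveN//; exact: df.
Qed.

Lemma smoothV n f : (forall t, U t -> f t != 0) -> smooth U n f -> smooth U n (fun x => (f x)^-1).
Proof.
move=> f0; elim: n => // n IHn sf; have [df sf'] := sf; split.
  by move=> t Ut; apply: derivableV; [exact: f0|exact: df].
apply: (@eq_smooth _ (fun x => - (derive1 f) x * ((f x)^-1 * (f x)^-1))).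
  move=> t; rewrite inE => Ut; rewrite !derive1E deriveV//; [|exact: f0|exact: df].
  by rewrite expr2 invfM scaleNr mulNr; congr (- _); exact: mulrC.
apply: smoothM; first exact: smoothN.
by apply: smoothM; apply: IHn; exact: smoothW.
Qed.

Lemma derive1nD n f g t : U t -> smooth U n f -> smooth U n g ->
  derive1n n (fun x => f x + g x) t = derive1n n f t + derive1n n g t.
Proof.
elim: n f g t => [//|n IHn] f g t Ut [df sf] [dg sg].
rewrite !derive1Sn (@eq_derive1n n _ (fun x => derive1 f x + derive1 g x) t Ut); first exact: IHn.
by move=> x; rewrite inE => Ux; rewrite derive1D//; [exact: df|exact: dg].
Qed.

Lemma derive1nN n f t : U t -> smooth U n f ->
  derive1n n (fun x => - f x) t = - derive1n n f t.
Proof.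
elim: n f t => [//|n IHn] f t Ut [df sf].
rewrite !derive1Sn (@eq_derive1n n _ (fun x => - derive1 f x) t Ut); first exact: IHn.
by move=> x; rewrite inE => Ux; rewrite !derive1E deriveN//; exact: df.
Qed.

Lemma derive1n_mul n f g t : U t -> smooth U n f -> smooth U n g ->
  derive1n n (fun x => f x * g x) t = \sum_(k < n.+1) 'C(n, k)%:R * derive1n (k) f t * derive1n (n - k) g t.
Proof.
elim: n f g t => [|n IHn] f g t Ut sf sg.
  by rewrite big_ord1 !derive1n0 mul1r.
have [df sf'] := sf; have [dg sg'] := sg.
rewrite derive1Sn (@eq_derive1n n _ (fun x => derive1 f x * g x + f x * derive1 g x) t Ut).
  rewrite derive1nD//; [|by apply: smoothM => //; exact: smoothW..].
  rewrite !IHn//; [|exact: smoothW..].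
  pose h k := 'C(n, k)%:R * derive1n k f t * derive1n (n.+1 - k) g t.
  have -> : \sum_(k < n.+1) 'C(n, k)%:R * derive1n k f t * derive1n (n - k) (derive1 g) t =
      \sum_(k < n.+2) h k.
    rewrite [RHS]big_ord_recr /= /h bin_small// !mul0r addr0; apply: eq_bigr => k _.
    by rewrite -derive1Sn subSn// -ltnS.
  rewrite [X in _ + X]big_ord_recl [RHS]big_ord_recl /= addrCA {1}/h !bin0; congr (_ + _).
  rewrite -big_split; apply: eq_bigr => k _ /=.
  by rewrite /bump /= add1n subSS /h binS natrD !mulrDl subSS addrC -derive1Sn.
by move=> x; rewrite inE => Ux; rewrite derive1M//; [exact: df|exact: dg].
Qed.

End Smooth.

Section PowersOfI.
Context {R : pzRingType}.

(** Real and imaginary parts of i^n. *)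
Fixpoint ipow n : R * R :=
  if n is n'.+1 then let: (a, b) := ipow n' in (- b, a) else (1, 0).
Definition reI n : R := (ipow n).1.
Definition imI n : R := (ipow n).2.

Lemma reIS n : reI n.+1 = - imI n. Proof. by rewrite /reI /imI /=; case: (ipow n). Qed.
Lemma imIS n : imI n.+1 = reI n. Proof. by rewrite /reI /imI /=; case: (ipow n). Qed.

Lemma ipowD j k : reI (j + k) = reI j * reI k - imI j * imI k /\
  imI (j + k) = reI j * imI k + imI j * reI k.
Proof.
elim: j => [|j [IH1 IH2]]; first by rewrite /reI /imI /= !mul1r !mul0r subr0 addr0.
rewrite addSn !reIS !imIS IH1 IH2; split; last by rewrite mulNr addrC.
by rewrite opprD addrC mulNr.
Qed.

Lemma reI_double n : reI n.*2 = (-1) ^+ n.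
Proof. by elim: n => // n IHn; rewrite doubleS reIS imIS IHn exprS mulN1r. Qed.

End PowersOfI.

Section CharDerivatives.
Context d (T : measurableType d) (R : realType) (P : probability T R) (X : {RV P >-> R}).
Hypothesis mom : has_all_moments X.
Implicit Types (a b t : R) (k n : nat).

(** A family closed under differentiation in t: (a, b, k) becomes (b, -a, k+1), with |X|^(k+1) as
    dominating function. *)
Definition trig_moment a b k t : R :=
  \int[P]_x (X x ^+ k * (a * cos (t * X x) + b * sin (t * X x))).

Let mX : measurable_fun setT X. Proof. exact: measurable_funP. Qed.

Lemma measurable_trig a b k t :
  measurable_fun setT (fun x => X x ^+ k * (a * cos (t * X x) + b * sin (t * X x))).
Proof.
have mtX : measurable_fun setT (fun x => t * X x) by exact: measurable_funM.
apply: measurable_funM; first exact: measurable_funX.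
apply: measurable_funD; apply: measurable_funM => //.
- by apply: measurableT_comp mtX; apply: continuous_measurable_fun; exact: continuous_cos.
- by apply: measurableT_comp mtX; apply: continuous_measurable_fun; exact: continuous_sin.
Qed.

Lemma trig_bound a b k t (x : T) :
  `|X x ^+ k * (a * cos (t * X x) + b * sin (t * X x))| <= (`|a| + `|b|) * `|X x ^+ k|.
Proof.
rewrite normrM mulrC ler_wpM2r// (le_trans (ler_normD _ _))// !normrM lerD//.
- by rewrite ler_piMr// ler_norml cos_geN1 cos_le1.
- by rewrite ler_piMr// ler_norml sin_geN1 sin_le1.
Qed.

Lemma integrable_normX a b k :
  P.-integrable setT (EFin \o (fun x => (`|a| + `|b|) * `|X x ^+ k|)).
Proof. by apply: integrable_mull; exact: (integrable_norm (mom k)). Qed.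

Lemma integrable_trig a b k t :
  P.-integrable setT (EFin \o (fun x => X x ^+ k * (a * cos (t * X x) + b * sin (t * X x)))).
Proof.
apply: integrable_dom (integrable_normX a b k) _; first exact: measurable_trig.
by move=> x; exact: trig_bound.
Qed.

Lemma is_derive_trig a b k t x : is_derive t 1
  (fun t => X x ^+ k * (a * cos (t * X x) + b * sin (t * X x)))
  (X x ^+ k.+1 * (b * cos (t * X x) + (- a) * sin (t * X x))).
Proof.
have h : is_derive t 1 (fun t => t * X x) (X x).
  apply: is_derive_eq; by rewrite /GRing.scale /= !(mulr0, mulr1, add0r, addr0).
have c := @is_derive1_comp R cos (fun t => t * X x) t _ _ (is_derive_cos _) h.
have s := @is_derive1_comp R sin (fun t => t * X x) t _ _ (is_derive_sin _) h.
have := is_deriveZ (X x ^+ k) (is_deriveD (is_deriveZ a c) (is_deriveZ b s)).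
move=> /is_derive_eq; apply.
by rewrite /GRing.scale /= exprS; ring.
Qed.

Lemma is_derive_trig_moment a b k t :
  is_derive t 1 (trig_moment a b k) (trig_moment b (- a) k.+1 t).
Proof.
have I_t : `]t - 1, t + 1[%classic t by rewrite /= in_itv/= ltrBlDr ltrDl ltr01.
pose f s x := X x ^+ k * (a * cos (s * X x) + b * sin (s * X x)).
have fi s : `]t - 1, t + 1[%classic s -> P.-integrable setT (EFin \o f s).
  by move=> _; exact: integrable_trig.
have df s x : `]t - 1, t + 1[%classic s -> setT x -> derivable (f ^~ x) s 1.
  by move=> _ _; have [] := is_derive_trig a b k s x.
have dfE s x : partial1of2 f s x = X x ^+ k.+1 * (b * cos (s * X x) + (- a) * sin (s * X x)).
  by rewrite partial1of2E; have [] := is_derive_trig a b k s x.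
have Gub s x : `]t - 1, t + 1[%classic s -> setT x ->
    `|partial1of2 f s x| <= (`|b| + `|- a|) * `|X x ^+ k.+1|.
  by move=> _ _; rewrite dfE; exact: trig_bound.
have G0 x : 0 <= (`|b| + `|- a|) * `|X x ^+ k.+1| by rewrite mulr_ge0.
have iG := integrable_normX b (- a) k.+1.
apply: DeriveDef.
  exact: (derivable_under_integral measurableT I_t fi df G0 iG Gub).
rewrite -derive1E.
rewrite (differentiation_under_integral measurableT I_t fi df G0 iG Gub).
by apply: eq_Rintegral => x _; exact: dfE.
Qed.

Lemma derive1_trig_moment a b k : derive1 (trig_moment a b k) = trig_moment b (- a) k.+1.
Proof.
by apply/funext => t; rewrite derive1E; have [] := is_derive_trig_moment a b k t.
Qed.

Lemma smooth_trig_moment U n a b k : smooth U n (trig_moment a b k).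
Proof.
elim: n a b k => // n IHn a b k; split; last by rewrite derive1_trig_moment.
by move=> t _; have [] := is_derive_trig_moment a b k t.
Qed.

Lemma trig_moment_at0 a b k : trig_moment a b k 0 = a * \int[P]_x (X x ^+ k).
Proof.
rewrite /trig_moment -RintegralZl//; last exact: mom.
by apply: eq_Rintegral => x _; rewrite mul0r cos0 sin0 mulr1 mulr0 addr0 mulrC.
Qed.

Lemma char_reE : char_re X = trig_moment 1 0 0.
Proof.
apply/funext => t; rewrite /char_re /trig_moment unlock; congr fine.
by apply: eq_integral => x _; rewrite expr0 !mul1r mul0r addr0.
Qed.

Lemma char_imE : char_im X = trig_moment 0 1 0.
Proof.
apply/funext => t; rewrite /char_im /trig_moment unlock; congr fine.
by apply: eq_integral => x _; rewrite expr0 !mul1r mul0r add0r.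
Qed.

Lemma derive1n_char_re n : derive1n n (char_re X) = trig_moment (reI n) (- imI n) n.
Proof.
rewrite char_reE; elim: n => [|n IHn]; first by rewrite derive1n0 /reI /imI /= oppr0.
by rewrite derive1nS IHn derive1_trig_moment reIS imIS.
Qed.

Lemma derive1n_char_im n : derive1n n (char_im X) = trig_moment (imI n) (reI n) n.
Proof.
rewrite char_imE; elim: n => [|n IHn]; first by rewrite derive1n0 /reI /imI.
by rewrite derive1nS IHn derive1_trig_moment reIS imIS.
Qed.

End CharDerivatives.

Section LogCharDerivatives.
Context d (T : measurableType d) (R : realType) (P : probability T R) (X : {RV P >-> R}).
Hypothesis mom : has_all_moments X.

Let C := char_re X.
Let S := char_im X.
Let m n := \int[P]_x (X x ^+ n).
(** Q is the squared modulus of phi, U the set where phi is nonzero, and Lr, Li are the real and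
    imaginary parts of phi'/phi. *)
Let Q t := C t * C t + S t * S t.
Let U := [set t | 0 < Q t].
Let Lr t := (C t * derive1 C t + S t * derive1 S t) * (Q t)^-1.
Let Li t := (C t * derive1 S t - S t * derive1 C t) * (Q t)^-1.

Let C_at0 n : derive1n n C 0 = reI n * m n.
Proof. by rewrite derive1n_char_re// trig_moment_at0. Qed.

Let S_at0 n : derive1n n S 0 = imI n * m n.
Proof. by rewrite derive1n_char_im// trig_moment_at0. Qed.

Let m0 : m 0 = 1.
Proof.
have -> : m 0 = \int[P]_x cst 1 x by apply: eq_Rintegral => x _; rewrite expr0.
by rewrite Rintegral_cst// mul1r [X in fine X](@probability_setT _ _ _ P).
Qed.

Let U0 : U 0.
Proof.
have := C_at0 0; have := S_at0 0; rewrite !derive1n0 /reI /imI /= mul0r mul1r m0.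
by rewrite /U/= /Q => -> ->; rewrite mulr0 mulr1 addr0 ltr01.
Qed.

Let sC V n : smooth V n C.
Proof. by rewrite /C char_reE//; exact: smooth_trig_moment. Qed.

Let sS V n : smooth V n S.
Proof. by rewrite /S char_imE//; exact: smooth_trig_moment. Qed.

Let dC t : derivable C t 1. Proof. by have [+ _] := sC setT 1; apply. Qed.
Let dS t : derivable S t 1. Proof. by have [+ _] := sS setT 1; apply. Qed.

Let oU : open U.
Proof.
apply: (@open_comp _ _ Q [set x | 0 < x]); last exact: open_gt.
move=> t _; apply: differentiable_continuous; apply/derivable1_diffP.
by apply: derivableD; apply: derivableM.
Qed.

Let sC' n : smooth U n (derive1 C). Proof. by have [] := sC U n.+1. Qed.
Let sS' n : smooth U n (derive1 S). Proof. by have [] := sS U n.+1. Qed.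

Let sQ n : smooth U n (fun t => (Q t)^-1).
Proof.
apply: (smoothV oU); first by move=> t /= /lt0r_neq0.
by apply: (smoothD oU); apply: (smoothM oU); auto.
Qed.

Let sLr n : smooth U n Lr.
Proof. by apply: (smoothM oU) => //; apply: (smoothD oU); apply: (smoothM oU). Qed.

Let sLi n : smooth U n Li.
Proof.
apply: (smoothM oU) => //; apply: (smoothD oU); first exact: (smoothM oU).
by apply: (smoothN oU); exact: (smoothM oU).
Qed.

Let C'E : {in U, derive1 C =1 fun t => Lr t * C t + - (Li t * S t)}.
Proof.
move=> t; rewrite inE => /= Ut; have q0 := lt0r_neq0 Ut.
by rewrite /Lr /Li; move: q0; rewrite /Q => q0; field.
Qed.

Let S'E : {in U, derive1 S =1 fun t => Lr t * S t + Li t * C t}.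
Proof.
move=> t; rewrite inE => /= Ut; have q0 := lt0r_neq0 Ut.
by rewrite /Lr /Li; move: q0; rewrite /Q => q0; field.
Qed.

(* [phi' = (Lr + i Li) phi] near [0]: by Leibniz' rule its derivatives at [0] are
   the recursion between moments and cumulants. *)
Lemma log_char_derivs n :
  derive1n n Lr 0 = reI n.+1 * cumul m n /\ derive1n n Li 0 = imI n.+1 * cumul m n.
Proof.
elim/ltn_ind: n => n IHn.
have r0 : reI 0 = 1 :> R by []; have i0 : imI 0 = 0 :> R by [].
have sCn k : smooth U k C by []; have sSn k : smooth U k S by [].
have LC := smoothM oU (sLr n) (sCn n); have LS := smoothM oU (sLi n) (sSn n).
have LS' := smoothM oU (sLr n) (sSn n); have LC' := smoothM oU (sLi n) (sCn n).
have mn := moment_cumul n m0; rewrite big_ord_recr/= subnn m0 binn mul1r mulr1 in mn.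
split.
- have := C_at0 n.+1; rewrite derive1Sn (eq_derive1n oU n U0 C'E).
  rewrite (derive1nD oU U0 LC (smoothN oU LS)) (derive1nN oU U0 LS).
  rewrite (derive1n_mul oU U0 (sLr n) (sCn n)) (derive1n_mul oU U0 (sLi n) (sSn n)).
  under eq_bigr do rewrite C_at0.
  under [X in _ - X]eq_bigr do rewrite S_at0.
  rewrite -sumrB big_ord_recr/= subnn binn m0 r0 i0 !mul1r !mulr1 mulr0 subr0.
  under eq_bigr => k _.
    have [-> ->] := IHn k (ltn_ord k).
    (* Real part of i^(k+1) i^(n-k) = i^(n+1): the sum over k < n becomes that of the moment
       recursion and cancels. *)
    have -> : 'C(n, k)%:R * (reI k.+1 * cumul m k) * (reI (n - k) * m (n - k)%N) -
     'C(n, k)%:R * (imI k.+1 * cumul m k) * (imI (n - k) * m (n - k)%N) =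
      reI n.+1 * ('C(n, k)%:R * cumul m k * m (n - k)%N).
      have -> : n.+1 = (k.+1 + (n - k))%N by rewrite addSn subnKC// ltnW.
      by rewrite (ipowD _ _).1; ring.
    over.
  rewrite -mulr_sumr mn mulrDr => /addrI; exact.
- have := S_at0 n.+1; rewrite derive1Sn (eq_derive1n oU n U0 S'E).
  rewrite (derive1nD oU U0 LS' LC').
  rewrite (derive1n_mul oU U0 (sLr n) (sSn n)) (derive1n_mul oU U0 (sLi n) (sCn n)).
  under eq_bigr do rewrite S_at0.
  under [X in _ + X]eq_bigr do rewrite C_at0.
  rewrite -big_split big_ord_recr/= subnn binn m0 r0 i0 !mul1r !mulr1 mulr0 add0r.
  under eq_bigr => k _.
    have [-> ->] := IHn k (ltn_ord k).
    have -> : 'C(n, k)%:R * (reI k.+1 * cumul m k) * (imI (n - k) * m (n - k)%N) +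
     'C(n, k)%:R * (imI k.+1 * cumul m k) * (reI (n - k) * m (n - k)%N) =
      imI n.+1 * ('C(n, k)%:R * cumul m k * m (n - k)%N).
      have -> : n.+1 = (k.+1 + (n - k))%N by rewrite addSn subnKC// ltnW.
      by rewrite (ipowD _ _).2; ring.
    over.
  rewrite -mulr_sumr mn mulrDr => /addrI; exact.
Qed.

(** The derivative of ln |phi| is the real part of phi'/phi. *)
Let re_log_charE : {in U, derive1 (re_log_char X) =1 Lr}.
Proof.
move=> t; rewrite inE => Ut; have q0 := lt0r_neq0 Ut.
have dQ : is_derive t 1 Q (2 * (C t * derive1 C t + S t * derive1 S t)).
  apply: DeriveDef; first by apply: derivableD; apply: derivableM.
  rewrite -derive1E derive1D; [|exact: derivableM..].
  by rewrite !derive1M//; ring.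
have s0 : 0 < Num.sqrt (Q t) by rewrite sqrtr_gt0.
have h := @is_derive1_comp R (@ln R) _ t _ _ (is_derive1_ln s0)
  (is_derive1_comp (is_derive1_sqrt Ut) dQ).
have -> : re_log_char X = @ln R \o (Num.sqrt \o Q) by [].
rewrite derive1E (@derive_val _ _ _ _ _ _ _ h).
have := sqr_sqrtr (ltW Ut); rewrite /Lr => e; rewrite -[in RHS]e expr2.
by have := lt0r_neq0 s0 => ?; field.
Qed.

(** The sign (-1)^(n+1) in the definition cancels the real part of i^(2n+2). *)
Lemma cumulant_evenE n : cumulant_even X n.+1 = cumul m n.*2.+1.
Proof.
rewrite /cumulant_even doubleS derive1Sn (eq_derive1n oU _ U0 re_log_charE).
have [-> _] := log_char_derivs n.*2.+1.
by rewrite -doubleS reI_double mulrA -expr2 sqrr_sign mul1r.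
Qed.

End LogCharDerivatives.

(** * Comparison of two laws *)

Section MmseComparison.
Context {R : realType}.
Implicit Types (Q : {poly {poly R}}) (mu nu : probability R R).
Local Notation gauss := (@gauss R).
Local Notation has_moments mu :=
  (forall n, mu.-integrable setT (EFin \o (fun x : R => x ^+ n))).

(** Bounds the degree in y of Q(t) for all t at once, so that B can be fixed before t. *)
Definition max_size Q : nat := \max_(i < size Q) size (Q`_i)%R.

Lemma size_horner_polyC Q (c : R) : (size Q.[c%:P] <= max_size Q)%N.
Proof.
rewrite horner_coef (leq_trans (size_sum _ _ _))//; apply/bigmax_leqP => i _.
rewrite (leq_trans _ (@leq_bigmax _ (fun i : 'I_(size Q) => size (Q`_i)%R) i))// mulrC -polyC_exp mul_polyC.
exact: size_scale_leq.
Qed.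

Lemma excess_ge0 mu t q : has_moments mu -> (0 <= excess mu t q)%E.
Proof.
move=> mom; apply: integral_ge0 => y _; rewrite lee_fin divr_ge0 ?sqr_ge0//.
by rewrite ltW// evidence_gt0.
Qed.

Lemma risk_split mu t B Q : has_moments mu -> 0 < t ->
  (max_size Q <= B)%N -> (max_size (Q ^+ 2) <= B)%N ->
  (((risk B (moment mu) Q).[t])%:E = mmse_law mu (t ^+ 2) + excess mu t (horner Q.[t%:P]))%E.
Proof.
move=> mom t0 QB Q2B; have tE : Num.sqrt (t ^+ 2) = t by rewrite sqrtr_sqr gtr0_norm.
have := integral_sqr_obst_split mom (t ^+ 2) (@measurable_poly R Q.[t%:P] setT).
rewrite tE => <-; symmetry; apply: integral_risk => //.
  exact: leq_trans (size_horner_polyC _ _) QB.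
exact: leq_trans (size_horner_polyC _ _) Q2B.
Qed.

(** The risk of Q under nu is at least the common mmse, which is at least the risk of G under mu
    minus C t^(2M). *)
Lemma risk_comparison mu nu M Q : has_moments mu -> has_moments nu -> moment mu 1 = 0 ->
  (forall s, 0 < s -> mmse_law mu s = mmse_law nu s) ->
  let G := postpoly (moment mu) M in
  exists C N, 0 <= C /\ forall B, (N <= B)%N -> forall t, 0 < t -> t <= 1 ->
    - (C * t ^+ M.*2) <= (risk B (moment nu) Q - risk B (moment mu) G).[t].
Proof.
move=> mom_mu mom_nu centred mmseE G.
have [C C0 excessC] := excess_post_bound mom_mu centred M.
exists C, (max_size Q + max_size (Q ^+ 2) + max_size G + max_size (G ^+ 2))%N.
split=> // B NB t t0 t1.
have GE : (((risk B (moment mu) G).[t])%:E = mmse_law mu (t ^+ 2) + excess mu t (horner G.[t%:P]))%E.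
  apply: risk_split => //; apply: leq_trans NB; last exact: leq_addl.
  by rewrite -addnA (leq_trans (leq_addr (max_size (G ^+ 2)) _))// leq_addl.
have QE : (((risk B (moment nu) Q).[t])%:E = mmse_law nu (t ^+ 2) + excess nu t (horner Q.[t%:P]))%E.
  apply: risk_split => //; apply: leq_trans NB; rewrite -!addnA ?leq_addr//.
  by rewrite addnCA leq_addr.
rewrite hornerD hornerN lerBrDr addrC -lerBrDr opprK -lee_fin EFinD.
rewrite GE QE mmseE ?exprn_gt0//; move: (mmse_law nu _) => a.
rewrite -addeA; apply: leeD2l; rewrite (le_trans (excessC t t0 t1))//.
by rewrite leeDr// excess_ge0.
Qed.

Lemma moment0 mu : moment mu 0 = 1.
Proof.
have -> : moment mu 0 = \int[mu]_x cst 1 x by apply: eq_Rintegral => x _; rewrite expr0.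
by rewrite Rintegral_cst// mul1r [X in fine X](@probability_setT _ _ _ mu).
Qed.

(** The case M = 1: for a centred law the truncated estimator is 0, and the risks compared at order
    t^0 are second moments. *)
Lemma second_moment_le mu nu : has_moments mu -> has_moments nu -> moment mu 1 = 0 ->
  (forall s, 0 < s -> mmse_law mu s = mmse_law nu s) -> moment mu 2 <= moment nu 2.
Proof.
move=> mom_mu mom_nu centred mmseE.
have [C [N [C0 /(_ N (leqnn N)) cmp]]] := risk_comparison 1 0 mom_mu mom_nu centred mmseE.
have G0 : postpoly (moment mu) 1 = 0.
  apply/polyP => j; rewrite coef_poly coef0; case: ifP => //; rewrite ltnS leqn0 => /eqP ->.
  by rewrite post0 centred polyC0.
have risk0 (m : nat -> R) : risk N m 0 = (m 2)%:P.
  by rewrite /risk /mpol expr0n !mul0r map_poly0 scaler0 subr0 addr0.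
rewrite G0 !risk0 in cmp.
have := @poly_lead_ge0 R ((moment nu 2)%:P - (moment mu 2)%:P) C 1 0 ltr01.
rewrite coefB !coefC/= subr_ge0; apply=> // t t0 t1.
apply: le_trans (cmp t t0 (ltW t1)); rewrite lerN2 ler_wpM2l//.
by rewrite ler_wiXn2l// ltW.
Qed.

Section FirstGap.
Variables (mu nu : probability R R) (p : nat).
Hypotheses (mom_mu : has_moments mu) (mom_nu : has_moments nu).
Hypothesis centred : moment mu 1 = 0.
Hypothesis mmseE : forall s, 0 < s -> mmse_law mu s = mmse_law nu s.
Hypotheses (p2 : (2 <= p)%N) (munu : forall i, (i <= p)%N -> moment nu i = moment mu i).
Let d i := moment nu i - moment mu i.

(* For the law [nu], the estimator [postpoly (moment mu)] corrected by [perturb d p]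
   cannot do better than the mmse of [nu], which is that of [mu]. *)
Lemma first_gap : d p.+1 * (d p.+1 + 2 * cumul (moment mu) p) <= 0 /\
  (d p.+1 = - 2 * cumul (moment mu) p ->
   0 <= p.+2%:R * d p.+1 * (\sum_(i < p.+2) ncumul (moment mu) i * ncumul (moment mu) (p.+1 - i)%N)
  - 2%:R * d p.+2 * ncumul (moment mu) p.+1 - d p.+2 ^+ 2 / p.+1`!%:R
  + p.+2%:R * moment mu 2 * d p.+1 ^+ 2 / p`!%:R).
Proof.
pose G := postpoly (moment mu) p.+3; pose E := perturb d p.
have [C [N [C0 cmp]]] := risk_comparison p.+3 (G + E) mom_mu mom_nu centred mmseE.
pose B := maxn N p.+1.*2.+1.
have /cmp {}cmp : (N <= B)%N by exact: leq_maxl.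
have Bp : (p.+1.*2 < B)%N by exact: leq_maxr.
pose D := risk B (moment nu) (G + E) - risk B (moment mu) G.
(* With M = p+3 the error t^(2p+6) is below t^(n+1) for every order n <= 2p+2. *)
have bound n : (n <= p.*2.+2)%N -> forall t, 0 < t -> t < 1 -> - (C * t ^+ n.+1) <= D.[t].
  move=> np t t0 t1; apply: le_trans (cmp t t0 (ltW t1)); rewrite lerN2 ler_wpM2l//.
  by rewrite ler_wiXn2l ?(ltW t0) ?(ltW t1)//; lia.
have m0 := moment0.
have low i : (i < p.*2)%N -> D`_i = 0.
  by move=> ip; rewrite coefB (risk_diff_low (m0 _) munu p2 Bp ip) subrr.
have pf : 0 < p`!%:R^-1 :> R by rewrite invr_gt0 ltr0n fact_gt0.
have Dp : D`_p.*2 = - (d p.+1 * (d p.+1 + 2 * cumul (moment mu) p)) / p`!%:R.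
  by rewrite coefB (risk_diff_lead (m0 _) (m0 _) centred munu p2 Bp) /ncumul /d; ring.
split.
  have := poly_lead_ge0 ltr01 low (bound _ _); rewrite Dp pmulr_lge0// oppr_ge0; apply; lia.
move=> gap.
(* The assumption on d kills order 2p and parity kills order 2p+1, so order 2p+2 becomes the leading
   one. *)
have Dn : forall i, (i < p.*2.+2)%N -> D`_i = 0.
  move=> i; rewrite ltnS leq_eqVlt => /orP[/eqP ->|].
    by rewrite coefB (risk_diff_odd (m0 _) (m0 _) centred munu p2 Bp) subrr.
  rewrite ltnS leq_eqVlt => /orP[/eqP ->|]; last exact: low.
  by rewrite Dp gap mulNr addNr mulr0 oppr0 mul0r.
have := poly_lead_ge0 ltr01 Dn (bound _ (leqnn _)).
by rewrite coefB (risk_diff_next (m0 _) (m0 _) centred munu p2 Bp).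
Qed.

End FirstGap.

Lemma moments_eq mu nu : has_moments mu -> has_moments nu ->
  (forall i, odd i -> moment mu i = 0) -> moment nu 1 = 0 ->
  (forall j, 0 < (-1) ^+ j * cumul (moment mu) j.*2.+1) ->
  0 < cumul (moment nu) 3 * cumul (moment mu) 3 ->
  (forall s, 0 < s -> mmse_law mu s = mmse_law nu s) ->
  forall n, moment nu n = moment mu n.
Proof.
move=> mom_mu mom_nu mu_odd nu1 alt sign4 mmseE.
have mmseE' s : 0 < s -> mmse_law nu s = mmse_law mu s by move=> /mmseE.
have mu1 := mu_odd 1 isT.
suff all n : forall i, (i <= n)%N -> moment nu i = moment mu i by move=> n; exact: all (leqnn n).
elim: n => [|p IHp] i; first by rewrite leqn0 => /eqP ->; rewrite !moment0.
rewrite leq_eqVlt => /orP[/eqP -> {i}|]; last exact: IHp.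
have [p1|p2] := leqP p 1.
  move: p1; rewrite leq_eqVlt => /orP[/eqP ->|].
    by apply/le_anti/andP; split; exact: second_moment_le.
  by rewrite ltnS leqn0 => /eqP ->; rewrite nu1 mu1.
have [gap1 gap2] := first_gap mom_mu mom_nu mu1 mmseE p2 IHp.
have IHp' i : (i <= p)%N -> moment mu i = moment nu i by move=> /IHp.
have [gap3 _] := first_gap mom_nu mom_mu nu1 mmseE' p2 IHp'.
set d := moment nu p.+1 - moment mu p.+1 in gap1 gap2 gap3.
(* Moments up to order p agree, so only the leading term of the recursion changes. *)
have cumul_nu : cumul (moment nu) p = cumul (moment mu) p + d.
  rewrite cumulE [cumul (moment mu) p]cumulE /d.
  under eq_bigr => i _.
    rewrite IHp ?leq_subr// (@eq_cumul _ (moment nu) (moment mu)); first over.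
    by move=> j ji; apply: IHp; exact: leq_trans ji (ltn_ord i).
  by rewrite /=; ring.
(* After exchanging the laws d becomes -d and the cumulant gains d, so the second inequality reads -
   d (d + 2 K) <= 0. *)
have /eqP : d * (d + 2 * cumul (moment mu) p) = 0.
  by apply/le_anti; rewrite gap1/=; move: gap3; rewrite -opprB -/d cumul_nu; nra.
rewrite mulf_eq0 => /orP[/eqP/subr0_eq//|/eqP dE].
have {}dE : d = - 2 * cumul (moment mu) p by rewrite -[LHS]subr0 -dE; ring.
have [op|ep] := boolP (odd p); last first.
  by apply: subr0_eq; rewrite -/d dE odd_cumul ?mulr0.
have pE : p = p./2.*2.+1 by rewrite -{1}(odd_double_half p) op.
have [q1|q2] := leqP p./2 1.
  (* Order p+1 = 4: the fourth cumulants would be opposite, against [sign4]. *)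
  have p3 : p = 3 by lia.
  by move: sign4 cumul_nu; rewrite dE p3 => + e; rewrite e; nra.
have := next_coef_lt0 (moment nu p.+2 - moment mu p.+2) q2 (moment0 mu) mu_odd alt.
rewrite /= -pE => /(_ _ dE); rewrite ltNge => /negP []; exact: gap2.
Qed.

End MmseComparison.

(** * From random variables to their laws *)

Section Law.
Context d (T : measurableType d) (R : realType) (P : probability T R) (X : {RV P >-> R}).
Hypothesis mom : has_all_moments X.

Lemma distribution_integrableX n :
  (distribution P X).-integrable setT (EFin \o (fun x : R => x ^+ n)).
Proof.
have mX : measurable_fun setT X by exact: measurable_funP.
apply: (@integrable_pushforward _ _ _ _ R X _ P setT) => //.
- apply/measurable_EFinP; exact: (@measurable_funX _ R R setT id n).
- by rewrite preimage_setT; exact: mom.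
Qed.

Lemma moment_distribution n : moment (distribution P X) n = \int[P]_x (X x ^+ n).
Proof.
have mX : measurable_fun setT X by exact: measurable_funP.
congr fine; rewrite integral_distribution//.
- apply/measurable_EFinP; exact: (@measurable_funX _ R R setT id n).
- exact: mom.
Qed.

Lemma symmetric_odd_moment n :
  (forall A, measurable A -> P (X @^-1` A) = P ((fun x => - X x) @^-1` A)) ->
  odd n -> \int[P]_x (X x ^+ n) = 0.
Proof.
move=> sym on; pose X' : {RV P >-> R} := (- X)%R.
have mX : measurable_fun setT (EFin \o (fun x : R => x ^+ n)).
  by apply/measurable_EFinP; exact: (@measurable_funX _ R R setT id n).
have powN x : X' x ^+ n = - X x ^+ n by rewrite /X'/= exprNn -signr_odd on expr1 mulN1r.
have im := mom n.
have im' : P.-integrable setT (fun x => (X' x ^+ n)%:E).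
  by under eq_fun do rewrite powN EFinN; exact: integrableN.
suff E : \int[P]_x (X x ^+ n) = \int[P]_x (X' x ^+ n).
  have : \int[P]_x (X' x ^+ n) = - \int[P]_x (X x ^+ n).
    rewrite -mulN1r -RintegralZl//; apply: eq_Rintegral => x _.
    by rewrite powN mulN1r.
  by rewrite -E; lra.
congr fine; rewrite -(@integral_distribution _ _ _ _ _ P X _ mX im).
rewrite -(@integral_distribution _ _ _ _ _ P X' _ mX im').
by apply: eq_measure_integral => A mA _; exact: sym.
Qed.

Lemma EFin_RintegralX n :
  (\int[P]_x (X x ^+ n))%:E = (\int[P]_x (X x ^+ n)%:E)%E.
Proof. by rewrite fineK//; apply: integrable_fin_num => //; exact: mom. Qed.

End Law.

Theorem theorem2p9 (R : realType)
  (d : measure_display) (T : measurableType d) (P : probability T R)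
  (X : {RV P >-> R})
  (d' : measure_display) (T' : measurableType d') (Q : probability T' R)
  (Y : {RV Q >-> R}) :
  SMD X ->
  (forall n : nat, (1 <= n)%N ->
     cumulant_even X n * cumulant_even X n.+1 < 0) ->
  ('E_Q[Y] = 0)%E ->
  has_all_moments Y ->
  0 < cumulant_even Y 2 * cumulant_even X 2 ->
  (forall s : R, 0 < s -> mmse X s = mmse Y s) ->
  same_law X Y.
Proof.
move=> [sym momX det] altX centY momY sign4 mmseE.
pose mu := distribution P X; pose nu := distribution Q Y.
have muE : moment mu = fun n => \int[P]_x (X x ^+ n).
  by apply/funext => n; exact: moment_distribution.
have nuE : moment nu = fun n => \int[Q]_x (Y x ^+ n).
  by apply/funext => n; exact: moment_distribution.
have cX n : cumulant_even X n.+1 = cumul (moment mu) n.*2.+1 by rewrite cumulant_evenE// muE.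
have cY n : cumulant_even Y n.+1 = cumul (moment nu) n.*2.+1 by rewrite cumulant_evenE// nuE.
have mu_odd i : odd i -> moment mu i = 0.
  by move=> oi; rewrite muE symmetric_odd_moment.
have nu1 : moment nu 1 = 0.
  rewrite nuE; move: centY; rewrite unlock => /(congr1 fine) /= <-.
  by apply: eq_Rintegral => x _; rewrite expr1.
have alt n : cumul (moment mu) n.*2.+1 * cumul (moment mu) n.+1.*2.+1 < 0.
  by rewrite -!cX; exact: altX.
have alt' j : 0 < (-1) ^+ j * cumul (moment mu) j.*2.+1.
  elim: j => [|j IHj].
    (* K_2 is a second moment, hence nonnegative, and it is nonzero because K_2 K_4 < 0; this fixes
       the signs of all even cumulants. *)
    have k0 := alt 0; rewrite mul1r lt_neqAle eq_sym; apply/andP; split.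
      by apply/eqP => e; move: k0; rewrite e mul0r ltxx.
    rewrite cumulE big_ord1 subn0 (mu_odd 1)// mulr0 subr0 muE.
    by apply: Rintegral_ge0 => x _; exact: sqr_ge0.
  move: (alt j) IHj; rewrite exprS mulN1r mulNr oppr_gt0.
  move: (cumul _ j.*2.+1) (cumul _ j.+1.*2.+1) => a b ab.
  rewrite -signr_odd; case: (odd j); rewrite ?expr0 ?expr1 ?mul1r ?mulN1r.
    by rewrite !oppr_cp0 => a0; rewrite nmulr_rlt0 in ab.
  by move=> a0; rewrite pmulr_rlt0 in ab.
have eqm := moments_eq (distribution_integrableX momX) (distribution_integrableX momY)
  mu_odd nu1 alt' _ mmseE.
(* Determinacy is assumed for X and concludes from Y to X, hence the symmetry. *)
move=> A mA; symmetry; apply: det => // p _; split; first exact: momY.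
have sign : 0 < cumul (moment nu) 3 * cumul (moment mu) 3 by rewrite -(cX 1) -(cY 1).
have := eqm sign p; rewrite muE nuE unlock => e.
by rewrite -(EFin_RintegralX momX) -(EFin_RintegralX momY) e.
Qed.
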